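(* Let $\mu$ be a continuous, finite, non-negative Borel measure on $\mathbb{R}^5$. Then $\mu$ admits an equipartition by $4$ hyperplanes. Moreover, given in advance $\nu_1,\nu_2,\nu_3,\nu_4$, each of which is a measurable set (or a continuous, finite, non-negative Borel measure) in $\mathbb{R}^5$, and a measurable set $B\subset\mathbb{R}^5$, there exists an equipartition of $\mu$ by $4$ hyperplanes such that one of these hyperplanes is a common bisector of $\nu_1,\nu_2,\nu_3,\nu_4$ and one of the three remaining hyperplanes is a bisector of $B$.
   Context: Hyperplanes are affine hyperplanes. A Borel measure on $\mathbb{R}^d$ is called continuous if every hyperplane has measure zero. For an oriented hyperplane $h$ in $\mathbb{R}^d$, $h^+$ and $h^-$ denote the two closed half-spaces bounded by $h$. For a $k$-tuple $h_1,\dots,h_k$ of oriented hyperplanes, the associated $2^k$ hyperorthants are the sets $O_\epsilon=h_1^{\epsilon_1}\cap\dots\cap h_k^{\epsilon_k}$, $\epsilon\in\{+,-\}^k$. The hyperplanes $h_1,\dots,h_k$ form an equipartition of a finite measure $\mu$ if $\mu(O_\epsilon)=\frac{1}{2^k}\mu(\mathbb{R}^d)$ for every $\epsilon\in\{+,-\}^k$ (independent of the chosen orientations). A hyperplane $h$ is a bisector of a measure $\nu$ if $\nu(h^+)=\nu(h^-)$. ''Measurable set'' means a Lebesgue measurable set of finite Lebesgue measure, and a hyperplane $h$ is a bisector of such a set $B$ if $m(B\cap h^+)=m(B\cap h^-)$, where $m$ is Lebesgue measure. *)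

(* Defs.v *)
From HB Require Import structures.
From mathcomp Require Import all_boot all_order all_algebra.
From mathcomp Require Import all_classical all_reals all_analysis.

Set Implicit Arguments.
Unset Strict Implicit.
Unset Printing Implicit Defensive.
Import Order.TTheory GRing.Theory Num.Theory.
Import numFieldNormedType.Exports.

Local Open Scope classical_set_scope.
Local Open Scope ring_scope.

Definition borel (R : realType) (d : nat) := g_sigma_algebraType (@open 'rV[R]_d).

HB.instance Definition _ (R : realType) (d : nat) := Measurable.on (borel R d).

Notation borel_measure R d := {finite_measure set (borel R d) -> \bar R}.

(* The oriented affine hyperplane { x | <normal, x> = offset }; its positive
   side is the one its normal vector points to. *)
Record hyperplane (R : realType) (d : nat) := Hyperplane {
  normal : 'rV[R]_d ;
  offset : R ;
  normal_neq0 : normal != 0 }.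

Definition height (R : realType) (d : nat) (h : hyperplane R d) (x : 'rV[R]_d) : R :=
  \sum_(i < d) normal h ord0 i * x ord0 i - offset h.

Definition hyperplane_set (R : realType) (d : nat) (h : hyperplane R d) : set 'rV[R]_d :=
  [set x | height h x = 0].

(* Closed half-spaces: h^+ is [halfspace h true], h^- is [halfspace h false]. *)
Definition halfspace (R : realType) (d : nat) (h : hyperplane R d) (e : bool) :
    set 'rV[R]_d :=
  if e then [set x | 0 <= height h x] else [set x | height h x <= 0].

Definition hyperorthant (R : realType) (d k : nat) (h : 'I_k -> hyperplane R d)
    (e : 'I_k -> bool) : set 'rV[R]_d :=
  \bigcap_(i in [set: 'I_k]) halfspace (h i) (e i).

Definition continuous_measure (R : realType) (d : nat) (mu : borel_measure R d) : Prop :=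
  forall h : hyperplane R d, mu (hyperplane_set h) = 0%E.

Definition equipartition (R : realType) (d k : nat) (mu : borel_measure R d)
    (h : 'I_k -> hyperplane R d) : Prop :=
  forall e : 'I_k -> bool,
    mu (hyperorthant h e) = ((2 ^- k)%:E * mu [set: 'rV[R]_d])%E.

Definition box (R : realType) (d : nat) (a b : 'rV[R]_d) : set 'rV[R]_d :=
  [set x | forall i, x ord0 i \in `]a ord0 i, b ord0 i]].

(* Lebesgue outer measure on R^d, for d > 0 (for d = 0 every box has volume 1,
   so the value is always +oo). *)
Definition lebesgue_outer (R : realType) (d : nat) (X : set 'rV[R]_d) : \bar R :=
  ereal_inf [set v | exists a b : nat -> 'rV[R]_d,
    [/\ forall k i, a k ord0 i <= b k ord0 i,
        X `<=` \bigcup_k box (a k) (b k) &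
        v = (\sum_(0 <= k <oo) (\prod_(i < d) (b k ord0 i - a k ord0 i))%:E)%E]].

Definition finite_lebesgue_measurable (R : realType) (d : nat) (B : set 'rV[R]_d) : Prop :=
  (@lebesgue_outer R d).-caratheodory B /\ (lebesgue_outer B < +oo)%E.

Definition bisects_measure (R : realType) (d : nat) (h : hyperplane R d)
    (nu : borel_measure R d) : Prop :=
  nu (halfspace h true) = nu (halfspace h false).

(* On Lebesgue measurable sets, Lebesgue measure is the outer measure. *)
Definition bisects_set (R : realType) (d : nat) (h : hyperplane R d)
    (B : set 'rV[R]_d) : Prop :=
  lebesgue_outer (B `&` halfspace h true) = lebesgue_outer (B `&` halfspace h false).

Inductive mass (R : realType) (d : nat) :=
| MassSet of set 'rV[R]_d
| MassMeasure of borel_measure R d.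

Definition admissible (R : realType) (d : nat) (nu : mass R d) : Prop :=
  match nu with
  | MassSet B => finite_lebesgue_measurable B
  | MassMeasure m => continuous_measure m
  end.

Definition bisects (R : realType) (d : nat) (h : hyperplane R d) (nu : mass R d) : Prop :=
  match nu with
  | MassSet B => bisects_set h B
  | MassMeasure m => bisects_measure h m
  end.

(* Main.v *)
(** The heart is a Borsuk-Ulam type theorem for [(S^5)^3] under the group
    generated by the three antipodes and the exchange of the first two spheres:
    an equivariant continuous map to [R^15], whose coordinates carry prescribed
    characters, has a zero as soon as its coordinate [XY0] is positive on the
    diagonal [x = y].  Spheres are boundaries of cubes, subdivided into finer and
    finer simplices.  For generic vertex values, the number of top simplices
    whose convex hull contains the origin keeps its residue modulo twice the
    order of the group when the values are changed orbit by orbit: by Gale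
    duality, origin-containing simplices appear or disappear in pairs.  An
    explicit map ([std_map]) with a single orbit of nondegenerate zeros shows
    that this residue is not zero; compactness does the rest.

    A point of [S^5] encodes an oriented affine hyperplane of [R^5], possibly at
    infinity.  Applied to signed sums of the masses of the open octants, the
    theorem cuts two measures into eight equal parts by three planes, one of which
    also halves a third measure; the ham sandwich theorem follows from the same
    theorem with another test map.  Halve [mu] and all [nu i] by a first
    hyperplane, and then take the two halves of [mu], together with [B].  If [mu]
    vanishes, it is first replaced by a measure carried by the moment curve. *)

(* Sign changes alone would prove nothing: [std_map] has 16 zeros, which form two orbits under the
   eight sign changes, and an even number of orbits leaves no residue. The exchange of the first two
   spheres fuses them into a single orbit, and 16 is not 0 modulo 32. The price is that the exchange
   does not act freely: it fixes points with x = y and, combined with two antipodes, points with x =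
   -y. This explains the condition on [XY0]. By equivariance its sign is known on both sets, so no
   simplex near them has the origin in its hull, and the count may ignore them. The number of
   conditions is exact: 15 = 3 * 5 is the dimension of the product of spheres. Each of two measures
   uses the seven nontrivial characters of (Z/2)^3, which makes 14, and the one left over halves a
   third measure by the third plane. That extra condition singles out the third sphere, so only the
   other two may be exchanged. *)
From HB Require Import structures.
From mathcomp Require Import all_boot all_order all_algebra.
From mathcomp Require Import boolp ring lra zify.

Set Implicit Arguments.
Unset Strict Implicit.
Unset Printing Implicit Defensive.
Import Order.TTheory GRing.Theory Num.Theory.
Local Open Scope ring_scope.

(** * Linear dependence and Gale duality *)

Lemma linear_dependence (R : fieldType) (I J : finType) (A : {set I}) (Q : I -> J -> R) :
  (#|J| < #|A|)%N ->
  exists l : I -> R,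
    [/\ exists2 i, i \in A & l i != 0, forall i, i \notin A -> l i = 0
      & forall j, \sum_(i in A) l i * Q i j = 0].
Proof.
move=> ltJA.
pose M := \matrix_(i < #|A|, j < #|J|) Q (enum_val i) (enum_val j).
have kM : kermx M != 0.
  by rewrite kermx_eq0 /row_free neq_ltn (leq_ltn_trans (rank_leq_col M) ltJA).
pose u := nz_row (kermx M).
have u0 : u != 0 by rewrite nz_row_eq0.
have uM : u *m M = 0 by apply/sub_kermxP; exact: nz_row_sub.
pose l i := \sum_(k < #|A| | enum_val k == i) u 0 k.
have lE k : l (enum_val k) = u 0 k.
  by rewrite /l (big_pred1 k) // => k' /=; rewrite (inj_eq enum_val_inj).
exists l; split.
- have [k uk] : exists k, u 0 k != 0.
    apply/existsP; apply: contraNT u0 => /existsPn u0.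
    by apply/eqP/rowP => k; rewrite mxE; apply/eqP; have := u0 k; rewrite negbK.
  by exists (enum_val k); [exact: enum_valP|rewrite lE].
- move=> i iA; rewrite /l big_pred0 // => k.
  by apply: contraNF iA => /eqP <-; exact: enum_valP.
- move=> j; rewrite big_enum_val /=.
  transitivity ((u *m M) 0 (enum_rank j)); last by rewrite uM mxE.
  rewrite mxE.
  by apply: eq_bigr => k _; rewrite mxE enum_rankK lE.
Qed.

(** Fewer vectors than coordinates lie in a common hyperplane, with normal vector [c]: this is
    [linear_dependence] with the roles of vectors and coordinates exchanged. *)
Lemma annihilator (R : fieldType) (I J : finType) (A : {set I}) (Q : I -> J -> R) :
  (#|A| < #|J|)%N ->
  exists c : J -> R, (exists j, c j != 0) /\
    forall i, i \in A -> \sum_j c j * Q i j = 0.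
Proof.
move=> ltAJ.
have := @linear_dependence R J {i | i \in A} [set: J] (fun j i => Q (val i) j).
rewrite card_sig cardsT => /(_ ltAJ) [c [[j _ cj] _ cQ]].
exists c; split; first by exists j.
move=> i iA; rewrite -[RHS](cQ (Sub i iA)); apply: eq_bigl => k.
by rewrite inE.
Qed.

Section Hulls.
Variables (R : realFieldType) (J : finType).

(** Linear independence of the family indexed by [A], so that repeated vectors are dependent. *)
Definition li (I : finType) (A : {set I}) (Q : I -> J -> R) : Prop :=
  forall l : I -> R, (forall j, \sum_(i in A) l i * Q i j = 0) ->
  forall i, i \in A -> l i = 0.

Definition hull0 (I : finType) (A : {set I}) (Q : I -> J -> R) : Prop :=
  exists l : I -> R,
    [/\ forall i, i \in A -> 0 <= l i, \sum_(i in A) l i = 1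
      & forall j, \sum_(i in A) l i * Q i j = 0].

Lemma hull0_sep (I : finType) (A : {set I}) (Q : I -> J -> R) (s : R) (j : J) :
  (forall i, i \in A -> 0 < s * Q i j) -> ~ hull0 A Q.
Proof.
move=> sQ [l [l0 l1 lQ]].
have /eqP : \sum_(i in A) l i * (s * Q i j) = 0.
  rewrite (eq_bigr (fun i => s * (l i * Q i j))) => [|i _]; last by ring.
  by rewrite -big_distrr /= lQ mulr0.
rewrite psumr_eq0 => [/allP h|i iA]; last first.
  by rewrite mulr_ge0 ?l0 // ltW // sQ.
suff : \sum_(i in A) l i = 0 by rewrite l1 => /eqP; rewrite oner_eq0.
apply: big1 => i iA; have := h i (mem_index_enum _); rewrite iA /=.
by rewrite mulf_eq0 (gt_eqF (sQ i iA)) orbF => /eqP.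
Qed.

Lemma eq_hull0 (I : finType) (A : {set I}) (Q Q' : I -> J -> R) :
  (forall i, i \in A -> Q i = Q' i) -> hull0 A Q -> hull0 A Q'.
Proof.
move=> QQ' [l [l0 l1 lQ]]; exists l; split=> // j.
by rewrite -[RHS](lQ j); apply: eq_bigr => i iA; rewrite QQ'.
Qed.

Lemma eq_li (I : finType) (A : {set I}) (Q Q' : I -> J -> R) :
  (forall i, i \in A -> Q i = Q' i) -> li A Q -> li A Q'.
Proof.
move=> QQ' h l lQ; apply: h => j.
by rewrite -[RHS](lQ j); apply: eq_bigr => i iA; rewrite QQ'.
Qed.

Lemma hull0_imset (I I' : finType) (f : I -> I') (A : {set I}) (Q : I' -> J -> R) :
  {in A &, injective f} -> hull0 (f @: A) Q <-> hull0 A (Q \o f).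
Proof.
move=> finj; split=> [[l [l0 l1 lQ]]|[l [l0 l1 lQ]]].
  exists (l \o f); split.
  - by move=> i iA; apply: l0; exact: imset_f.
  - by rewrite -l1 big_imset.
  - by move=> j; rewrite -[RHS](lQ j) big_imset.
pose l' i' := \sum_(i in A | f i == i') l i.
have l'E i : i \in A -> l' (f i) = l i.
  move=> iA; rewrite /l' (big_pred1 i) // => k /=.
  apply/andP/eqP => [[kA /eqP /finj]|->]; first exact.
  by rewrite iA.
exists l'; split.
- by move=> _ /imsetP[i iA ->]; rewrite l'E ?l0.
- by rewrite big_imset // -[RHS]l1; apply: eq_bigr => i iA; rewrite l'E.
- move=> j; rewrite big_imset // -[RHS](lQ j).
  by apply: eq_bigr => i iA; rewrite l'E.
Qed.

Lemma li_imset (I I' : finType) (f : I -> I') (A : {set I}) (Q : I' -> J -> R) :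
  {in A &, injective f} -> li (f @: A) Q <-> li A (Q \o f).
Proof.
move=> finj; split=> h l lQ.
  pose l' i' := \sum_(i in A | f i == i') l i.
  have l'E i : i \in A -> l' (f i) = l i.
    move=> iA; rewrite /l' (big_pred1 i) // => k /=.
    apply/andP/eqP => [[kA /eqP /finj]|->]; first exact.
    by rewrite iA.
  have {}h := h l' _; move=> i iA; rewrite -l'E //; apply: h; last exact: imset_f.
  move=> j; rewrite big_imset // -[RHS](lQ j).
  by apply: eq_bigr => k kA; rewrite l'E.
move=> _ /imsetP[i iA ->]; apply: (h (l \o f)) => // j.
by rewrite -[RHS](lQ j) big_imset.
Qed.

Section Gale.
Variables (I : finType) (A : {set I}) (Q : I -> J -> R).
Hypothesis cardA : #|A| = #|J|.+2.
Hypothesis genA : forall B : {set I}, B \subset A -> #|B| = #|J| -> li B Q.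

Let ker (l : I -> R) := forall j, \sum_(i in A) l i * Q i j = 0.

(** Without [i] and [k] only [#|J|] vectors remain, and these are independent by [genA]. *)
Let ker_two_zeros l i k : ker l -> i \in A -> k \in A -> i != k ->
  l i = 0 -> l k = 0 -> forall m, m \in A -> l m = 0.
Proof.
move=> kl iA kA ik li0 lk0 m mA.
have [->//|mi] := eqVneq m i; have [->//|mk] := eqVneq m k.
have kA' : k \in A :\ i by rewrite !inE eq_sym ik.
apply: (genA (B := A :\ i :\ k)); rewrite ?subDset ?in_setD1 ?mi ?mk //.
- by apply/subsetP => z; rewrite !inE => ->; rewrite !orbT.
- by have := cardsD1 i A; have := cardsD1 k (A :\ i); rewrite iA kA' cardA; lia.
- move=> j; rewrite -[RHS](kl j) [RHS](big_setD1 i) //= li0 mul0r add0r.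
  by rewrite [RHS](big_setD1 k) //= lk0 mul0r add0r.
Qed.

(** Convex weights on the facet opposite to [i] extend by 0 to the kernel. They are positive off
    [i], since a second zero would kill them all; conversely such a kernel vector can be
    normalized. *)
Let hull0_ker i : i \in A -> hull0 (A :\ i) Q <->
  exists l, [/\ ker l, l i = 0 & forall k, k \in A -> k != i -> 0 < l k].
Proof.
move=> iA; split=> [[l [l0 l1 lQ]]|[l [kl li0 l0]]].
  pose l' k := if k == i then 0 else l k.
  have kl' : ker l'.
    move=> j; rewrite (big_setD1 i) //= {1}/l' eqxx mul0r add0r -[RHS](lQ j).
    by apply: eq_bigr => k; rewrite !inE /l' => /andP[/negbTE-> _].
  have l'i : l' i = 0 by rewrite /l' eqxx.
  exists l'; split=> // k kA ki; rewrite lt_def.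
  have -> : 0 <= l' k by rewrite /l' (negbTE ki) l0 // !inE ki.
  rewrite andbT; apply/eqP => l'k.
  have ik : i != k by rewrite eq_sym.
  have l'0 := ker_two_zeros kl' iA kA ik l'i l'k.
  have /eqP : 1 = 0 :> R; last by rewrite oner_eq0.
  rewrite -l1; apply: big1 => m; rewrite !inE => /andP[mi mA].
  by have := l'0 m mA; rewrite /l' (negbTE mi).
have S0 : 0 < \sum_(k in A :\ i) l k.
  have [k kA] : exists k, k \in A :\ i.
    apply/set0Pn; rewrite -card_gt0; have := cardsD1 i A; rewrite iA cardA; lia.
  rewrite (big_setD1 k) //= ltr_wpDr //; last first.
    by move: kA; rewrite !inE => /andP[ki kA]; exact: l0.
  by apply: sumr_ge0 => m; rewrite !inE => /and3P[_ mi mA]; rewrite ltW // l0.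
set S := \sum_(k in A :\ i) l k in S0.
exists (fun k => l k / S); split.
- by move=> k; rewrite !inE => /andP[ki kA]; rewrite divr_ge0 ?ltW // l0.
- by rewrite -big_distrl /= divff // gt_eqF.
- move=> j; transitivity (S^-1 * \sum_(k in A) l k * Q k j); last by rewrite kl mulr0.
  rewrite [in RHS](big_setD1 i) //= li0 mul0r add0r big_distrr /=.
  by apply: eq_bigr => k _; ring.
Qed.

(* The kernel of the [n+2] vectors is a plane [K] in which no nonzero vector
   has two vanishing entries.  The [i] in question correspond to the boundary
   rays of the cone of nonnegative vectors of [K], so there are 0 or 2 of them. *)
Lemma hull0_facets_even : ~~ odd #|[set i in A | `[< hull0 (A :\ i) Q >]]|.
Proof.
have [->|/set0Pn[i0]] := eqVneq [set i in A | `[< hull0 (A :\ i) Q >]] set0.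
  by rewrite cards0.
rewrite inE => /andP[i0A /asboolP/(hull0_ker i0A)[b [kb bi0 b0]]].
have [j0 j0A] : exists k, k \in A :\ i0.
  apply/set0Pn; rewrite -card_gt0; have := cardsD1 i0 A; rewrite i0A cardA; lia.
have /andP[j0i0 j0A'] : (j0 != i0) && (j0 \in A) by move: j0A; rewrite !inE.
(* With [b], this gives a basis of the kernel: [b] vanishes at [i0] and [a] does not. *)
have [a [ka ai0 aj0]] : exists a, [/\ ker a, a i0 = 1 & a j0 = 0].
  have : (#|J| < #|A :\ j0|)%N.
    by have := cardsD1 j0 A; rewrite j0A' cardA; lia.
  move=> /(@linear_dependence _ _ _ _ Q)[a [[k kA ak] aout aQ]].
  have ka : ker a.
    by move=> j; rewrite (big_setD1 j0) //= aout ?mul0r ?add0r // !inE eqxx.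
  have aj0 : a j0 = 0 by rewrite aout // !inE eqxx.
  have ai0 : a i0 != 0.
    apply: contraNneq ak => ai0; apply/eqP.
    apply: (ker_two_zeros ka j0A' i0A j0i0 aj0 ai0).
    by move: kA; rewrite inE => /andP[].
  exists (fun i => a i / a i0); split.
  - move=> j; transitivity ((a i0)^-1 * \sum_(i in A) a i * Q i j).
      by rewrite big_distrr; apply: eq_bigr => i _ /=; ring.
    by rewrite ka mulr0.
  - by rewrite divff.
  - by rewrite aj0 mul0r.
(* Moving from [a] in the direction of [b], all entries are nonnegative from the time [s] on, and
   the entry [j1] is the last to reach 0. Thus [g] spans the other boundary ray. *)
pose j1 := [arg max_(k > j0 in A :\ i0) (- a k / b k)]%O.
have [j1A j1max] : j1 \in A :\ i0 /\ forall k, k \in A :\ i0 -> - a k / b k <= - a j1 / b j1.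
  by rewrite /j1; case: Order.TotalTheory.arg_maxP => // k kA kmax; split.
have /andP[j1i0 j1A'] : (j1 != i0) && (j1 \in A) by move: j1A; rewrite !inE.
pose s := - a j1 / b j1.
pose g i := a i + s * b i.
have kg : ker g.
  move=> j; transitivity (\sum_(i in A) a i * Q i j + s * \sum_(i in A) b i * Q i j).
    by rewrite big_distrr -big_split; apply: eq_bigr => i _ /=; rewrite /g; ring.
  by rewrite ka kb mulr0 addr0.
have gi0 : g i0 = 1 by rewrite /g ai0 bi0 mulr0 addr0.
have gj1 : g j1 = 0.
  by rewrite /g /s -mulrA mulVf ?mulr1 ?subrr // gt_eqF // b0.
have gpos k : k \in A -> k != j1 -> 0 < g k.
  move=> kA kj1; have [->|ki0] := eqVneq k i0; first by rewrite gi0.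
  rewrite lt_def; apply/andP; split.
    apply/eqP => gk; have jk : j1 != k by rewrite eq_sym.
    by have /eqP := ker_two_zeros kg j1A' kA jk gj1 gk i0A; rewrite gi0 oner_eq0.
  have kA' : k \in A :\ i0 by rewrite !inE ki0.
  have := j1max k kA'; rewrite ler_pdivrMr ?b0 // -/s /g; lra.
suff -> : [set i in A | `[< hull0 (A :\ i) Q >]] = [set i0; j1].
  by rewrite cards2 eq_sym j1i0.
apply/setP => i; rewrite !inE; apply/andP/orP => [[iA /asboolP/(hull0_ker iA)]|]; last first.
  case=> /eqP->; split=> //; apply/asboolP/hull0_ker => //.
    by exists b.
  by exists g; split.
move=> [h [kh hi hpos]].
have [->|ii0] := eqVneq i i0; [by left|right].
have hi0 : 0 < h i0 by apply: hpos; rewrite // eq_sym.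
(* For a third ray [h], the vector [e] vanishes at [i0], so it is a multiple [c] of [b]. Its entry
   at [i] is negative and its entry at [j1] is positive, whereas [b] is positive at both. *)
pose e k := h k / h i0 - g k.
have ke : ker e.
  move=> j; transitivity ((h i0)^-1 * (\sum_(i in A) h i * Q i j) - \sum_(i in A) g i * Q i j).
    by rewrite big_distrr -sumrB; apply: eq_bigr => k _ /=; rewrite /e; ring.
  by rewrite kh kg mulr0 subrr.
have ei0 : e i0 = 0 by rewrite /e gi0 divff ?subrr // gt_eqF.
pose c := e j1 / b j1.
have ecb k : k \in A -> e k = c * b k.
  pose f k := e k - c * b k.
  have kf : ker f.
    move=> j; transitivity ((\sum_(i in A) e i * Q i j) - c * \sum_(i in A) b i * Q i j).
      by rewrite big_distrr -sumrB; apply: eq_bigr => m _ /=; rewrite /f; ring.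
    by rewrite ke kb mulr0 subrr.
  have fi0 : f i0 = 0 by rewrite /f ei0 bi0 mulr0 subrr.
  have fj1 : f j1 = 0 by rewrite /f /c -mulrA mulVf ?mulr1 ?subrr // gt_eqF // b0.
  move=> kA; apply/eqP; rewrite -subr_eq0; apply/eqP.
  by apply: (ker_two_zeros kf j1A' i0A j1i0 fj1 fi0).
apply: contraT => ij1.
have bj1 : 0 < b j1 by rewrite b0.
have bi : 0 < b i by rewrite b0.
have := gpos i iA ij1; have := ecb i iA; rewrite /e hi mul0r add0r => gi gi'.
have := ecb j1 j1A'; rewrite /e gj1 subr0 => hj1.
have hj1' : 0 < h j1 by apply: hpos; rewrite // eq_sym.
have c0 : 0 < c by rewrite -(pmulr_lgt0 _ bj1) -hj1 divr_gt0.
by have := mulr_gt0 c0 bi; rewrite -gi; lra.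
Qed.

End Gale.
End Hulls.

(** * Parity of origin-containing simplices *)

Lemma card_set_sum (I : finType) (A : {set I}) (P : pred I) :
  #|[set x in A | P x]| = (\sum_(x in A) P x)%N.
Proof.
rewrite -sum1_card big_mkcond [RHS]big_mkcond; apply: eq_bigr => x _.
by rewrite inE; case: (x \in A) => //=; case: (P x).
Qed.

Lemma even_sum (I : finType) (P : pred I) (F : I -> nat) :
  (forall i, P i -> ~~ odd (F i)) -> ~~ odd (\sum_(i | P i) F i)%N.
Proof.
move=> h; apply: (big_ind (fun n => ~~ odd n)) => // m n.
by rewrite oddD => /negbTE-> /negbTE->.
Qed.

Lemma even_involution (I : finType) (A : {set I}) (f : I -> I) :
  (forall x, x \in A -> [/\ f x \in A, f x != x & f (f x) = x]) -> ~~ odd #|A|.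
Proof.
have [n] := ubnP #|A|; elim: n A => // n IH A ltn fA.
have [->|/set0Pn[x xA]] := eqVneq A set0; first by rewrite cards0.
have [fxA fxx ffx] := fA x xA.
have fxA' : f x \in A :\ x by rewrite !inE fxx.
have cA : #|A| = (#|A :\ x :\ f x|).+2.
  by rewrite (cardsD1 x) xA (cardsD1 (f x)) fxA'.
rewrite cA /= negbK; apply: IH; first by lia.
move=> y; rewrite !inE => /and3P[yfx yx yA]; have [fyA fyy ffy] := fA y yA.
split=> //; rewrite fyA andbT; apply/andP; split.
  by apply: contra yx => /eqP e; rewrite -ffy e ffx.
by apply: contra yfx => /eqP e; rewrite -ffy e.
Qed.

(* Summing the parities of the facets of the simplices [None |: Some @: s],
   [s] in the star of [v], leaves only the two terms below: every other facet
   contains [None] and [Some v] and is counted an even number of times. *)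
Lemma star_parity (T : finType) (S : {set {set T}}) (v : T) (h : {set option T} -> bool) :
  (forall r : {set T}, ~~ odd #|[set u | (u \notin r) && ((u |: r) \in S)]|) ->
  (forall s, s \in S -> v \in s ->
     ~~ odd #|[set i in None |: Some @: s | h ((None |: Some @: s) :\ i)]|) ->
  odd #|[set s in S | (v \in s) && h (Some @: s)]| =
  odd #|[set s in S | (v \in s) && h (None |: Some @: (s :\ v))]|.
Proof.
move=> thin facets.
pose St := [set s in S | v \in s].
have cE (g : pred {set T}) : #|[set s in S | (v \in s) && g s]| = (\sum_(s in St) g s)%N.
  by rewrite -card_set_sum; apply: eq_card => s; rewrite !inE andbA.
have Sinj : injective (@Some T) by move=> a b [].
have NS (s : {set T}) : None \notin Some @: s by apply/imsetP => -[].
have SomeD (s : {set T}) u : (None |: Some @: s) :\ Some u = None |: Some @: (s :\ u).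
  apply/setP => -[w|]; rewrite !inE //=.
  rewrite !(mem_imset _ _ Sinj) !inE.
  by rewrite (inj_eq Sinj).
have NoneD (s : {set T}) : (None |: Some @: s) :\ None = Some @: s.
  apply/setP => -[w|]; rewrite !inE //=.
  by apply/esym/negbTE.
rewrite !cE.
suff: ~~ odd (\sum_(s in St) h (Some @: s) + \sum_(s in St) h (None |: Some @: (s :\ v)))%N.
  by rewrite oddD; do 2 case: (odd _).
pose rest := (\sum_(s in St) \sum_(u in s :\ v) h (None |: Some @: (s :\ u)))%N.
suff rest_even : ~~ odd rest.
  suff: ~~ odd (\sum_(s in St) h (Some @: s) + \sum_(s in St) h (None |: Some @: (s :\ v)) + rest)%N.
    by rewrite oddD (negbTE rest_even) addbF.
  rewrite /rest -!big_split /=; apply: even_sum => s; rewrite inE => /andP[sS vs].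
  have := facets s sS vs; rewrite card_set_sum (big_setD1 None) ?inE //= NoneD.
  rewrite big_imset /=; last by move=> a b _ _ [].
  rewrite (big_setD1 v) //= SomeD addnA.
  by under eq_bigr do rewrite SomeD.
pose Pr := [set p : {set T} * T | (p.1 \in St) && (p.2 \in p.1 :\ v)].
have -> : rest = (\sum_(p in Pr) h (None |: Some @: (p.1 :\ p.2)))%N.
  rewrite /rest pair_big_dep /=; apply: eq_bigl => p; by rewrite !inE.
(* Pairs are grouped by their ridge [r], on which the summand depends alone. The pairs over [r]
   correspond to the fillers of [r], even in number by [thin]; there are none if [v] is not in
   [r]. *)
rewrite (partition_big (fun p => p.1 :\ p.2) xpredT) //=.
apply: even_sum => r _.
rewrite (eq_bigr (fun _ => h (None |: Some @: r) : nat)) => [|p /andP[_ /eqP->]//].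
rewrite sum_nat_const oddM negb_and; apply/orP; left.
have [vr|vr] := boolP (v \in r); last first.
  rewrite eq_card0 // => p; apply/negbTE/negP => /andP[].
  rewrite !inE => /andP[/andP[pS vp] /andP[pv _]] /eqP e.
  by move: vr; rewrite -e !inE eq_sym pv vp.
rewrite (_ : #|_| = #|[set (u |: r, u) | u in [set u | (u \notin r) && ((u |: r) \in S)]]|).
  by rewrite card_imset // => a b [].
apply: eq_card => -[s u]; apply/andP/imsetP => /=.
  case; rewrite !inE /= => /andP[/andP[sS vs] /andP[uv us]] /eqP e.
  exists u; last by rewrite -e setD1K.
  by rewrite inE -e !inE eqxx /= setD1K.
case=> w; rewrite inE => /andP[wr wS] [-> ->].
rewrite !inE wS vr eqxx !orbT /= andbT setU1K // eqxx; split=> //.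
by apply: contra wr => /eqP ->.
Qed.

(** Along the curve v + (t, t^2, t^3, ...) each functional becomes a nonzero polynomial in t, so it
    is enough that a small t avoids the roots of their product. *)
Lemma avoid_functionals (R : realFieldType) (M J : finType) (d : M -> J -> R)
    (v : J -> R) (e : R) :
  0 < e -> (forall m, exists j, d m j != 0) ->
  exists w : J -> R, (forall j, `|w j - v j| < e) /\
    forall m, \sum_j d m j * w j != 0.
Proof.
move=> e0 dn0.
pose p m : {poly R} := (\sum_j d m j * v j)%:P + \sum_j d m j *: 'X^((enum_rank j).+1).
have p0 m : p m != 0.
  have [j dj] := dn0 m; apply: contraNneq dj => pm0.
  have := congr1 (fun q : {poly R} => q`_((enum_rank j).+1)) pm0.
  rewrite coef0 coefD coefC /= add0r coef_sum (bigD1 j) //= big1 => [|i ij].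
    by rewrite coefZ coefXn eqxx mulr1 addr0 => ->.
  rewrite coefZ coefXn eqSS (inj_eq val_inj) (inj_eq enum_rank_inj).
  by rewrite eq_sym (negbTE ij) mulr0.
pose P := \prod_m p m.
have P0 : P != 0 by rewrite prodf_seq_neq0; apply/allP => m _; rewrite p0.
pose c := Num.min 1 e.
have c0 : 0 < c by rewrite /c lt_min ltr01.
(* Distinct candidates, of which [size P] are more than the roots; the shift by 2 keeps them
   strictly below [c]. *)
pose t k : R := c / k.+2%:R.
have tinj : injective t.
  move=> i j /(mulfI (lt0r_neq0 c0)) /invr_inj /eqP.
  by rewrite eqr_nat => /eqP [].
have [k Pk] : exists k, ~~ root P (t k).
  pose rs := [seq t k | k <- iota 0 (size P)].
  have : ~~ all (root P) rs.
    apply/negP => h; have := max_poly_roots P0 h.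
    by rewrite map_inj_uniq // iota_uniq size_map size_iota ltnn => /(_ isT).
  by move=> /allPn[_ /mapP[k _ ->] h]; exists k.
have t0 : 0 < t k by rewrite divr_gt0 // ltr0n.
have tc : t k < c.
  by rewrite ltr_pdivrMr ?ltr0n // ltr_pMr // ltr1n.
have [t1 te] : t k < 1 /\ t k < e by move: tc; rewrite /c lt_min => /andP[].
exists (fun j => v j + t k ^+ (enum_rank j).+1); split.
  move=> j; rewrite addrAC subrr add0r ger0_norm ?exprn_ge0 ?(ltW t0) //.
  apply: le_lt_trans te; rewrite exprS ger_pMr //.
  by apply: exprn_ile1; exact: ltW.
move=> m; apply: contraNneq Pk => h.
rewrite /root /P horner_prod prodf_seq_eq0; apply/hasP; exists m; rewrite ?mem_index_enum //=.
rewrite hornerD hornerC horner_sum -[X in _ == X]h; apply/eqP.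
rewrite -big_split; apply: eq_bigr => j _ /=.
by rewrite hornerZ hornerXn mulrDr.
Qed.

(** * Counting origin-containing simplices of equivariant maps *)

Section EquivariantCount.
Variables (R : realFieldType) (T J K : finType) (S : {set {set T}}).
Variables (act : K -> T -> T) (sg : K -> J -> R) (sj : K -> J -> J).
Variables (core : {set T}) (j0 : J).
Hypothesis card_simplex : forall s : {set T}, s \in S -> #|s| = #|J|.+1.
(** The simplices form a pseudomanifold without boundary, modulo 2. *)
Hypothesis thin : forall r : {set T}, ~~ odd #|[set u | (u \notin r) && ((u |: r) \in S)]|.
(** [K] bears no group structure: [act_comp], [act_inv] and [act_id] say that its elements act like
    a group, and composition is respected on vertices and on signed coordinates at once. *)
Hypothesis act_comp : forall k m, exists l,
  (forall t, act k (act m t) = act l t) /\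
  (forall j, sg k j * sg m (sj k j) = sg l j /\ sj m (sj k j) = sj l j).
Hypothesis act_inv : forall k, exists m, forall t, act m (act k t) = t.
Hypothesis act_id : exists e,
  (forall t, act e t = t) /\ (forall j, sg e j = 1 /\ sj e j = j).
Hypothesis sg_norm : forall k j, `|sg k j| = 1.
Hypothesis sj_inj : forall k, injective (sj k).
Hypothesis act_simplex : forall k (s : {set T}), s \in S -> act k @: s \in S.
Hypothesis core_act : forall k t, (act k t \in core) = (t \in core).
Hypothesis act_free : forall t k l, t \notin core -> act k t = act l t -> k = l.
Hypothesis simplex_free : forall (s : {set T}) t k, s \in S -> t \in s -> act k t \in s ->
  t \notin core -> act k t = t.

Definition equivariant (F : T -> J -> R) :=
  forall k t j, F (act k t) j = sg k j * F t (sj k j).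

(** The factor [c] fixes one sign of coordinate [j0] on a simplex that meets the core. Hence its
    hull avoids the origin whichever of the two maps is used at each vertex. *)
Definition core_signed (F0 F1 : T -> J -> R) :=
  forall (s : {set T}) t, s \in S -> t \in s -> t \in core ->
  exists c : R, forall u, u \in s -> 0 < c * F0 u j0 /\ 0 < c * F1 u j0.

(** The boolean selects the map, so a family may contain both values of one vertex, as happens when
    its old value is compared with its new one. *)
Definition generic_on (D : {set T * bool}) (F : bool -> T -> J -> R) :=
  forall A : {set T * bool}, A \subset D ->
  (exists2 s : {set T}, s \in S & forall x, x \in A -> x.1 \in s) ->
  (forall x, x \in A -> x.1 \notin core) ->
  (#|A| <= #|J|)%N -> li A (fun x => F x.2 x.1).

Definition hull0_count (F : T -> J -> R) : nat := #|[set s in S | `[< hull0 s F >]]|.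

Let sg_neq0 k j : sg k j != 0.
Proof. by rewrite -normr_eq0 sg_norm oner_eq0. Qed.

Let act_inj k : injective (act k).
Proof. by have [m mK] := act_inv k; exact: can_inj mK. Qed.

Let act_surj k t : exists u, act k u = t.
Proof. by exists (invF (@act_inj k) t); rewrite f_invF. Qed.

Let act_inv_r k : exists m, forall t, act k (act m t) = t.
Proof.
have [m mK] := act_inv k; exists m => t.
by have [u <-] := act_surj k t; rewrite mK.
Qed.

Let orb v := [set act k v | k : K].

Let mem_orb v : v \in orb v.
Proof. by have [e [eid _]] := act_id; apply/imsetP; exists e. Qed.

Let orb_act v k t : (act k t \in orb v) = (t \in orb v).
Proof.
apply/imsetP/imsetP => -[m _ e]; last first.
  by have [l [lE _]] := act_comp k m; exists l; rewrite // e lE.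
have [k' k'K] := act_inv k; have [l [lE _]] := act_comp k' m.
by exists l; rewrite // -lE -e k'K.
Qed.

Let act_simplexE k (s : {set T}) : (act k @: s \in S) = (s \in S).
Proof.
apply/idP/idP; last exact: act_simplex.
have [m mK] := act_inv k => /(act_simplex m).
by rewrite -imset_comp (eq_imset (g := id)) ?imset_id // => t /=; rewrite mK.
Qed.

Lemma hull0_act k (s : {set T}) F : equivariant F -> hull0 (act k @: s) F <-> hull0 s F.
Proof.
move=> eF.
have hull0_act1 m (u : {set T}) : hull0 u F -> hull0 (act m @: u) F.
  move=> [l [l0 l1 lF]]; apply/hull0_imset; first by move=> ? ? _ _; exact: act_inj.
  exists l; split=> // j.
  transitivity (sg m j * \sum_(i in u) l i * F i (sj m j)); last by rewrite lF mulr0.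
  by rewrite big_distrr; apply: eq_bigr => i _ /=; rewrite eF; ring.
split; last exact: hull0_act1.
have [m mK] := act_inv k => /(hull0_act1 m).
by rewrite -imset_comp (eq_imset (g := id)) ?imset_id // => t /=; rewrite mK.
Qed.

Lemma li_act k (s : {set T}) F : equivariant F -> li s F -> li (act k @: s) F.
Proof.
move=> eF h; apply/li_imset; first by move=> ? ? _ _; exact: act_inj.
move=> l lF; apply: h => j.
have [j' <-] : exists j', sj k j' = j by exists (invF (@sj_inj k) j); rewrite f_invF.
have := lF j'; rewrite (eq_bigr (fun i => sg k j' * (l i * F i (sj k j')))); last first.
  by move=> i _ /=; rewrite eF; ring.
by rewrite -big_distrr /= => /eqP; rewrite mulf_eq0 (negbTE (sg_neq0 _ _)) => /eqP.
Qed.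

Section Mixing.
Variable F : bool -> T -> J -> R.
Hypothesis F_equi : forall b, equivariant (F b).
Hypothesis F_gen : generic_on setT F.
Hypothesis F_core : core_signed (F false) (F true).

Let mix (D : {set T}) t := F (t \in D) t.
Let act_closed (D : {set T}) := forall k t, (act k t \in D) = (t \in D).

Let mix_equi D : act_closed D -> equivariant (mix D).
Proof. by move=> cD k t j; rewrite /mix cD F_equi. Qed.

Let mix_core D s t : s \in S -> t \in s -> t \in core -> ~ hull0 s (mix D).
Proof.
move=> sS ts tc; have [c h] := F_core sS ts tc.
by apply: (@hull0_sep _ _ _ _ _ c j0) => u us; have [] := h u us; rewrite /mix; case: (u \in D).
Qed.

Let star D v := #|[set s in S | (v \in s) && `[< hull0 s (mix D) >]]|.

(** This is [star_parity], with [None] standing for [v] at its new value. A simplex contains no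
    other point of the orbit of [v], so [v] is the only vertex of its star whose value changes. *)
Let star_mix D v : act_closed D -> v \notin D -> v \notin core ->
  odd (star D v) = odd (star (D :|: orb v) v).
Proof.
move=> cD vD vcore.
pose Q (x : option T) := if x is Some t then mix D t else F true v.
have Sinj : injective (@Some T) by move=> a b [].
have eL : star D v = #|[set s in S | (v \in s) && (fun X => `[< hull0 X Q >]) (Some @: s)]|.
  apply: eq_card => s; rewrite !inE /=; congr [&& _, _ & _]; apply: asbool_equiv_eq.
  rewrite hull0_imset; last by move=> a b _ _; exact: Sinj.
  by [].
have eR : star (D :|: orb v) v =
    #|[set s in S | (v \in s) && (fun X => `[< hull0 X Q >]) (None |: Some @: (s :\ v))]|.
  apply: eq_card => s; rewrite !inE /=.
  have [sS|//] := boolP (s \in S); have [vs|//] /= := boolP (v \in s).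
  apply: asbool_equiv_eq.
  pose f t := if t == v then None else Some t.
  have fE : f @: s = None |: Some @: (s :\ v).
    rewrite -{1}(setD1K vs) imsetU1 /f eqxx; congr (_ |: _).
    by apply: eq_in_imset => t; rewrite !inE => /andP[/negbTE->].
  have finj : {in s &, injective f}.
    by move=> a b _ _; rewrite /f; case: eqP => [->|_]; case: eqP => [->|_] // [].
  rewrite -fE hull0_imset //.
  have QE t : t \in s -> Q (f t) = mix (D :|: orb v) t.
    move=> ts; rewrite /f /mix inE; case: eqP => [->|tv] /=.
      by rewrite mem_orb orbT.
    suff /negbTE-> : t \notin orb v by rewrite orbF.
    apply/negP => /imsetP[k _ e]; apply: tv; rewrite e.
    by apply: (simplex_free sS) => //; rewrite -e.
  by split; apply: eq_hull0 => t ts /=; rewrite QE.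
rewrite eL eR; apply: (@star_parity T S v (fun X => `[< hull0 X Q >])) => // s sS vs.
have sep t : t \in s -> t \in core -> ~~ odd #|[set i in None |: Some @: s |
     `[< hull0 ((None |: Some @: s) :\ i) Q >]]|.
  move=> ts tcore; rewrite (_ : [set i in _ | _] = set0) ?cards0 //.
  apply/setP => i; rewrite in_set in_set0; apply/negbTE/negP => /andP[_ /asboolP].
  have [c h] := F_core sS ts tcore.
  apply: (@hull0_sep _ _ _ _ _ c j0) => x; rewrite !inE => /andP[_].
  case: x => [u|_] /=; last by have [] := h v vs.
  rewrite mem_imset //= => us; have [] := h u us; rewrite /mix; by case: (u \in D).
have [/existsP[t /andP[ts tcore]]|/existsPn nocore] := boolP [exists t, (t \in s) && (t \in core)].
  exact: sep ts tcore.
apply: hull0_facets_even.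
  rewrite cardsU1 card_imset // card_simplex //.
  by case: imsetP => [[]|].
move=> B BA cB.
(* Each vertex is paired with the map that gives its value. This is injective because [v] is not in
   [D]: its old value comes from the other map. *)
pose f (x : option T) := if x is Some t then (t, t \in D) else (v, true).
have finj : injective f.
  move=> [a|] [b|] //=; first by case=> ->.
    by case=> -> ; rewrite (negbTE vD).
  by case=> <- /esym; rewrite (negbTE vD).
have BS x : x \in B -> (f x).1 \in s.
  move=> /(subsetP BA); rewrite !inE; case: x => [t|] //=.
  by rewrite mem_imset.
have nc t : t \in s -> t \notin core by move=> ts; have := nocore t; rewrite ts.
have: li (f @: B) (fun x => F x.2 x.1).
  apply: F_gen; first exact: subsetT.
  - by exists s => // _ /imsetP[x xB ->]; exact: BS.
  - by move=> _ /imsetP[x xB ->]; apply: nc; exact: BS.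
  - by rewrite card_imset // cB.
rewrite li_imset; last by move=> ? ? _ _; exact: finj.
by apply: eq_li => -[t|].
Qed.

(** A simplex that meets the orbit of [v] does so in exactly one point, so these simplices are
    spread over [#|K|] translates of the star of [v], which have equal counts by equivariance. *)
Let count_split D v : act_closed D -> v \notin core ->
  hull0_count (mix D) = (\sum_(s in S | [forall k, act k v \notin s]) `[< hull0 s (mix D) >]
    + #|K| * star D v)%N.
Proof.
move=> cD vcore.
rewrite /hull0_count card_set_sum (bigID (fun s : {set T} => [forall k, act k v \notin s])) /=.
congr (_ + _)%N.
have -> : (#|K| * star D v = \sum_(k : K) \sum_(s in S | act k v \in s) `[< hull0 s (mix D) >])%N.
  rewrite -sum_nat_const; apply: eq_bigr => k _.
  rewrite (reindex_inj (imset_inj (@act_inj k))) /= /star.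
  have -> : [set s in S | (v \in s) && `[< hull0 s (mix D) >]]
      = [set s in [set s in S | v \in s] | `[< hull0 s (mix D) >]].
    by apply/setP => s; rewrite !inE andbA.
  rewrite card_set_sum; apply: eq_big => s.
    by rewrite act_simplexE mem_imset // inE.
  by move=> _; congr nat_of_bool; apply: asbool_equiv_eq; rewrite hull0_act //; exact: mix_equi.
rewrite (exchange_big_dep (mem S)) /=; last by move=> k s _ /andP[].
rewrite big_mkcondr /=; apply: eq_bigr => s sS.
rewrite sum_nat_cond_const /= sS /=.
have [/forallP h|/forallPn[k]] := boolP [forall k, act k v \notin s].
  rewrite (_ : #|_| = 0%N) //; apply: eq_card0 => k.
  by rewrite !inE (negbTE (h k)).
rewrite negbK => ks; rewrite (_ : #|_| = 1%N) ?mul1n //; apply: (@eq_card1 _ k) => m.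
rewrite !inE; apply/idP/eqP => [ms|->//].
have [k' k'K] := act_inv k; have [l [lE _]] := act_comp m k'.
apply: (act_free vcore).
have := @simplex_free s (act k v) l sS ks.
by rewrite -lE k'K core_act => /(_ ms vcore).
Qed.

(** Away from the orbit nothing changes; on it, an even change of the star is multiplied by [#|K|].
    If [v] lies in the core, no simplex around its orbit counts, before or after. *)
Let count_step D v : act_closed D ->
  hull0_count (mix D) = hull0_count (mix (D :|: orb v)) %[mod 2 * #|K|].
Proof.
move=> cD.
have cD' : act_closed (D :|: orb v) by move=> k t; rewrite !inE cD orb_act.
have [vD|vD] := boolP (v \in D).
  suff -> : D :|: orb v = D by [].
  by apply/setUidPl/subsetP => t /imsetP[k _ ->]; rewrite cD.
have far (s : {set T}) : [forall k, act k v \notin s] -> hull0 s (mix D) <-> hull0 s (mix (D :|: orb v)).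
  move=> /forallP h.
  have QE t : t \in s -> mix D t = mix (D :|: orb v) t.
    move=> ts; rewrite /mix inE; suff /negbTE-> : t \notin orb v by rewrite orbF.
    by apply: contraL ts => /imsetP[k _ ->].
  by split; apply: eq_hull0 => t ts; rewrite QE.
have [vcore|vcore] := boolP (v \in core).
  congr (_ %% _)%N; apply: eq_card => s; rewrite !inE; case sS: (s \in S) => //=.
  apply: asbool_equiv_eq.
  have [/far//|/forallPn[k]] := boolP [forall k, act k v \notin s].
  rewrite negbK => ks; have kc : act k v \in core by rewrite core_act.
  by split=> /(mix_core sS ks kc).
rewrite !(count_split _ vcore) //.
rewrite (eq_bigr (fun s => `[< hull0 s (mix (D :|: orb v)) >] : nat)); last first.
  by move=> s /andP[_ /far e]; congr nat_of_bool; exact: asbool_equiv_eq.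
apply/eqP; rewrite eqn_modDl; apply/eqP.
by rewrite [(2 * _)%N]mulnC -!muln_modr !modn2 star_mix.
Qed.

Lemma hull0_count_invariant :
  hull0_count (F false) = hull0_count (F true) %[mod 2 * #|K|].
Proof.
pose D (s : seq T) := \bigcup_(v <- s) orb v.
have cD s : act_closed (D s).
  elim: s => [|v s IH] k t; first by rewrite /D big_nil !inE.
  by rewrite /D big_cons !inE orb_act; congr (_ || _); exact: IH.
have step s : hull0_count (mix (D [::])) = hull0_count (mix (D s)) %[mod 2 * #|K|].
  elim: s => // v s ->.
  have -> : D (v :: s) = D s :|: orb v by rewrite /D big_cons setUC.
  exact: count_step.
have -> : hull0_count (F false) = hull0_count (mix (D [::])).
  apply: eq_card => s; rewrite !inE; congr (_ && _); apply: asbool_equiv_eq.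
  by split; apply: eq_hull0 => t _; rewrite /mix /D big_nil inE.
rewrite (step (enum T)); congr (_ %% _)%N.
have DT t : t \in D (enum T).
  rewrite /D big_enum /=; apply/bigcupP; exists t => //; exact: mem_orb.
apply: eq_card => s; rewrite !inE; congr (_ && _); apply: asbool_equiv_eq.
by split; apply: eq_hull0 => t _; rewrite /mix DT.
Qed.

End Mixing.

Section Perturbation.
Variables (F : bool -> T -> J -> R) (s0 : {set T}) (eps : R).
Hypothesis eps_gt0 : 0 < eps.
Hypothesis F_equi : forall b, equivariant (F b).
Hypothesis s0_gen : forall B : {set T}, B \subset s0 -> (#|B| <= #|J|)%N -> li B (F false).
Hypothesis s0_isolated : forall s : {set T}, s \in S -> exists k,
  forall t l, act l t \in s -> t \in s0 -> act l t \in act k @: s0.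

Let closed (D : {set T * bool}) := forall k t b, ((act k t, b) \in D) = ((t, b) \in D).

Let good (D : {set T * bool}) (G : bool -> T -> J -> R) :=
  [/\ forall b, equivariant (G b), forall b t j, `|G b t j - F b t j| < eps,
      forall b t, t \in core -> G b t = F b t,
      forall t, t \in s0 -> G false t = F false t & generic_on D G].

(** By isolation, the vertices of a simplex that come from the orbits of [s0] lie in a single
    translate of [s0], to which independence is transported. *)
Let good0 : good [set x | (x.2 == false) && [exists u in s0, x.1 \in orb u]] F.
Proof.
split=> //; first by move=> b t j; rewrite subrr normr0.
move=> A AD [s sS As] Ac cA.
have [k h] := s0_isolated sS.
pose f t : T * bool := (t, false).
have finj : injective f by move=> a b [].
have AE x : x \in A -> x.2 = false /\ x.1 \in act k @: s0.
  move=> xA; move: (subsetP AD x xA); rewrite inE => /andP[/eqP x2 /existsP[u /andP[us0 /imsetP[l _ e]]]].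
  by split=> //; rewrite e; apply: h => //; rewrite -e; exact: As.
pose B := [set t in s0 | f (act k t) \in A].
have -> : A = f @: (act k @: B).
  apply/setP => -[t b]; apply/idP/imsetP => [xA|[u /imsetP[v]]].
    have /= [b0 /imsetP[u us e]] := AE _ xA; subst b t.
    exists (act k u) => //; apply: imset_f; by rewrite inE us.
  by rewrite inE => /andP[_ fA] -> [-> ->].
have cB : (#|B| <= #|J|)%N.
  apply: leq_trans cA; rewrite -(card_imset (mem B) (@act_inj k)) -(card_imset _ finj).
  apply: subset_leq_card; apply/subsetP => x /imsetP[y /imsetP[t]].
  by rewrite inE => /andP[_ fA] -> ->.
apply/li_imset; first by move=> ? ? _ _; exact: finj.
apply: (li_act (F := F false)) => //; apply: s0_gen => //.
by apply/subsetP => t; rewrite inE => /andP[].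
Qed.

(** A simplex contains at most one point of the orbit of [r]. Its new value has to avoid the spans
    of the families of fewer than [#|J|] values already made generic, for all points of the orbit at
    once; these are finitely many conditions on the value at [r]. *)
Let good_step D G r b : closed D -> (forall t, t \in s0 -> (t, false) \in D) -> good D G ->
  exists G', good (D :|: [set x | (x.2 == b) && (x.1 \in orb r)]) G'.
Proof.
move=> cD s0D [Ge GF Gc Gs gD].
set D' := D :|: _.
have [rD|rD] := boolP ((r, b) \in D).
  suff -> : D' = D by exists G.
  apply/setUidPl/subsetP => -[t b']; rewrite inE /= => /andP[/eqP-> /imsetP[k _ ->]].
  by rewrite cD.
have [rcore|rcore] := boolP (r \in core).
  exists G; split=> // A AD' AS Ac; apply: gD => //.
  apply/subsetP => -[t b'] xA; have := subsetP AD' _ xA; rewrite !inE /= => /orP[//|].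
  by move=> /andP[_ /imsetP[k _ e]]; have := Ac _ xA; rewrite /= e core_act rcore.
(* A hyperplane through the values on [A]; when [A] is too large for this, a dummy nonzero
   vector. *)
have /choice[c cP] : forall A : {set T * bool}, exists c : J -> R, (exists j, c j != 0) /\
    ((#|A| < #|J|)%N -> forall x, x \in A -> \sum_j c j * G x.2 x.1 j = 0).
  move=> A; have [lt|ge] := ltnP #|A| #|J|.
    have [c [cn0 cA]] := annihilator (fun x : T * bool => G x.2 x.1) lt.
    by exists c; split.
  by exists (fun _ => 1); split=> //; exists j0; rewrite oner_eq0.
(* The value at [act k r] is a signed permutation of the value [w] at [r]; [d (k, A)] is the
   functional [c A] pulled back to [w]. *)
pose d (m : K * {set T * bool}) j' := \sum_(j | sj m.1 j == j') sg m.1 j * c m.2 j.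
have dn0 m : exists j, d m j != 0.
  have [[j cj] _] := cP m.2; exists (sj m.1 j); rewrite /d (big_pred1 j).
    by rewrite mulf_neq0.
  by move=> i /=; rewrite (inj_eq (@sj_inj _)).
(* The new value is chosen close to [F] rather than to [G], so errors do not accumulate from orbit
   to orbit. *)
have [w [wF wd]] := avoid_functionals (F b r) eps_gt0 dn0.
have {}wd k (A : {set T * bool}) : \sum_j c A j * (sg k j * w (sj k j)) != 0.
  have := wd (k, A); rewrite /d /=; congr (_ != _).
  under eq_bigr do rewrite big_distrl /=.
  rewrite (exchange_big_dep xpredT) //=; apply: eq_bigr => j _.
  by rewrite (big_pred1 (sj k j)) => [|i]; [ring|rewrite eq_sym].
pose G' b' t := if b' == b then
  (if [pick k | act k r == t] is Some k then fun j => sg k j * w (sj k j) else G b t) else G b' t.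
have G'r k : G' b (act k r) = fun j => sg k j * w (sj k j).
  rewrite /G' eqxx; case: pickP => [m /eqP e|/(_ k)]; last by rewrite eqxx.
  by rewrite (act_free rcore e).
have G'o b' t : ~~ ((b' == b) && (t \in orb r)) -> G' b' t = G b' t.
  rewrite negb_and /G'; case: eqP => //= -> h.
  case: pickP => // k /eqP e; case/negP: h; apply/imsetP; by exists k.
exists G'; split.
- move=> b' k t j.
  have [/andP[/eqP-> /imsetP[m _ ->]]|h] := boolP ((b' == b) && (t \in orb r)).
    have [l [lE lj]] := act_comp k m.
    rewrite lE !G'r mulrA; have [<- <-] := lj j; by [].
  by rewrite !G'o ?orb_act // Ge.
- move=> b' t j.
  have [/andP[/eqP-> /imsetP[m _ ->]]|h] := boolP ((b' == b) && (t \in orb r)).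
    by rewrite G'r F_equi -mulrBr normrM sg_norm mul1r.
  by rewrite G'o.
- move=> b' t tc; rewrite G'o ?Gc // negb_and; apply/orP; right.
  by apply: contraL tc => /imsetP[k _ ->]; rewrite core_act.
- move=> t ts.
  have [/andP[/eqP bf /imsetP[m _ e]]|h] := boolP ((false == b) && (t \in orb r)); last first.
    by rewrite G'o // Gs.
  by case/negP: rD; rewrite -(cD m) -e -bf s0D.
- move=> A AD' [s sS As] Ac cA.
  have inD x : x \in A -> ~~ ((x.2 == b) && (x.1 \in orb r)) -> x \in D.
    by move=> xA h; have := subsetP AD' x xA; rewrite !inE (negbTE h) orbF.
  have [/existsP[[t b'] /and3P[xA /= /eqP b'b /imsetP[k _ tk]]]|/existsPn none] :=
      boolP [exists x, [&& x \in A, x.2 == b & x.1 \in orb r]]; last first.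
    have AN x : x \in A -> ~~ ((x.2 == b) && (x.1 \in orb r)).
      by move=> xA; have := none x; rewrite xA.
    apply: (eq_li (Q := fun x => G x.2 x.1)) => [x xA|]; first by rewrite G'o ?AN.
    apply: gD => //; first by apply/subsetP => x xA; apply: inD => //; exact: AN.
    by exists s.
  subst b' t; set x := (act k r, b) in xA.
  have AN y : y \in A :\ x -> ~~ ((y.2 == b) && (y.1 \in orb r)).
    case: y => [t b']; rewrite !inE => /andP[yx yA].
    apply: contra yx => /= /andP[/eqP b'b /imsetP[m _ e]]; subst b' t.
    have [k' k'K] := act_inv k; have [l [lE _]] := act_comp m k'.
    have := @simplex_free s (act k r) l sS (As _ xA).
    rewrite -lE k'K => /(_ (As _ yA)); rewrite core_act => /(_ rcore) ->.
    by rewrite eqxx.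
  have AD : A :\ x \subset D.
    apply/subsetP => y yA; apply: inD; last exact: AN.
    by move: yA; rewrite inE => /andP[].
  have cAx : (#|A :\ x| < #|J|)%N by move: cA; rewrite (cardsD1 x A) xA.
  have [_ /(_ cAx) cG] := cP (A :\ x).
  move=> l lG.
  have lx : l x = 0.
    have : \sum_j c (A :\ x) j * \sum_(y in A) l y * G' y.2 y.1 j = 0.
      by apply: big1 => j _; rewrite lG mulr0.
    under eq_bigr do rewrite big_distrr /=.
    rewrite exchange_big /= (big_setD1 x) //= [X in _ + X]big1 ?addr0 => [|y yA].
      rewrite (eq_bigr (fun j => l x * (c (A :\ x) j * (sg k j * w (sj k j))))) => [|j _].
        rewrite -big_distrr /= => /eqP; rewrite mulf_eq0 (negbTE (wd _ _)) orbF.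
        by move/eqP.
      by rewrite G'r; ring.
    rewrite G'o ?AN // (eq_bigr (fun j => l y * (c (A :\ x) j * G y.2 y.1 j))) => [|j _].
      by rewrite -big_distrr /= cG // mulr0.
    by ring.
  have liA : li (A :\ x) (fun y => G y.2 y.1).
    apply: gD => //; first by exists s => // y; rewrite inE => /andP[_]; exact: As.
      by move=> y; rewrite inE => /andP[_]; exact: Ac.
    exact: ltnW.
  move=> y yA; have [->//|yx] := eqVneq y x.
  apply: liA; last by rewrite !inE yx.
  move=> j; rewrite -[RHS](lG j) [RHS](big_setD1 x) //= lx mul0r add0r.
  by apply: eq_bigr => z zA; rewrite G'o ?AN.
Qed.

(** Keeping the values on [s0] matters: the origin must stay in the hull of the one simplex where
    the start map is known to have it. *)
Lemma generic_perturbation : exists G : bool -> T -> J -> R,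
  [/\ forall b, equivariant (G b), forall b t j, `|G b t j - F b t j| < eps,
      forall b t, t \in core -> G b t = F b t,
      forall t, t \in s0 -> G false t = F false t & generic_on setT G].
Proof.
pose D0 := [set x : T * bool | (x.2 == false) && [exists u in s0, x.1 \in orb u]].
pose D (xs : seq (T * bool)) :=
  D0 :|: \bigcup_(y <- xs) [set x | (x.2 == y.2) && (x.1 \in orb y.1)].
have D_cons y xs : D (y :: xs) = D xs :|: [set x | (x.2 == y.2) && (x.1 \in orb y.1)].
  by rewrite /D big_cons setUCA [LHS]setUC.
have s0D xs t : t \in s0 -> (t, false) \in D xs.
  move=> ts; rewrite !inE /=; apply/orP; left; apply/existsP; exists t.
  by rewrite ts mem_orb.
have cD xs : closed (D xs).
  elim: xs => [|y xs IH] k t b.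
    2: by rewrite D_cons in_setU [RHS]in_setU IH !in_set /= orb_act.
  rewrite /D big_nil !inE !orbF /=; congr (_ && _).
  by apply: eq_existsb => u; rewrite orb_act.
have [G [? ? ? ? gG]] : exists G, good (D (enum {: T * bool})) G.
  elim: (enum _) => [|[r b] xs [G gG]]; first by exists F; rewrite /D big_nil setU0.
  by rewrite D_cons; exact: good_step (cD xs) (@s0D xs) gG.
exists G; split=> // A _; apply: gG; apply/subsetP => x _.
rewrite /D big_enum inE; apply/orP; right; apply/bigcupP; exists x => //.
by rewrite inE eqxx mem_orb.
Qed.

End Perturbation.

End EquivariantCount.

Local Open Scope nat_scope.

(** * Subdivided products of cube boundaries *)

Section Grid.
Variable N : nat.
Hypothesis N_gt0 : 0 < N.

(* A cell of the product of three copies of the boundary of [0, 4N]^6, cut by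
   the even hyperplanes: even entries are vertices, odd entries are the
   intervals around them, and [gle] is the face relation. *)
Definition cell := {ffun 'I_3 * 'I_6 -> 'I_(4 * N).+1}.

Definition consecutive (a b : nat) := (a == b.+1) || (b == a.+1).
Lemma consecutive_neq a b : consecutive a b -> b != a.
Proof. by rewrite /consecutive; lia. Qed.

Definition kle (a b : nat) := (a == b) || (odd b && consecutive a b).
Definition gle (c d : cell) := [forall i, kle (c i) (d i)].
Definition extreme (a : nat) := (a == 0) || (a == 4 * N).
Definition on_spheres (c : cell) := [forall b, [exists i, extreme (c (b, i))]].
Definition rk (c : cell) := #|[set i | odd (c i)]|.
Definition incident (c d : cell) := gle c d || gle d c.

Definition inward (a : nat) := if a == 0 then 1 else (4 * N).-1.

(** Full flags of cells, with ranks 0 to 15: the top simplices of the barycentric subdivision of a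
    cubical complex of dimension 15, whose vertices are the cells. *)
Definition simplices : {set {set cell}} :=
  [set s : {set cell} | [&& #|s| == 16, [forall c in s, on_spheres c]
             & [forall c in s, [forall d in s, incident c d]]]].

Lemma simplicesP (s : {set cell}) : reflect
  [/\ #|s| = 16, forall c, c \in s -> on_spheres c
    & forall c d, c \in s -> d \in s -> incident c d] (s \in simplices).
Proof.
rewrite inE; apply: (iffP and3P) => [[/eqP c1 /forall_inP c2 /forall_inP c3]|[c1 c2 c3]].
  by split=> // c d cs ds; have /forall_inP := c3 c cs; apply.
split; [exact/eqP|exact/forall_inP|apply/forall_inP => c cs; apply/forall_inP => d ds; exact: c3].
Qed.

Lemma extreme_even n : extreme n -> ~~ odd n.
Proof. by rewrite /extreme; lia. Qed.

Lemma gle_refl c : gle c c.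
Proof. by apply/forallP => i; rewrite /kle /consecutive eqxx. Qed.

Lemma gle_trans d c e : gle c d -> gle d e -> gle c e.
Proof.
by move=> /forallP cd /forallP de; apply/forallP => i; have := cd i; have := de i; rewrite /kle /consecutive; lia.
Qed.

Lemma rk_sum c : rk c = \sum_i odd (c i).
Proof. by rewrite /rk -sum1dep_card big_mkcond; apply: eq_bigr => i _; case: (odd _). Qed.

Lemma rk_sub c d : gle c d -> [set i | odd (c i)] \subset [set i | odd (d i)].
Proof.
by move=> /forallP cd; apply/subsetP => i; rewrite !inE; have := cd i; rewrite /kle /consecutive; lia.
Qed.

Lemma gle_rk_eq c d : gle c d -> rk d <= rk c -> c = d.
Proof.
move=> cd rdc; have /eqP e : [set i | odd (c i)] == [set i | odd (d i)].
  by rewrite eqEcard rk_sub.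
apply/ffunP => i; apply/val_inj.
have := forallP cd i; have : odd (c i) = odd (d i) by have := in_set (fun i => odd (c i)) i; rewrite e inE.
by rewrite /kle /consecutive /=; lia.
Qed.

Lemma incident_rk c d : incident c d -> rk c <= rk d -> gle c d.
Proof. by case/orP=> // dc rcd; rewrite (gle_rk_eq dc rcd) gle_refl. Qed.

Lemma on_spheres_le c d : gle c d -> on_spheres d -> on_spheres c.
Proof.
move=> cd /forallP dS; apply/forallP => b; have /existsP[i di] := dS b.
apply/existsP; exists i; move: di; have := forallP cd (b, i).
by rewrite /kle /consecutive /extreme; lia.
Qed.

Lemma card_even (c : cell) : #|[set i | ~~ odd (c i)]| = 18 - rk c.
Proof.
have := cardsC [set i | odd (c i)]; rewrite card_prod !card_ord -/(rk c) => e.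
rewrite -(addnK (rk c) #|_|) addnC -[in RHS](_ : 3 * 6 = 18) // -e; congr (rk c + _ - _).
by apply: eq_card => i; rewrite !inE.
Qed.

Lemma on_spheres_evens c : on_spheres c -> exists e : 'I_3 -> 'I_6,
  (forall b, extreme (c (b, e b))) /\
  [set (b, e b) | b : 'I_3] \subset [set i | ~~ odd (c i)].
Proof.
move=> /forallP cS.
have {}cS b : {i | extreme (c (b, i))} by apply/sigW/existsP; exact: cS.
exists (fun b => sval (cS b)); split; first by move=> b; exact: svalP (cS b).
apply/subsetP => _ /imsetP[b _ ->]; rewrite inE.
exact: extreme_even (svalP (cS b)).
Qed.

(** Each of the three spheres requires an extreme, hence even, entry among the 18. *)
Lemma rk_le15 c : on_spheres c -> rk c <= 15.
Proof.
move=> /on_spheres_evens[e [_ /subset_leq_card]].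
rewrite card_imset ?card_ord; last by move=> b b' [].
by rewrite card_even; lia.
Qed.

Lemma top_evens c : on_spheres c -> rk c = 15 -> forall b, exists i,
  extreme (c (b, i)) /\ forall j, ~~ odd (c (b, j)) -> j = i.
Proof.
move=> /on_spheres_evens[e [ce sub]] r15 b; exists (e b); split=> // j cj.
have : (b, j) \in [set (b, e b) | b : 'I_3].
  suff -> : [set (b, e b) | b : 'I_3] = [set i | ~~ odd (c i)] by rewrite inE.
  apply/eqP; rewrite eqEcard sub card_even r15.
  by rewrite card_imset ?card_ord // => b1 b2 [].
by move=> /imsetP[b' _ [-> ->]].
Qed.

Lemma cover_diff (p w : cell) : gle p w -> rk w = (rk p).+1 ->
  exists a, [/\ ~~ odd (p a), odd (w a) & forall k, (w k != p k) = (k == a)].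
Proof.
move=> pw rw; have /eqP/cards1P[a aE] : #|[set i | odd (w i)] :\: [set i | odd (p i)]| = 1.
  by rewrite cardsD (setIidPr (rk_sub pw)) -/(rk w) -/(rk p) rw; lia.
have ma k : (k \in [set i | odd (w i)] :\: [set i | odd (p i)]) = (k == a) by rewrite aE inE.
exists a; have := ma a; rewrite eqxx !inE => /andP[-> ->]; split=> // k.
rewrite -ma !inE -(inj_eq val_inj) /=; have := forallP pw k; rewrite /kle /consecutive; lia.
Qed.

Definition set_cell (p : cell) a (x : nat) : cell := [ffun k => if k == a then inord x else p k].

Lemma set_cellE (p : cell) a x k : x <= 4 * N -> set_cell p a x k = (if k == a then x else p k) :> nat.
Proof. by move=> xN; rewrite ffunE; case: eqP => // _; rewrite inordK. Qed.

Lemma set_cell_cover (p : cell) a x : x <= 4 * N -> ~~ odd (p a) -> odd x ->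
  consecutive (p a) x ->
  gle p (set_cell p a x) /\ rk (set_cell p a x) = (rk p).+1.
Proof.
move=> xN pa ox px; split.
  by apply/forallP => k; rewrite set_cellE //; case: eqP => [->|_]; rewrite /kle ?eqxx // ox px orbT.
rewrite /rk (_ : [set i | odd (set_cell p a x i)] = a |: [set i | odd (p i)]).
  by rewrite cardsU1 inE pa.
by apply/setP => k; rewrite !inE set_cellE //; case: eqP.
Qed.

(* The three exchanges of an element of a maximal chain between its neighbours. *)
Definition mid_swap (p q w : cell) : cell := [ffun i => if w i == p i then q i else p i].
(** When [q] is an edge, it is also the midpoint of its ends, so the other end is the reflection of
    [w]. *)
Definition bottom_swap (q w : cell) : cell :=
  [ffun i => if odd (q i) then inord (2 * q i - w i) else q i].
(** Here [p] has codimension one in [w] and [a] is the entry that [w] opens. If [p a] is not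
    extreme, the second top cell lies on the opposite side of [p]. If it is, [p] lies where two
    faces of a cube meet; [w] keeps the other extreme entry [a'], and the second top cell opens [a']
    inward instead. *)
Definition top_swap (p w : cell) : cell :=
  if [pick k | w k != p k] is Some a then
    if extreme (p a) then
      if [pick k | [&& k.1 == a.1, k != a & ~~ odd (p k)]] is Some a' then
        set_cell p a' (inward (p a'))
      else w
    else set_cell p a (2 * p a - w a)
  else w.

(** If [q] opens two entries of [p] and [w] opens one of them, the exchange opens the other. *)
Lemma mid_swapP (p q w : cell) : gle p w -> gle w q -> w != p ->
  [/\ gle p (mid_swap p q w), gle (mid_swap p q w) q,
      rk (mid_swap p q w) + rk w = rk p + rk q, mid_swap p q w != w
    & mid_swap p q (mid_swap p q w) = w].
Proof.
move=> pw wq np; have pq := gle_trans pw wq.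
have h i := forallP pw i; have g i := forallP wq i; have pqi i := forallP pq i.
split.
- by apply/forallP => i; rewrite ffunE; case: ifP => _; rewrite ?pqi // /kle eqxx.
- by apply/forallP => i; rewrite ffunE; case: ifP => _; rewrite ?pqi // /kle eqxx.
- rewrite !rk_sum -!big_split /=; apply: eq_bigr => i _.
  rewrite ffunE; case: (eqVneq (w i) (p i)) => [->|]; first by rewrite addnC.
  rewrite -(inj_eq val_inj) /= => ne; suff -> : val (w i) = val (q i) by [].
  by move: ne (h i) (g i); rewrite /kle /consecutive /=; lia.
- apply: contraNneq np => e; apply/eqP/ffunP => i.
  have := congr1 (fun c : cell => c i) e; rewrite ffunE.
  by case: eqP => // _ <-.
- apply/ffunP => i; rewrite !ffunE; case: (eqVneq (w i) (p i)) => [->|ne]; first by case: eqP.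
  rewrite eqxx; apply: val_inj; move: ne (h i) (g i).
  by rewrite -(inj_eq val_inj) /kle /consecutive /=; lia.
Qed.

Lemma bottom_swapP (q w : cell) : gle w q -> rk w = 0 -> 0 < rk q ->
  [/\ gle (bottom_swap q w) q, rk (bottom_swap q w) = 0, bottom_swap q w != w
    & bottom_swap q (bottom_swap q w) = w].
Proof.
move=> wq rw rq; have g i := forallP wq i.
have ew i : ~~ odd (w i).
  by have := cards0_eq rw => /setP/(_ i); rewrite !inE => ->.
have ri i : odd (q i) -> 2 * q i - w i < (4 * N).+1.
  by have := g i; have := ew i; have := ltn_ord (q i); have := ltn_ord (w i); rewrite /kle /consecutive; lia.
have vE i : bottom_swap q w i = (if odd (q i) then 2 * q i - w i else q i) :> nat.
  by rewrite ffunE; case: ifP => // oq; rewrite inordK ?ri.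
split.
- apply/forallP => i; rewrite vE; have := g i; have := ew i; rewrite /kle /consecutive; case: ifP; lia.
- apply/eqP; rewrite cards_eq0; apply/eqP/setP => i; rewrite !inE vE.
  by have := g i; have := ew i; rewrite /kle /consecutive; case: ifP; lia.
- have [i] : exists i, i \in [set i | odd (q i)] by apply/set0Pn; rewrite -card_gt0.
  rewrite inE => oq; apply: contraTneq oq => e.
  have := vE i; rewrite e; have := ew i; case: ifP => //; lia.
- apply/ffunP => i; apply: val_inj; rewrite /= ffunE; have := g i; have := ew i; rewrite /kle /consecutive.
  case: ifP => oq; last by lia.
  by rewrite vE oq inordK; have := ri i oq; have := ltn_ord (w i); lia.
Qed.

Lemma reflect_adjacent a b : a <= 4 * N -> ~~ extreme a -> ~~ odd a -> consecutive a b ->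
  [/\ 2 * a - b <= 4 * N, odd (2 * a - b), consecutive a (2 * a - b), 2 * a - b != b
    & 2 * a - (2 * a - b) = b].
Proof.
by rewrite /extreme /consecutive negb_or => aN /andP[a0 a4] ea /orP[]/eqP; split; lia.
Qed.

Lemma inward_adjacent a : extreme a ->
  [/\ inward a <= 4 * N, odd (inward a), consecutive a (inward a)
    & forall b, b <= 4 * N -> consecutive a b -> b = inward a].
Proof.
rewrite /extreme /consecutive /inward => /orP[]/eqP->.
  by split=> [|||b] /=; lia.
have -> : (4 * N == 0) = false by lia.
by split=> [|||b]; lia.
Qed.

Lemma top_swapP (p w : cell) : gle p w -> rk w = 15 -> rk p = 14 -> on_spheres w ->
  [/\ gle p (top_swap p w), rk (top_swap p w) = 15, on_spheres (top_swap p w),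
      top_swap p w != w & top_swap p (top_swap p w) = w].
Proof.
move=> pw rw rp wS; have pS := on_spheres_le pw wS.
have [a [pa wa dE]] : exists a, [/\ ~~ odd (p a), odd (w a) & forall k, (w k != p k) = (k == a)].
  by apply: cover_diff => //; rewrite rw rp.
have wE k : k != a -> w k = p k by move=> ka; apply/eqP; rewrite -[_ == _]negbK dE.
have pickE (v : cell) b : (forall k, (v k != p k) = (k == b)) -> [pick k | v k != p k] = Some b.
  move=> h; case: pickP => [k|/(_ b)]; last by rewrite h eqxx.
  by rewrite h => /eqP->.
have wpa : consecutive (p a) (w a).
  by have := forallP pw a; rewrite /kle wa => /orP[/eqP e|//]; rewrite e wa in pa.
have [i [wi wu]] := top_evens wS rw a.1.
set a' := (a.1, i) in wi.
have a'a : a' != a by apply: contraTneq wi => ->; apply: contraL wa; exact: extreme_even.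
have pa' : extreme (p a') by rewrite -wE.
have pu k : k.1 = a.1 -> k != a -> ~~ odd (p k) -> k = a'.
  move=> ka kna; rewrite -wE //; case: k ka kna => b j /= -> _ /wu -> //.
have others b : b != a.1 -> forall x, [exists j, extreme (set_cell p a x (b, j))].
  move=> ba x; have /existsP[j pj] := forallP pS b; apply/existsP; exists j.
  by rewrite ffunE; case: eqP => // e; rewrite -e eqxx in ba.
rewrite /top_swap (pickE w a dE).
have le4 (v : cell) k : v k <= 4 * N by rewrite -ltnS.
have [ea|nea] := boolP (extreme (p a)); last first.
  have [xN ox px xw xx] := reflect_adjacent (le4 p a) nea pa wpa.
  set x := 2 * p a - w a in xN ox px xw xx *.
  have [g r] := set_cell_cover xN pa ox px.
  have dE' k : (set_cell p a x k != p k) = (k == a).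
    rewrite -(inj_eq val_inj) /= set_cellE //; case: (k =P a) => [->|_]; last by rewrite eqxx.
    exact: consecutive_neq.
  split=> //.
  - by rewrite r rp.
  - apply/forallP => b; have [->|ba] := eqVneq b a.1; last exact: others.
    by apply/existsP; exists i; rewrite ffunE -/a' (negbTE a'a).
  - apply/eqP => e; have := congr1 (fun c : cell => val (c a)) e.
    by rewrite /= set_cellE // eqxx => /eqP; rewrite (negbTE xw).
  - rewrite (pickE _ a dE') (negbTE nea); apply/ffunP => k; apply: val_inj => /=.
    have e : set_cell p a x a = x :> nat by rewrite set_cellE // eqxx.
    rewrite set_cellE e xx; last exact: le4.
    by case: eqP => [->//|/eqP ka]; rewrite wE.
have pick_other b b' : [&& b'.1 == b.1, b' != b & ~~ odd (p b')] ->
    (forall k, k.1 = b.1 -> k != b -> ~~ odd (p k) -> k = b') ->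
    [pick k | [&& k.1 == b.1, k != b & ~~ odd (p k)]] = Some b'.
  move=> h u; case: pickP => [k /and3P[/eqP k1 k2 k3]|/(_ b')]; last by rewrite h.
  by rewrite (u k).
have pa'e : ~~ odd (p a') by exact: extreme_even.
rewrite (pick_other a a') ?eqxx ?a'a //=.
have [xN ox px _] := inward_adjacent pa'.
have [_ _ _ uw] := inward_adjacent ea.
have [g r] := set_cell_cover xN pa'e ox px.
set x := inward (p a') in xN ox px g r *.
have dE' k : (set_cell p a' x k != p k) = (k == a').
  rewrite -(inj_eq val_inj) /= set_cellE //; case: (k =P a') => [->|_]; last by rewrite eqxx.
  exact: consecutive_neq.
split=> //.
- by rewrite r rp.
- apply/forallP => b; have [->|ba] := eqVneq b a.1; last first.
    have /existsP[j pj] := forallP pS b; apply/existsP; exists j.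
    by rewrite ffunE; case: eqP => // -[e _]; rewrite e eqxx in ba.
  apply/existsP; exists a.2; rewrite ffunE.
  by move: a'a; rewrite eq_sym -surjective_pairing => /negbTE->.
- apply/eqP => e; have := congr1 (fun c : cell => val (c a')) e.
  by rewrite /= set_cellE // eqxx wE // => /eqP; rewrite (negbTE (consecutive_neq px)).
- have pk : [pick k | [&& k.1 == a'.1, k != a' & ~~ odd (p k)]] = Some a.
    apply: pick_other; first by rewrite eqxx eq_sym a'a.
    move=> k k1 ka' pk; have [//|ka] := eqVneq k a.
    by move: ka'; rewrite (pu k k1 ka pk) eqxx.
  rewrite (pickE _ a' dE') pa' pk.
  apply/ffunP => k; apply: val_inj => /=; rewrite set_cellE -(uw _ (le4 w a) wpa); last exact: le4.
  by case: eqP => [->//|/eqP ka]; rewrite wE.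
Qed.

Lemma simplex_rk_inj s : s \in simplices -> {in s &, injective rk}.
Proof.
move=> /simplicesP[_ _ sc] c d cs ds e.
by apply: gle_rk_eq; rewrite ?e //; apply: incident_rk; rewrite ?e //; exact: sc.
Qed.

Lemma simplex_rk_surj s i : s \in simplices -> i < 16 -> exists2 c, c \in s & rk c = i.
Proof.
move=> sS i16; have [cs sph _] := simplicesP _ sS.
pose f c : 'I_16 := inord (rk c).
have fE c : c \in s -> f c = rk c :> nat.
  by move=> cin; rewrite inordK // ltnS rk_le15 // sph.
have /eqP e : f @: s == [set: 'I_16].
  rewrite eqEcard subsetT card_in_imset ?cs ?cardsT ?card_ord //.
  move=> c d cin din /(congr1 val) /=; rewrite !fE //; exact: (simplex_rk_inj sS).
have : Ordinal i16 \in f @: s by rewrite e inE.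
by move=> /imsetP[c cin /(congr1 val)] /=; rewrite fE // => ic; exists c.
Qed.

Let fillers (r : {set cell}) := [set u | (u \notin r) && ((u |: r) \in simplices)].

Let lower (r : {set cell}) u := [pick c in r | (rk c).+1 == rk u].
Let upper (r : {set cell}) u := [pick c in r | rk c == (rk u).+1].
Let swap r u := match lower r u, upper r u with
  | Some p, Some q => mid_swap p q u
  | None, Some q => bottom_swap q u
  | Some p, None => top_swap p u
  | None, None => u end.

Let filler_rk r u c : u \in fillers r -> c \in r -> rk c != rk u.
Proof.
rewrite inE => /andP[ur uS] cr; apply: contraNneq ur => e.
by rewrite -(simplex_rk_inj uS _ _ e) // !inE ?eqxx // cr orbT.
Qed.

Let lowerP r u : u \in fillers r -> 0 < rk u -> exists p, [/\ lower r u = Some p,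
  (rk p).+1 = rk u, gle p u & forall c, c \in r -> rk c < rk u -> gle c p].
Proof.
move=> uW u0; have := uW; rewrite inE => /andP[ur uS].
have [cs sph comp] := simplicesP _ uS.
have u15 : rk u <= 15 by apply: rk_le15; apply: sph; rewrite setU11.
rewrite /lower; case: pickP => [p /andP[pr /eqP pu]|].
  exists p; split=> //.
    by apply: incident_rk; [apply: comp; rewrite !inE ?eqxx ?pr ?orbT|lia].
  by move=> c cr lt; apply: incident_rk; [apply: comp; rewrite !inE ?cr ?pr ?orbT|lia].
have [|c] := @simplex_rk_surj _ (rk u).-1 uS; first by lia.
rewrite !inE => /orP[/eqP->|cr] e; first by lia.
by move=> /(_ c); rewrite cr /= e prednK // eqxx.
Qed.

Let upperP r u : u \in fillers r -> rk u < 15 -> exists q, [/\ upper r u = Some q,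
  rk q = (rk u).+1, gle u q, on_spheres q & forall c, c \in r -> rk u < rk c -> gle q c].
Proof.
move=> uW u0; have := uW; rewrite inE => /andP[ur uS].
have [cs sph comp] := simplicesP _ uS.
rewrite /upper; case: pickP => [p /andP[pr /eqP pu]|].
  exists p; split=> //.
  - by apply: incident_rk; [apply: comp; rewrite !inE ?eqxx ?pr ?orbT|lia].
  - by apply: sph; rewrite !inE pr orbT.
  - by move=> c cr lt; apply: incident_rk; [apply: comp; rewrite !inE ?cr ?pr ?orbT|lia].
have [|c] := @simplex_rk_surj _ (rk u).+1 uS; first by lia.
rewrite !inE => /orP[/eqP->|cr] e; first by lia.
by move=> /(_ c); rewrite cr /= e eqxx.
Qed.

Let filler_intro r u u' : u \in fillers r -> rk u' = rk u -> on_spheres u' ->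
  (forall c, c \in r -> rk c < rk u -> gle c u') ->
  (forall c, c \in r -> rk u < rk c -> gle u' c) -> u' \in fillers r.
Proof.
move=> uW e u'S lo up; have := uW; rewrite in_set => /andP[ur uS].
have u'r : u' \notin r by apply/negP => /(filler_rk uW); rewrite e eqxx.
rewrite in_set u'r; have [cs sph comp] := simplicesP _ uS.
have u'c c : c \in r -> incident u' c.
  move=> cr; have := filler_rk uW cr; rewrite neq_ltn /incident => /orP[h|h].
    by rewrite lo ?orbT.
  by rewrite up.
apply/simplicesP; split.
- by move: cs; rewrite !cardsU1 ur u'r.
- by move=> c /setU1P[->//|cr]; apply: sph; rewrite !inE cr orbT.
- move=> c d /setU1P[->|cr] /setU1P[->|dr]; first by rewrite /incident gle_refl.
  + exact: u'c.
  + by rewrite /incident orbC; exact: u'c.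
  + by apply: comp; rewrite !inE ?cr ?dr orbT.
Qed.

(** All fillers of [r] have the one rank missing from [r]. The exchanges preserve the rank, hence
    also the neighbours [lower] and [upper], so [swap r] is an involution without fixed points. *)
Lemma simplices_thin (r : {set cell}) : ~~ odd #|[set u | (u \notin r) && ((u |: r) \in simplices)]|.
Proof.
apply: (@even_involution _ _ (swap r)) => u uW.
have uS : on_spheres u.
  have := uW; rewrite inE => /andP[_ /simplicesP[_ sph _]]; apply: sph; exact: setU11.
have u15 := rk_le15 uS.
have lowE u' : rk u' = rk u -> lower r u' = lower r u by rewrite /lower => ->.
have upE u' : rk u' = rk u -> upper r u' = upper r u by rewrite /upper => ->.
have fin u' : rk u' = rk u -> on_spheres u' ->
  (forall c, c \in r -> rk c < rk u -> gle c u') ->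
  (forall c, c \in r -> rk u < rk c -> gle u' c) -> u' \in fillers r by exact: filler_intro.
rewrite /swap.
have [u0|u0] := posnP (rk u).
  have -> : lower r u = None by rewrite /lower; case: pickP => // c /andP[_]; rewrite u0.
  have [|q [qE rq uq qS qc]] := upperP uW; first by rewrite u0.
  rewrite qE; have [|w1 w2 w3 w4] := bottom_swapP uq u0; first by rewrite rq.
  rewrite lowE ?upE ?w2 ?u0 // qE.
  have -> : lower r u = None by rewrite /lower; case: pickP => // c /andP[_]; rewrite u0.
  split=> //; apply: fin; rewrite ?w2 ?u0 //; first exact: on_spheres_le w1 qS.
  by move=> c cr c0; apply: gle_trans w1 (qc c cr _); rewrite u0.
have [p [pE rp pu pc]] := lowerP uW u0; rewrite pE.
have up : u != p by apply/eqP => e; move: rp; rewrite e; lia.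
have [u14|u14] := ltnP (rk u) 15.
  have [q [qE rq uq qS qc]] := upperP uW u14; rewrite qE.
  have [w1 w2 w3 w4 w5] := mid_swapP pu uq up.
  have w : rk (mid_swap p q u) = rk u.
    by apply/eqP; rewrite -(eqn_add2r (rk u)) w3 rq -rp addnS addSn.
  rewrite lowE ?upE ?w // pE qE; split=> //; apply: fin => //; first exact: on_spheres_le w2 qS.
    by move=> c cr lt; apply: gle_trans (pc c cr lt) w1.
  by move=> c cr lt; apply: gle_trans w2 (qc c cr lt).
have u15' : rk u = 15 by lia.
have upN : upper r u = None.
  rewrite /upper; case: pickP => // c /andP[cr /eqP e].
  have := uW; rewrite inE => /andP[_ /simplicesP[_ sph _]].
  by have := rk_le15 (sph c _); rewrite !inE cr orbT e u15' => /(_ isT).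
have [|w1 w2 w3 w4 w5] := top_swapP pu u15' _ uS; first by lia.
have {}w2 : rk (top_swap p u) = rk u by rewrite w2.
rewrite upN lowE ?upE ?w2 // pE upN; split=> //; apply: fin; rewrite ?w2 //.
  by move=> c cr lt; apply: gle_trans (pc c cr lt) w1.
by move=> c cr lt; have := uW; rewrite inE => /andP[_ /simplicesP[_ sph _]];
  have := rk_le15 (sph c _); rewrite !inE cr orbT => /(_ isT); lia.
Qed.

End Grid.

(* The components of the test map, named after the characters of [(Z/2)^3]
   by which the sign changes of the three spheres act on them. *)
Inductive component :=
  X0 | Y0 | X1 | Y1 | Z0 | Z1 | Z2 | XZ0 | YZ0 | XZ1 | YZ1 | XY0 | XY1 | XYZ0 | XYZ1.

Definition component_code (j : component) : 'I_15 :=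
  match j with
  | X0 => inord 0 | Y0 => inord 1 | X1 => inord 2 | Y1 => inord 3
  | Z0 => inord 4 | Z1 => inord 5 | Z2 => inord 6 | XZ0 => inord 7
  | YZ0 => inord 8 | XZ1 => inord 9 | YZ1 => inord 10 | XY0 => inord 11
  | XY1 => inord 12 | XYZ0 => inord 13 | XYZ1 => inord 14 end.

Definition component_decode (i : 'I_15) : component :=
  nth X0 [:: X0; Y0; X1; Y1; Z0; Z1; Z2; XZ0; YZ0; XZ1; YZ1; XY0; XY1; XYZ0; XYZ1] i.

Lemma component_codeK : cancel component_code component_decode.
Proof. by case; rewrite /component_decode inordK. Qed.

HB.instance Definition _ := Finite.copy component (can_type component_codeK).

Lemma card_component : #|{: component}| = 15.
Proof.
rewrite -[RHS](card_ord 15); apply: (bij_eq_card (f := component_code)).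
exists component_decode; first exact: component_codeK.
by case=> i lt; apply: val_inj; do 15 (case: i lt => [|i] lt; first by rewrite /= inordK).
Qed.

Definition swap_component (j : component) : component :=
  match j with
  | X0 => Y0 | Y0 => X0 | X1 => Y1 | Y1 => X1
  | XZ0 => YZ0 | YZ0 => XZ0 | XZ1 => YZ1 | YZ1 => XZ1 | j => j end.

Definition character (j : component) : bool * bool * bool :=
  match j with
  | X0 | X1 => (true, false, false)
  | Y0 | Y1 => (false, true, false)
  | Z0 | Z1 | Z2 => (false, false, true)
  | XZ0 | XZ1 => (true, false, true)
  | YZ0 | YZ1 => (false, true, true)
  | XY0 | XY1 => (true, true, false)
  | XYZ0 | XYZ1 => (true, true, true) end.

(* [(e0, e1, e2, s)] swaps the first two spheres if [s], and then changes the
   sign of the sphere [b] if [eb]. *)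
Definition symmetry : Type := bool * bool * bool * bool.

Definition flips (k : symmetry) (b : 'I_3) : bool :=
  let: (e0, e1, e2, s) := k in nth e2 [:: e0; e1] b.

Definition swaps (k : symmetry) (b : 'I_3) : 'I_3 :=
  if k.2 then match val b with 0%N => inord 1 | 1%N => inord 0 | _ => b end else b.

Definition flips_component (k : symmetry) (j : component) : bool :=
  let: (e0, e1, e2, s) := k in let: (c0, c1, c2) := character j in
  (e0 && c0) (+) (e1 && c1) (+) (e2 && c2).

Definition moves_component (k : symmetry) (j : component) : component :=
  if k.2 then swap_component j else j.

Definition symmetry_mul (k m : symmetry) : symmetry :=
  let: (e0, e1, e2, s) := k in let: (f0, f1, f2, t) := m in
  if s then (e0 (+) f1, e1 (+) f0, e2 (+) f2, ~~ t) else (e0 (+) f0, e1 (+) f1, e2 (+) f2, t).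

Definition symmetry_inv (k : symmetry) : symmetry :=
  let: (e0, e1, e2, s) := k in if s then (e1, e0, e2, s) else k.

Definition symmetry1 : symmetry := (false, false, false, false).

Lemma ord3_ind (P : 'I_3 -> Prop) : P (inord 0) -> P (inord 1) -> P (inord 2) -> forall b, P b.
Proof.
move=> P0 P1 P2 [b lt]; have -> : Ordinal lt = inord b by apply: val_inj; rewrite /= inordK.
by move: b lt => [|[|[|b]]].
Qed.

Lemma flips_mul k m b : flips (symmetry_mul k m) b = flips k b (+) flips m (swaps k b).
Proof.
by case: k m => [[[e0 e1] e2] []] [[[f0 f1] f2] t]; elim/ord3_ind: b; rewrite /flips /swaps /= !inordK.
Qed.

Lemma swaps_mul k m b : swaps (symmetry_mul k m) b = swaps m (swaps k b).
Proof.
by case: k m => [[[e0 e1] e2] []] [[[f0 f1] f2] []]; elim/ord3_ind: b; rewrite /swaps /= ?inordK.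
Qed.

Lemma flips_component_mul k m j : flips_component (symmetry_mul k m) j =
  flips_component k j (+) flips_component m (moves_component k j).
Proof.
by case: k m => [[[[] []] []] []] [[[[] []] []] t]; case: j.
Qed.

Lemma moves_component_mul k m j : moves_component (symmetry_mul k m) j =
  moves_component m (moves_component k j).
Proof. by case: k m => [[[e0 e1] e2] []] [[[f0 f1] f2] []]; case: j. Qed.

Lemma moves_component_inj k : injective (moves_component k).
Proof. by case: k => [[[e0 e1] e2] []] [] []. Qed.

Lemma symmetry_mulVl k : symmetry_mul (symmetry_inv k) k = symmetry1.
Proof. by case: k => [[[[] []] []] []]. Qed.

Lemma symmetry_mulK k l : symmetry_mul (symmetry_mul l k) (symmetry_inv k) = l.
Proof.
case: k l => [[[e0 e1] e2] []] [[[f0 f1] f2] []] /=; rewrite -?addbA ?addbb ?addbF ?negbK //.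
Qed.

Lemma symmetry_mulI k : injective (symmetry_mul^~ k).
Proof. apply: (can_inj (g := symmetry_mul^~ (symmetry_inv k))) => l; exact: symmetry_mulK. Qed.

(** * Symmetries acting on cells *)

Section CellAction.
Variable N : nat.
Hypothesis N_gt0 : 0 < N.

Definition cell_act (k : symmetry) (c : cell N) : cell N :=
  [ffun i => if flips k i.1 then rev_ord (c (swaps k i.1, i.2)) else c (swaps k i.1, i.2)].

Lemma cell_act_mul k m c : cell_act k (cell_act m c) = cell_act (symmetry_mul k m) c.
Proof.
apply/ffunP => i; rewrite !ffunE /= flips_mul swaps_mul.
by case: (flips k _) => //=; case: (flips m _) => //=; rewrite rev_ordK.
Qed.

Lemma cell_act1 c : cell_act symmetry1 c = c.
Proof.
apply/ffunP => -[b i]; rewrite ffunE /swaps /=.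
by elim/ord3_ind: b; rewrite /= inordK.
Qed.

Lemma cell_actK k c : cell_act (symmetry_inv k) (cell_act k c) = c.
Proof. by rewrite cell_act_mul symmetry_mulVl cell_act1. Qed.

Lemma cell_act_inj k : injective (cell_act k).
Proof. exact: can_inj (cell_actK k). Qed.

Lemma gle_act k c d : gle c d -> gle (cell_act k c) (cell_act k d).
Proof.
move=> /forallP cd; apply/forallP => i; rewrite !ffunE.
have := cd (swaps k i.1, i.2); have := ltn_ord (c (swaps k i.1, i.2)).
have := ltn_ord (d (swaps k i.1, i.2)); case: ifP => _ //=.
rewrite /kle /consecutive; move: (nat_of_ord _) (nat_of_ord _) => a b; lia.
Qed.

Lemma incident_act k c d : incident c d -> incident (cell_act k c) (cell_act k d).
Proof. by case/orP=> /(gle_act k) h; rewrite /incident h ?orbT. Qed.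

Lemma on_spheres_act k c : on_spheres c -> on_spheres (cell_act k c).
Proof.
move=> /forallP cS; apply/forallP => b; have /existsP[i ci] := cS (swaps k b).
apply/existsP; exists i; rewrite ffunE /=; case: ifP => _ //=.
by move: ci (ltn_ord (c (swaps k b, i))); rewrite /extreme; move: (nat_of_ord _) => x; lia.
Qed.

Lemma simplices_act k (s : {set cell N}) : s \in simplices N -> cell_act k @: s \in simplices N.
Proof.
move=> /simplicesP[cs sph comp]; apply/simplicesP; split.
- by rewrite card_imset //; exact: cell_act_inj.
- by move=> _ /imsetP[c cin ->]; apply: on_spheres_act; exact: sph.
- move=> _ _ /imsetP[c cin ->] /imsetP[d din ->]; apply: incident_act; exact: comp.
Qed.

(* The cells at which the symmetries fail to act freely, up to adjacency. *)
Definition cell_core : {set cell N} := [set c | [exists k : symmetry, [exists l : symmetry,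
  (k != l) && incident (cell_act k c) (cell_act l c)]]].

Lemma cell_coreP c : reflect (exists2 k, k != symmetry1 & incident (cell_act k c) c)
  (c \in cell_core).
Proof.
rewrite inE; apply: (iffP existsP) => [[k /existsP[l /andP[kl cl]]]|[k k1 ck]]; last first.
  by exists k; apply/existsP; exists symmetry1; rewrite k1 cell_act1.
exists (symmetry_mul (symmetry_inv l) k).
  apply: contra kl => /eqP e; have := symmetry_mulVl (symmetry_inv l).
  have ll : symmetry_inv (symmetry_inv l) = l by case: (l) => [[[? ?] ?] []].
  rewrite ll => lV; move: e => /(congr1 (symmetry_mul l)) /eqP.
  by case: (l) (k) => [[[[] []] []] []] [[[[] []] []] []].
by have := incident_act (symmetry_inv l) cl; rewrite cell_actK cell_act_mul.
Qed.

Lemma cell_core_act k c : (cell_act k c \in cell_core) = (c \in cell_core).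
Proof.
have sub m d : d \in cell_core -> cell_act m d \in cell_core.
  rewrite !inE => /existsP[l /existsP[l' /andP[ll' cl]]].
  have e l0 : cell_act (symmetry_mul l0 (symmetry_inv m)) (cell_act m d) = cell_act l0 d.
    by rewrite -cell_act_mul cell_actK.
  apply/existsP; exists (symmetry_mul l (symmetry_inv m)).
  apply/existsP; exists (symmetry_mul l' (symmetry_inv m)).
  by rewrite !e cl andbT; apply: contra ll' => /eqP/symmetry_mulI->.
by apply/idP/idP => [/(sub (symmetry_inv k))|]; [rewrite cell_actK|exact: sub].
Qed.

Lemma cell_act_free c k l : c \notin cell_core -> cell_act k c = cell_act l c -> k = l.
Proof.
move=> cc e; apply/eqP; apply: contraR cc => kl; rewrite inE.
by apply/existsP; exists k; apply/existsP; exists l; rewrite kl e /incident gle_refl.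
Qed.

Lemma simplex_act_free (s : {set cell N}) c k : s \in simplices N -> c \in s ->
  cell_act k c \in s -> c \notin cell_core -> cell_act k c = c.
Proof.
move=> /simplicesP[_ _ comp] cs ks cc; have [->|k1] := eqVneq k symmetry1.
  exact: cell_act1.
by case/negP: cc; apply/cell_coreP; exists k => //; exact: comp.
Qed.

Definition near_cells (c d : cell N) := forall i, c i <= (d i).+1 /\ d i <= (c i).+1.

Lemma incident_near c d : incident c d -> near_cells c d.
Proof.
by move=> /orP[] /forallP h i; have := h i; rewrite /kle /consecutive; lia.
Qed.

(** A pure sign change moves an extreme entry to the opposite face, too far to stay incident. So the
    symmetry uses the exchange, and its first sign [e0] decides between x near y and x near -y. *)
Lemma core_near c : on_spheres c -> c \in cell_core -> exists e : bool, forall i,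
  let x := val (c (inord 0, i)) in let y := val (c (inord 1, i)) in
  if e then x + y <= (4 * N).+1 /\ 4 * N <= (x + y).+1 else x <= y.+1 /\ y <= x.+1.
Proof.
move=> /forallP cS /cell_coreP[k k1 /incident_near kc].
case: k k1 kc => [[[e0 e1] e2] [|]] k1 kc.
  exists e0 => i; have := kc (inord 0, i).
  rewrite ffunE /swaps /flips /= inordK //=.
  have := ltn_ord (c (inord 1, i)); have := ltn_ord (c (inord 0, i)).
  by case: e0 {k1 kc} => /=; lia.
have [b eb] : exists b, flips (e0, e1, e2, false) b.
  by case: e0 e1 e2 k1 {kc} => [] [] [] //= _; [exists (inord 0)|exists (inord 0)|exists (inord 0)
    |exists (inord 0)|exists (inord 1)|exists (inord 1)|exists (inord 2)]; rewrite /= inordK.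
have /existsP[i ci] := cS b; have := kc (b, i).
rewrite ffunE eb /=; have := ltn_ord (c (b, i)); move: ci; rewrite /extreme /swaps /=.
by move: (nat_of_ord _) => x; lia.
Qed.

End CellAction.

Local Open Scope ring_scope.

(** * The test map *)

Section TestMap.
Variable R : realFieldType.
Implicit Types x y z : 'I_6 -> R.

Definition clip (r s : R) : R := Num.max (- r) (Num.min r s).
(** [trim] vanishes on [-1/2, 1/2] and [saturate] is 1 from 1/2 on. These flat parts make [std_map]
    coincide with a linear map near its zeros. *)
Definition trim (s : R) : R := s - clip (1 / 2) s.
Definition saturate (s : R) : R := clip 1 (2 * s).

Lemma clipN r s : 0 <= r -> clip r (- s) = - clip r s.
Proof.
by move=> r0; rewrite /clip oppr_max opprK oppr_min min_maxr [Num.min r (- r)]min_r //; lra.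
Qed.

Lemma trimN s : trim (- s) = - trim s.
Proof. by rewrite /trim clipN; lra. Qed.

Lemma saturateN s : saturate (- s) = - saturate s.
Proof. by rewrite /saturate mulrN clipN; lra. Qed.

Lemma trim_small s : `|s| <= 1 / 2 -> trim s = 0.
Proof.
by rewrite ler_norml => /andP[s1 s2]; rewrite /trim /clip min_r // max_r // ?subrr //; lra.
Qed.

Lemma trim_eq0 s : trim s = 0 -> `|s| <= 1 / 2.
Proof.
move=> e; rewrite ler_norml; move: e; rewrite /trim /clip.
case: (lerP (1 / 2) s) => h; first by rewrite max_r; lra.
by case: (lerP (- (1 / 2)) s); lra.
Qed.

Lemma trim1 : trim 1 = 1 / 2.
Proof. by rewrite /trim /clip min_l ?max_r; lra. Qed.

Lemma saturate_eq0 s : saturate s = 0 -> s = 0.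
Proof.
rewrite /saturate /clip; case: (lerP 1 (2 * s)) => h; first by rewrite max_r; lra.
by case: (lerP (- 1) (2 * s)); lra.
Qed.

Lemma saturate_big s : 1 / 2 <= s -> saturate s = 1.
Proof. by move=> h; rewrite /saturate /clip min_l ?max_r; lra. Qed.

Definition in_cube_boundary x := (forall i, `|x i| <= 1) /\ exists i, `|x i| = 1.

Definition extent x := Num.max `|x (inord 2)| `|x (inord 3)|.
(** It vanishes when both extents are small, hence near the zeros of [std_map], and equals 1 when
    both extents are 1, as on points supported on the entries 2 and 3. *)
Definition excess x y := Num.max 0 (extent x + extent y - 1).

Definition im_part x y : R :=
  x (inord 4) * y (inord 5) + x (inord 5) * y (inord 4)
  - excess x y * (x (inord 2) * y (inord 3) + x (inord 3) * y (inord 2)).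

Definition mixed_part x y : R :=
  x (inord 4) * y (inord 3) + x (inord 5) * y (inord 2)
  + x (inord 2) * y (inord 5) + x (inord 3) * y (inord 4).

(* With [u = x2 + i x3], [v = x4 + i x5], likewise [u'], [v'] for [y], and
   [r = excess x y], the last components are [zt u + om v] (and the same for
   [y]), [Re (v v' + r conj (u u'))] and
   [(b1 + i b2) (Im (v v' + r conj (u u')) + i r Im (v u' + u v'))]. *)
Definition test_map (a0 a1 a2 b1 b2 zt1 zt2 om : R) x y (j : component) : R :=
  match j with
  | X0 => x (inord 0) | Y0 => y (inord 0) | X1 => x (inord 1) | Y1 => y (inord 1)
  | Z0 => a0 | Z1 => a1 | Z2 => a2
  | XZ0 => zt1 * x (inord 2) - zt2 * x (inord 3) + om * x (inord 4)
  | YZ0 => zt1 * y (inord 2) - zt2 * y (inord 3) + om * y (inord 4)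
  | XZ1 => zt1 * x (inord 3) + zt2 * x (inord 2) + om * x (inord 5)
  | YZ1 => zt1 * y (inord 3) + zt2 * y (inord 2) + om * y (inord 5)
  | XY0 => trim (x (inord 0)) * trim (y (inord 0)) + trim (x (inord 1)) * trim (y (inord 1))
           + trim (x (inord 2)) * trim (y (inord 2)) + trim (x (inord 3)) * trim (y (inord 3))
           + x (inord 4) * y (inord 4) + x (inord 5) * y (inord 5)
  | XY1 => x (inord 4) * y (inord 4) - x (inord 5) * y (inord 5)
           + excess x y * (x (inord 2) * y (inord 2) - x (inord 3) * y (inord 3))
  | XYZ0 => b1 * saturate (im_part x y) - b2 * (excess x y * mixed_part x y)
  | XYZ1 => b2 * saturate (im_part x y) + b1 * (excess x y * mixed_part x y)
  end.

Lemma ord6_ind (P : 'I_6 -> Prop) : P (inord 0) -> P (inord 1) -> P (inord 2) ->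
  P (inord 3) -> P (inord 4) -> P (inord 5) -> forall i, P i.
Proof.
move=> P0 P1 P2 P3 P4 P5 [i lt].
have -> : Ordinal lt = inord i by apply: val_inj; rewrite /= inordK.
by move: i lt => [|[|[|[|[|[|i]]]]]].
Qed.

Lemma cube_boundary_neq0 x : in_cube_boundary x -> ~ (forall i, x i = 0).
Proof. by move=> [_ [i xi]] x0; move: xi; rewrite x0 normr0 => /esym/eqP; rewrite oner_eq0. Qed.

Lemma sqr_sum_eq0 (a b : R) : a ^+ 2 + b ^+ 2 = 0 -> a = 0 /\ b = 0.
Proof.
move=> /eqP; rewrite paddr_eq0 ?sqr_ge0 // !sqrf_eq0 => /andP[/eqP-> /eqP->].
by [].
Qed.

(** The complex product (a + ib)(c + id) vanishes only if a factor does, by multiplicativity of the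
    norm. *)
Lemma mul_complex_eq0 (a b c d : R) : a * c - b * d = 0 -> a * d + b * c = 0 ->
  (a = 0 /\ b = 0) \/ (c = 0 /\ d = 0).
Proof.
move=> h1 h2.
have /eqP : (a ^+ 2 + b ^+ 2) * (c ^+ 2 + d ^+ 2) = 0.
  transitivity ((a * c - b * d) ^+ 2 + (a * d + b * c) ^+ 2); first by ring.
  by rewrite h1 h2; ring.
by rewrite mulf_eq0 => /orP[]/eqP/sqr_sum_eq0; [left|right].
Qed.

Lemma extent_eq1 x : in_cube_boundary x -> x (inord 0) = 0 -> x (inord 1) = 0 ->
  x (inord 4) = 0 -> x (inord 5) = 0 -> extent x = 1.
Proof.
move=> [x1 [i xi]] e0 e1 e4 e5.
have h j : `|x j| != 0 -> `|x j| <= extent x.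
  elim/ord6_ind: j; rewrite ?e0 ?e1 ?e4 ?e5 ?normr0 ?eqxx // => _.
    by rewrite /extent le_max lexx.
  by rewrite /extent le_max lexx orbT.
apply/eqP; rewrite eq_le -{2}xi h ?xi ?oner_neq0 // andbT.
by rewrite /extent ge_max !x1.
Qed.

(** In the complex notation above, (b1, b2) nonzero gives v v' = - r conj (u u') and r Im (v u' + u
    v') = 0, besides zt u + om v = 0 and zt u' + om v' = 0. With the entries 0 and 1 zero, these
    equations have no solution on the two spheres. *)
Lemma test_map_zero a0 a1 a2 b1 b2 zt1 zt2 om x y :
  in_cube_boundary x -> in_cube_boundary y ->
  ~ [/\ zt1 = 0, zt2 = 0 & om = 0] ->
  (forall j, test_map a0 a1 a2 b1 b2 zt1 zt2 om x y j = 0) ->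
  b1 = 0 /\ b2 = 0.
Proof.
move=> xS yS zt0 F0; apply: contrapT => b0.
have := F0 X0; have := F0 X1; have := F0 Y0; have := F0 Y1 => /= y1 y0 x1 x0.
have := F0 XZ0; have := F0 XZ1; have := F0 YZ0; have := F0 YZ1 => /= py1 py0 px1 px0.
have := F0 XY1; have := F0 XYZ0; have := F0 XYZ1 => /=.
have nx := cube_boundary_neq0 xS; have ny := cube_boundary_neq0 yS.
have xz : x (inord 2) = 0 -> x (inord 3) = 0 -> x (inord 4) = 0 -> x (inord 5) = 0 -> False.
  by move=> *; apply: nx; apply: ord6_ind.
have yz : y (inord 2) = 0 -> y (inord 3) = 0 -> y (inord 4) = 0 -> y (inord 5) = 0 -> False.
  by move=> *; apply: ny; apply: ord6_ind.
have ex : x (inord 4) = 0 -> x (inord 5) = 0 -> extent x = 1 by exact: extent_eq1.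
have ey : y (inord 4) = 0 -> y (inord 5) = 0 -> extent y = 1 by exact: extent_eq1.
have r0 : 0 <= excess x y by rewrite /excess le_max lexx.
have rE : excess x y = Num.max 0 (extent x + extent y - 1) by [].
rewrite /im_part /mixed_part.
move: (excess x y) r0 rE => r r0 rE.
move: (x (inord 2)) (x (inord 3)) (x (inord 4)) (x (inord 5)) px0 px1 xz ex => x2 x3 x4 x5 px0 px1 xz ex.
move: (y (inord 2)) (y (inord 3)) (y (inord 4)) (y (inord 5)) py0 py1 yz ey => y2 y3 y4 y5 py0 py1 yz ey.
pose m := x4 * y5 + x5 * y4 - r * (x2 * y3 + x3 * y2).
pose m' := x4 * y3 + x5 * y2 + x2 * y5 + x3 * y4.
rewrite -/m -/m' => q1 q0 c1.
have [//|[/saturate_eq0 m0 rm']] : (b1 = 0 /\ b2 = 0) \/ (saturate m = 0 /\ r * m' = 0).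
  by apply: mul_complex_eq0; rewrite // addrC.
have [U1 U1E] : exists U1, U1 = x2 * y2 - x3 * y3 by eexists.
have [U2 U2E] : exists U2, U2 = x2 * y3 + x3 * y2 by eexists.
have V1E : x4 * y4 - x5 * y5 = - r * U1 by apply/eqP; rewrite -subr_eq0 -[X in _ == X]c1 U1E; apply/eqP; ring.
have V2E : x4 * y5 + x5 * y4 = r * U2 by apply/eqP; rewrite -subr_eq0 -[X in _ == X]m0 U2E /m; apply/eqP; ring.
have px : zt1 = 0 -> zt2 = 0 -> om = 0 \/ x4 = 0 /\ x5 = 0.
  move=> z1 z2; move: px0 px1; rewrite z1 z2 !mul0r subr0 !add0r => /eqP + /eqP.
  by rewrite !mulf_eq0 => /orP[]/eqP->; [left|move=> /orP[]/eqP->; [left|right]].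
have py : zt1 = 0 -> zt2 = 0 -> om = 0 \/ y4 = 0 /\ y5 = 0.
  move=> z1 z2; move: py0 py1; rewrite z1 z2 !mul0r subr0 !add0r => /eqP + /eqP.
  by rewrite !mulf_eq0 => /orP[]/eqP->; [left|move=> /orP[]/eqP->; [left|right]].
(* If om = 0, then zt is nonzero, so u = u' = 0 and v v' = 0: one of the points vanishes. *)
have [om0|om0] := eqVneq om 0.
  have [[? ?]|[x20 x30]] : (zt1 = 0 /\ zt2 = 0) \/ (x2 = 0 /\ x3 = 0).
  - by apply: mul_complex_eq0; [rewrite -[RHS]px0|rewrite -[RHS]px1]; rewrite om0; ring.
  - by apply: zt0.
  have [[? ?]|[y20 y30]] : (zt1 = 0 /\ zt2 = 0) \/ (y2 = 0 /\ y3 = 0).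
  - by apply: mul_complex_eq0; [rewrite -[RHS]py0|rewrite -[RHS]py1]; rewrite om0; ring.
  - by apply: zt0.
  have [[? ?]|[? ?]] : (x4 = 0 /\ x5 = 0) \/ (y4 = 0 /\ y5 = 0).
  - by apply: mul_complex_eq0; rewrite ?V1E ?V2E ?U1E ?U2E x20 x30; ring.
  - exact: xz.
  - exact: yz.
have xv0 : x2 = 0 -> x3 = 0 -> x4 = 0 /\ x5 = 0.
  move=> e2 e3; move: px0 px1; rewrite e2 e3 !mulr0 subr0 !add0r => /eqP + /eqP.
  by rewrite !mulf_eq0 (negbTE om0) => /eqP-> /eqP->.
have yv0 : y2 = 0 -> y3 = 0 -> y4 = 0 /\ y5 = 0.
  move=> e2 e3; move: py0 py1; rewrite e2 e3 !mulr0 subr0 !add0r => /eqP + /eqP.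
  by rewrite !mulf_eq0 (negbTE om0) => /eqP-> /eqP->.
have xu : ~ (x2 = 0 /\ x3 = 0) by move=> [e2 e3]; have [] := xv0 e2 e3; exact: xz.
have yu : ~ (y2 = 0 /\ y3 = 0) by move=> [e2 e3]; have [] := yv0 e2 e3; exact: yz.
(* If r = 0, then v v' = 0 forces zt = 0 because u and u' are nonzero, and then v = v' = 0. But both
   extents are then 1, and r would be 1. *)
have [re0|rn0] := eqVneq r 0.
  have vv : (x4 = 0 /\ x5 = 0) \/ (y4 = 0 /\ y5 = 0).
    by apply: mul_complex_eq0; rewrite ?V1E ?V2E re0; ring.
  have zt : zt1 = 0 /\ zt2 = 0.
    case: vv => -[e4 e5].
      have [//|//] : (zt1 = 0 /\ zt2 = 0) \/ (x2 = 0 /\ x3 = 0).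
      by apply: mul_complex_eq0; [rewrite -[RHS]px0|rewrite -[RHS]px1]; rewrite ?e4 ?e5; ring.
    have [//|//] : (zt1 = 0 /\ zt2 = 0) \/ (y2 = 0 /\ y3 = 0).
    by apply: mul_complex_eq0; [rewrite -[RHS]py0|rewrite -[RHS]py1]; rewrite ?e4 ?e5; ring.
  have [z1 z2] := zt.
  have [e|[x40 x50]] := px z1 z2; first by rewrite e eqxx in om0.
  have [e|[y40 y50]] := py z1 z2; first by rewrite e eqxx in om0.
  move: rE; rewrite ex // ey // re0 addrK => /esym/eqP.
  by rewrite max_r ?oner_eq0 // ler01.
have m'0 : m' = 0 by move/eqP: rm'; rewrite mulf_eq0 (negbTE rn0) => /eqP.
(* s + it is the product zt u u'. *)
pose s := zt1 * U1 - zt2 * U2; pose t := zt1 * U2 + zt2 * U1.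
have ox4 : om * x4 = - (zt1 * x2 - zt2 * x3).
  by apply/eqP; rewrite -subr_eq0 -[X in _ == X]px0; apply/eqP; ring.
have ox5 : om * x5 = - (zt1 * x3 + zt2 * x2).
  by apply/eqP; rewrite -subr_eq0 -[X in _ == X]px1; apply/eqP; ring.
have oy4 : om * y4 = - (zt1 * y2 - zt2 * y3).
  by apply/eqP; rewrite -subr_eq0 -[X in _ == X]py0; apply/eqP; ring.
have oy5 : om * y5 = - (zt1 * y3 + zt2 * y2).
  by apply/eqP; rewrite -subr_eq0 -[X in _ == X]py1; apply/eqP; ring.
have t0 : t = 0.
  have : om * m' = - 2 * t.
    transitivity (om * x4 * y3 + om * x5 * y2 + x2 * (om * y5) + x3 * (om * y4)).
      by rewrite /m'; ring.
    by rewrite ox4 ox5 oy4 oy5 /t U1E U2E; ring.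
  by rewrite m'0 mulr0 => /esym/eqP; rewrite mulf_eq0 oppr_eq0 pnatr_eq0 => /eqP.
(* Multiplying v v' = - r conj (u u') by om^2 u u' gives - om^2 r |u u'|^2 = (zt u u')^2 = s^2,
   since t = 0. The two sides have opposite signs, so u u' = 0. *)
have : - (om ^+ 2 * r * (U1 ^+ 2 + U2 ^+ 2)) = s ^+ 2.
  transitivity (((om * x4) * (om * y4) - (om * x5) * (om * y5)) * U1
     - ((om * x4) * (om * y5) + (om * x5) * (om * y4)) * U2).
    transitivity (om ^+ 2 * ((x4 * y4 - x5 * y5) * U1 - (x4 * y5 + x5 * y4) * U2)).
      by rewrite V1E V2E; ring.
    by ring.
  rewrite ox4 ox5 oy4 oy5; transitivity (s ^+ 2 - t ^+ 2); last by rewrite t0; ring.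
  by rewrite /s /t U1E U2E; ring.
move=> h.
have : om ^+ 2 * r * (U1 ^+ 2 + U2 ^+ 2) = 0.
  apply/eqP; rewrite eq_le; apply/andP; split.
    by have := sqr_ge0 s; rewrite -h oppr_ge0.
  by apply: mulr_ge0; [apply: mulr_ge0 r0; exact: sqr_ge0|apply: addr_ge0; exact: sqr_ge0].
move/eqP; rewrite !mulf_eq0 (negbTE rn0) (negbTE om0) /= => /eqP/sqr_sum_eq0[U10 U20].
have [|] : (x2 = 0 /\ x3 = 0) \/ (y2 = 0 /\ y3 = 0); [|exact: xu|exact: yu].
by apply: mul_complex_eq0; rewrite -?U1E -?U2E.
Qed.

End TestMap.

(** * Equivariant continuous maps on triples of cube boundary points *)

Section Configurations.
Variable R : realFieldType.

Definition configuration := 'I_3 -> 'I_6 -> R.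
Implicit Types p q : configuration.

Definition spherical p := forall b, in_cube_boundary (p b).

Definition conf_act (k : symmetry) p : configuration :=
  fun b i => (-1) ^+ flips k b * p (swaps k b) i.

Definition equivariant_map (F : configuration -> component -> R) :=
  forall k p j, F (conf_act k p) j = (-1) ^+ flips_component k j * F p (moves_component k j).

Definition negv (x : 'I_6 -> R) : 'I_6 -> R := fun i => - x i.

Lemma equivariant_intro (G : ('I_6 -> R) -> ('I_6 -> R) -> ('I_6 -> R) -> component -> R) :
  (forall x y z j, G (negv x) y z j = (-1) ^+ (character j).1.1 * G x y z j) ->
  (forall x y z j, G x (negv y) z j = (-1) ^+ (character j).1.2 * G x y z j) ->
  (forall x y z j, G x y (negv z) j = (-1) ^+ (character j).2 * G x y z j) ->
  (forall x y z j, G y x z j = G x y z (swap_component j)) ->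
  equivariant_map (fun p => G (p (inord 0)) (p (inord 1)) (p (inord 2))).
Proof.
move=> Gx Gy Gz Gs k p j.
pose sg (e : bool) (x : 'I_6 -> R) : 'I_6 -> R := fun i => (-1) ^+ e * x i.
have sgT x : sg true x = negv x by apply/funext => i; rewrite /sg mulN1r.
have sgF x : sg false x = x by apply/funext => i; rewrite /sg mul1r.
case: k => [[[e0 e1] e2] s].
have E b : conf_act (e0, e1, e2, s) p b =
    sg (flips (e0, e1, e2, s) b) (p (swaps (e0, e1, e2, s) b)) by [].
rewrite !E /flips /swaps /= !inordK //=.
have -> : (if s then inord 1 else inord 0) = inord (if s then 1 else 0) :> 'I_3 by case: s {E}.
have -> : (if s then inord 0 else inord 1) = inord (if s then 0 else 1) :> 'I_3 by case: s {E}.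
have -> : (if s then inord 2 else inord 2) = inord 2 :> 'I_3 by case: s {E}.
rewrite /flips_component /moves_component /=.
have GsE x y z : G x y z (if s then swap_component j else j) =
    if s then G y x z j else G x y z j by case: s {E}; rewrite // -Gs.
rewrite GsE.
case: s {E GsE}; case: e0; case: e1; case: e2; rewrite ?sgT ?sgF ?Gx ?Gy ?Gz;
  case: (character j) => [[[] []] []] /=; by rewrite ?expr0 ?expr1; ring.
Qed.

(** Relative to spherical configurations: volumes of orthants would jump at the zero form. *)
Definition cont_at p (f : configuration -> R) :=
  forall e, 0 < e -> exists2 d, 0 < d & forall q, spherical q ->
    (forall b i, `|q b i - p b i| < d) -> `|f q - f p| < e.

Definition continuous_map (F : configuration -> component -> R) :=
  forall p, spherical p -> forall j, cont_at p (F ^~ j).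

Lemma cont_cst p c : cont_at p (fun=> c).
Proof. by move=> e e0; exists 1 => // q _ _; rewrite subrr normr0. Qed.

Lemma cont_coord p b i : cont_at p (fun q => q b i).
Proof. by move=> e e0; exists e. Qed.

Lemma cont_lip2 p (g : R -> R -> R) f h :
  (forall a b a' b', `|g a b - g a' b'| <= `|a - a'| + `|b - b'|) ->
  cont_at p f -> cont_at p h -> cont_at p (fun q => g (f q) (h q)).
Proof.
move=> gL cf ch e e0; have e2 : 0 < e / 2 by lra.
have [d d0 df] := cf _ e2; have [d' d'0 dh] := ch _ e2.
exists (Num.min d d') => [|q qS near]; first by rewrite lt_min d0.
have h1 : `|f q - f p| < e / 2.
  by apply: df => // b i; apply: lt_le_trans (near b i) _; rewrite ge_min lexx.
have h2 : `|h q - h p| < e / 2.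
  by apply: dh => // b i; apply: lt_le_trans (near b i) _; rewrite ge_min lexx orbT.
by have := gL (f q) (h q) (f p) (h p); lra.
Qed.

Lemma cont_add p f h : cont_at p f -> cont_at p h -> cont_at p (fun q => f q + h q).
Proof.
apply: (cont_lip2 (g := +%R)) => a b a' b'.
by rewrite opprD addrACA; exact: ler_normD.
Qed.

Lemma cont_opp p f : cont_at p f -> cont_at p (fun q => - f q).
Proof.
move=> cf e e0; have [d d0 df] := cf e e0; exists d => // q qS near.
by rewrite -opprD normrN; exact: df.
Qed.

Lemma cont_max p f h : cont_at p f -> cont_at p h -> cont_at p (fun q => Num.max (f q) (h q)).
Proof.
apply: (cont_lip2 (g := Num.max)) => a b a' b'.
have := ler_norm (a - a'); have := ler_norm (b - b').
have := ler_norm (a' - a); have := ler_norm (b' - b).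
rewrite (distrC a' a) (distrC b' b) => h1 h2 h3 h4.
rewrite ler_norml; case: (lerP a b) => h5; case: (lerP a' b') => h6; apply/andP; split; lra.
Qed.

Lemma cont_min p f h : cont_at p f -> cont_at p h -> cont_at p (fun q => Num.min (f q) (h q)).
Proof.
apply: (cont_lip2 (g := Num.min)) => a b a' b'.
have := ler_norm (a - a'); have := ler_norm (b - b').
have := ler_norm (a' - a); have := ler_norm (b' - b).
rewrite (distrC a' a) (distrC b' b) => h1 h2 h3 h4.
rewrite ler_norml; case: (lerP a b) => h5; case: (lerP a' b') => h6; apply/andP; split; lra.
Qed.

Lemma cont_norm p f : cont_at p f -> cont_at p (fun q => `|f q|).
Proof.
move=> cf e e0; have [d d0 df] := cf e e0; exists d => // q qS near.
by apply: le_lt_trans (df q qS near); exact: ler_dist_dist.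
Qed.

Lemma cont_mul p f h : cont_at p f -> cont_at p h -> cont_at p (fun q => f q * h q).
Proof.
move=> cf ch e e0.
pose A := `|f p| + `|h p| + 1.
have A0 : 0 < A by rewrite /A; have := normr_ge0 (f p); have := normr_ge0 (h p); lra.
pose e' := Num.min 1 (e / (2 * A)).
have e'0 : 0 < e' by rewrite lt_min ltr01 divr_gt0 // mulr_gt0.
have [d d0 df] := cf _ e'0; have [d' d'0 dh] := ch _ e'0.
exists (Num.min d d') => [|q qS near]; first by rewrite lt_min d0.
have h1 : `|f q - f p| < e'.
  by apply: df => // b i; apply: lt_le_trans (near b i) _; rewrite ge_min lexx.
have h2 : `|h q - h p| < e'.
  by apply: dh => // b i; apply: lt_le_trans (near b i) _; rewrite ge_min lexx orbT.
have e'1 : e' <= 1 by rewrite ge_min lexx.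
have e'e : e' * A <= e / 2.
  rewrite -ler_pdivlMr // -mulrA -invfM; apply: le_trans (_ : e / (2 * A) <= _).
    by rewrite /e' ge_min lexx orbT.
  by [].
have -> : f q * h q - f p * h p = (f q - f p) * (h q - h p) + (f q - f p) * h p + f p * (h q - h p).
  by ring.
apply: le_lt_trans (_ : e' * A < e); last by lra.
apply: le_trans (ler_normD _ _) _.
have t1 : `|(f q - f p) * (h q - h p) + (f q - f p) * h p| <= e' + e' * `|h p|.
  apply: le_trans (ler_normD _ _) _; rewrite !normrM; apply: lerD.
    rewrite -[leRHS]mulr1; apply: ler_pM => //; first exact: ltW.
    by apply: le_trans (ltW h2) _.
  by apply: ler_wpM2r => //; exact: ltW.
have t2 : `|f p * (h q - h p)| <= e' * `|f p|.
  by rewrite normrM mulrC; apply: ler_wpM2r => //; exact: ltW.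
apply: le_trans (lerD t1 t2) _; rewrite /A !mulrDr mulr1; lra.
Qed.

Lemma cont_clip p r f : cont_at p f -> cont_at p (fun q => clip r (f q)).
Proof. by move=> cf; apply: cont_max; [exact: cont_cst|apply: cont_min => //; exact: cont_cst]. Qed.

Lemma cont_trim p f : cont_at p f -> cont_at p (fun q => trim (f q)).
Proof. by move=> cf; apply: cont_add => //; apply: cont_opp; exact: cont_clip. Qed.

Lemma cont_saturate p f : cont_at p f -> cont_at p (fun q => saturate (f q)).
Proof. by move=> cf; apply: cont_clip; apply: cont_mul => //; exact: cont_cst. Qed.

Ltac cont_tac := repeat lazymatch goal with
  | |- cont_at _ (fun q => trim (@?f q)) => apply: (@cont_trim _ f)
  | |- cont_at _ (fun q => saturate (@?f q)) => apply: (@cont_saturate _ f)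
  | |- cont_at _ (fun q => Num.max (@?f q) (@?g q)) => apply: (@cont_max _ f g)
  | |- cont_at _ (fun q => @?f q + @?g q) => apply: (@cont_add _ f g)
  | |- cont_at _ (fun q => - (@?f q)) => apply: (@cont_opp _ f)
  | |- cont_at _ (fun q => `|@?f q|) => apply: (@cont_norm _ f)
  | |- cont_at _ (fun q => @?f q * @?g q) => apply: (@cont_mul _ f g)
  | |- cont_at _ (fun q => q _ _) => exact: cont_coord
  | |- _ => first [assumption | exact: cont_cst]
  end.

(** The parameters of [test_map] as functions of the third point. Two choices are made: coordinates
    for [std_map], imbalances of measures for the ham sandwich theorem. *)
Record z_data := ZData { zd_a0 : ('I_6 -> R) -> R; zd_a1 : ('I_6 -> R) -> R; zd_a2 : ('I_6 -> R) -> R;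
  zd_b1 : ('I_6 -> R) -> R; zd_b2 : ('I_6 -> R) -> R;
  zd_t1 : ('I_6 -> R) -> R; zd_t2 : ('I_6 -> R) -> R; zd_om : ('I_6 -> R) -> R }.

Definition z_test (D : z_data) p : component -> R :=
  let z := p (inord 2) in
  test_map (zd_a0 D z) (zd_a1 D z) (zd_a2 D z) (zd_b1 D z) (zd_b2 D z)
    (zd_t1 D z) (zd_t2 D z) (zd_om D z) (p (inord 0)) (p (inord 1)).

Definition odd_fun (f : ('I_6 -> R) -> R) := forall z, f (negv z) = - f z.

Lemma z_test_equivariant D :
  odd_fun (zd_a0 D) -> odd_fun (zd_a1 D) -> odd_fun (zd_a2 D) -> odd_fun (zd_b1 D) ->
  odd_fun (zd_b2 D) -> odd_fun (zd_t1 D) -> odd_fun (zd_t2 D) -> odd_fun (zd_om D) ->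
  equivariant_map (z_test D).
Proof.
case: D => a0 a1 a2 b1 b2 t1 t2 om /= oa0 oa1 oa2 ob1 ob2 ot1 ot2 oom.
have extN (x : 'I_6 -> R) : extent (negv x) = extent x by rewrite /extent /negv !normrN.
have excN (x y : 'I_6 -> R) : excess (negv x) y = excess x y by rewrite /excess extN.
have excC (x y : 'I_6 -> R) : excess x y = excess y x by rewrite /excess (addrC (extent x)).
have imN (x y : 'I_6 -> R) : im_part (negv x) y = - im_part x y by rewrite /im_part excN /negv; ring.
have imC (x y : 'I_6 -> R) : im_part x y = im_part y x by rewrite /im_part excC; ring.
have miN (x y : 'I_6 -> R) : mixed_part (negv x) y = - mixed_part x y by rewrite /mixed_part /negv; ring.
have miC (x y : 'I_6 -> R) : mixed_part x y = mixed_part y x by rewrite /mixed_part; ring.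
pose G x y z := test_map (a0 z) (a1 z) (a2 z) (b1 z) (b2 z) (t1 z) (t2 z) (om z) x y.
have Gx x y z j : G (negv x) y z j = (-1) ^+ (character j).1.1 * G x y z j.
  by rewrite /G; case: j => /=; rewrite ?expr0 ?expr1 ?excN ?imN ?miN ?saturateN /negv ?trimN; ring.
have Gs x y z j : G y x z j = G x y z (swap_component j).
  by rewrite /G; case: j => //=; rewrite ?(excC y x) ?(imC y x) ?(miC y x); ring.
change (equivariant_map (fun p => G (p (inord 0)) (p (inord 1)) (p (inord 2)))).
apply: equivariant_intro => // x y z j; rewrite /G.
  rewrite -[LHS]/(G x (negv y) z j) Gs Gx -Gs.
  by congr ((-1) ^+ nat_of_bool _ * _); case: j.
by case: j => /=; rewrite ?oa0 ?oa1 ?oa2 ?ob1 ?ob2 ?ot1 ?ot2 ?oom ?expr0 ?expr1; ring.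
Qed.

Definition cont_z (f : ('I_6 -> R) -> R) :=
  forall p, spherical p -> cont_at p (fun q => f (q (inord 2))).

Lemma z_test_continuous D :
  cont_z (zd_a0 D) -> cont_z (zd_a1 D) -> cont_z (zd_a2 D) -> cont_z (zd_b1 D) ->
  cont_z (zd_b2 D) -> cont_z (zd_t1 D) -> cont_z (zd_t2 D) -> cont_z (zd_om D) ->
  continuous_map (z_test D).
Proof.
case: D => a0 a1 a2 b1 b2 t1 t2 om /= ca0 ca1 ca2 cb1 cb2 ct1 ct2 com p pS j.
have cexc : cont_at p (fun q => excess (q (inord 0)) (q (inord 1))).
  by rewrite /excess /extent; cont_tac.
have cim : cont_at p (fun q => im_part (q (inord 0)) (q (inord 1))).
  by rewrite /im_part; cont_tac.
have cmix : cont_at p (fun q => mixed_part (q (inord 0)) (q (inord 1))).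
  by rewrite /mixed_part; cont_tac.
have := ca0 p pS; have := ca1 p pS; have := ca2 p pS; have := cb1 p pS; have := cb2 p pS.
have := ct1 p pS; have := ct2 p pS; have := com p pS => {}com {}ct2 {}ct1 {}cb2 {}cb1 {}ca2 {}ca1 {}ca0.
by case: j => //=; cont_tac.
Qed.

(** On x = y the component [XY0] is a sum of squares, and an entry of absolute value 1 has a nonzero
    square even after trimming. *)
Lemma z_test_diagonal D p : spherical p -> p (inord 0) = p (inord 1) -> 0 < z_test D p XY0.
Proof.
move=> pS e; rewrite /z_test /= e.
have := pS (inord 1); move: (p (inord 1)) => x [_ [i xi]].
have tt (s : R) : 0 <= trim s * trim s by rewrite -expr2 sqr_ge0.
have ss (s : R) : 0 <= s * s by rewrite -expr2 sqr_ge0.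
have t1 (s : R) : `|s| = 1 -> 0 < trim s * trim s.
  by move=> s1; rewrite -expr2 exprn_even_gt0 //=; apply/eqP => /trim_eq0; rewrite s1; lra.
have s1 (s : R) : `|s| = 1 -> 0 < s * s.
  by move=> s1; rewrite -expr2 exprn_even_gt0 //= -normr_eq0 s1 oner_neq0.
move: xi; elim/ord6_ind: i => /[dup] /t1 h1 /s1 h2;
  have := tt (x (inord 0)); have := tt (x (inord 1)); have := tt (x (inord 2));
  have := tt (x (inord 3)); have := ss (x (inord 4)); have := ss (x (inord 5)); lra.
Qed.

Lemma trim_coord_odd (i : 'I_6) : odd_fun (fun z => trim (z i)).
Proof. by move=> z; rewrite /negv trimN. Qed.

Definition std_data : z_data := ZData (fun z => z (inord 0)) (fun z => z (inord 1))
  (fun z => z (inord 2)) (fun z => z (inord 3)) (fun z => z (inord 4))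
  (fun z => z (inord 5)) (fun z => trim (z (inord 3))) (fun z => trim (z (inord 4))).

Definition std_map := z_test std_data.

Lemma std_map_equivariant : equivariant_map std_map.
Proof. by apply: z_test_equivariant => z //=; exact: trim_coord_odd. Qed.

Lemma std_map_continuous : continuous_map std_map.
Proof. by apply: z_test_continuous => p pS /=; cont_tac. Qed.

(** The entries equal to 1 in [std_zero]: entry 4 of the first point, entry 5 of the other two. *)
Definition special (b : 'I_3) (i : 'I_6) : bool := i == (if b == inord 0 then 4 else 5) :> nat.

Definition std_zero : configuration := fun b i => (special b i)%:R.

(** By [test_map_zero] the third point is supported on its entry 5. Then zt is nonzero and om = 0,
    so only the entries 4 and 5 of x and y survive, with x4 y4 = x5 y5 = 0: one point sits on entry
    4, the other on entry 5. *)
Lemma std_map_zero p : spherical p -> (forall j, std_map p j = 0) ->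
  exists k, p = conf_act k std_zero.
Proof.
move=> pS F0; have xS := pS (inord 0); have yS := pS (inord 1); have zS := pS (inord 2).
have := F0 Z0; have := F0 Z1; have := F0 Z2; rewrite /std_map /z_test /= => z2 z1 z0.
have norm_sg (s : R) : `|s| = 1 -> s = (-1) ^+ (s < 0)%R.
  by move=> s1; rewrite {1}(numEsign s) s1 mulr1.
have [] := @test_map_zero R _ _ _ _ _ _ _ _ (p (inord 0)) (p (inord 1)) xS yS _ F0.
  move=> /= [z5 /trim_eq0 z3 /trim_eq0 z4].
  have [i] := zS.2; elim/ord6_ind: i; rewrite ?z0 ?z1 ?z2 ?z5 ?normr0; lra.
move=> /= z3 z4.
have z5 : `|p (inord 2) (inord 5)| = 1.
  have [i] := zS.2; elim/ord6_ind: i => //; rewrite ?z0 ?z1 ?z2 ?z3 ?z4 ?normr0; lra.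
have z5n : p (inord 2) (inord 5) != 0 by rewrite -normr_eq0 z5 oner_neq0.
have t0 : trim 0 = 0 :> R by apply: trim_small; rewrite normr0; lra.
have := F0 X0; have := F0 X1; have := F0 Y0; have := F0 Y1.
have := F0 XZ0; have := F0 XZ1; have := F0 YZ0; have := F0 YZ1.
have := F0 XY0; have := F0 XY1; rewrite /std_map /z_test /= z3 z4 t0.
rewrite !mul0r !subr0 !addr0 => c1 c0 /eqP + /eqP + /eqP + /eqP + y1 y0 x1 x0.
rewrite !mulf_eq0 !(negbTE z5n) /= => /eqP y3 /eqP y2 /eqP x3 /eqP x2.
move: c1 c0; rewrite x0 x1 x2 x3 y2 y3 !t0 !mul0r !subr0 !mulr0 !add0r !addr0 => c1 c0.
have e4 : p (inord 0) (inord 4) * p (inord 1) (inord 4) = 0 by lra.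
have e5 : p (inord 0) (inord 5) * p (inord 1) (inord 5) = 0 by lra.
have one (b : 'I_3) (i j : 'I_6) : in_cube_boundary (p b) -> (forall i', i' != i -> i' != j -> p b i' = 0) ->
    p b i = 0 -> `|p b j| = 1.
  move=> [_ [i' h]] h0 bi; have [ij|ij] := eqVneq i' j; first by rewrite -ij.
  have [ii|ii] := eqVneq i' i; first by move: h; rewrite ii bi normr0 => /esym/eqP; rewrite oner_eq0.
  by move: h; rewrite h0 // normr0 => /esym/eqP; rewrite oner_eq0.
have x45 i' : i' != inord 4 -> i' != inord 5 -> p (inord 0) i' = 0.
  by elim/ord6_ind: i' => //; rewrite eqxx.
have y45 i' : i' != inord 4 -> i' != inord 5 -> p (inord 1) i' = 0.
  by elim/ord6_ind: i' => //; rewrite eqxx.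
have zz i' : i' != inord 5 -> p (inord 2) i' = 0 by elim/ord6_ind: i' => //; rewrite eqxx.
have i45 : inord 4 != inord 5 :> 'I_6 by rewrite -(inj_eq val_inj) /= !inordK.
have [x4|x4] := eqVneq (p (inord 0) (inord 4)) 0.
  have x5 := one _ _ _ xS x45 x4.
  have y5 : p (inord 1) (inord 5) = 0.
    by move/eqP: e5; rewrite mulf_eq0 -normr_eq0 x5 oner_eq0 => /eqP.
  have y4 : `|p (inord 1) (inord 4)| = 1.
    by apply: (one _ (inord 5)) => // i' h1 h2; exact: y45.
  (* The signs are read off the unit entries; here the two points come in the exchanged order. *)
  exists (p (inord 0) (inord 5) < 0, p (inord 1) (inord 4) < 0, p (inord 2) (inord 5) < 0, true).
  apply/funext => b; apply/funext => i; rewrite /conf_act /std_zero /special /flips /swaps /=.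
  elim/ord3_ind: b; rewrite /= ?inordK // -!(inj_eq val_inj) /= !inordK //=;
  elim/ord6_ind: i; rewrite /= ?inordK //= ?mulr0 ?mulr1 ?x0 ?x1 ?x2 ?x3 ?x4 ?y0 ?y1 ?y2 ?y3 ?y5 ?z0 ?z1 ?z2 ?z3 ?z4 //;
  exact: norm_sg.
have y4 : p (inord 1) (inord 4) = 0 by move/eqP: e4; rewrite mulf_eq0 (negbTE x4) => /eqP.
have y5 := one _ _ _ yS y45 y4.
have x5 : p (inord 0) (inord 5) = 0.
  by move/eqP: e5; rewrite mulf_eq0 -[X in _ || X]normr_eq0 y5 oner_eq0 orbF => /eqP.
have {}x4 : `|p (inord 0) (inord 4)| = 1.
  by apply: (one _ (inord 5)) => // i' h1 h2; exact: x45.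
exists (p (inord 0) (inord 4) < 0, p (inord 1) (inord 5) < 0, p (inord 2) (inord 5) < 0, false).
apply/funext => b; apply/funext => i; rewrite /conf_act /std_zero /special /flips /swaps /=.
elim/ord3_ind: b; rewrite /= ?inordK // -!(inj_eq val_inj) /= !inordK //=;
elim/ord6_ind: i; rewrite /= ?inordK //= ?mulr0 ?mulr1 ?x0 ?x1 ?x2 ?x3 ?x5 ?y0 ?y1 ?y2 ?y3 ?y4 ?z0 ?z1 ?z2 ?z3 ?z4 //;
exact: norm_sg.
Qed.

(** The derivative of [std_map] at [std_zero]; it is invertible in the 15 entries that are not
    special. *)
Definition std_linear (w : configuration) (j : component) : R :=
  match j with
  | X0 => w (inord 0) (inord 0) | X1 => w (inord 0) (inord 1)
  | XZ0 => w (inord 0) (inord 2) | XZ1 => w (inord 0) (inord 3)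
  | Y0 => w (inord 1) (inord 0) | Y1 => w (inord 1) (inord 1)
  | YZ0 => w (inord 1) (inord 2) | YZ1 => w (inord 1) (inord 3)
  | Z0 => w (inord 2) (inord 0) | Z1 => w (inord 2) (inord 1) | Z2 => w (inord 2) (inord 2)
  | XYZ0 => w (inord 2) (inord 3) | XYZ1 => w (inord 2) (inord 4)
  | XY0 => w (inord 1) (inord 4) + w (inord 0) (inord 5)
  | XY1 => w (inord 1) (inord 4) - w (inord 0) (inord 5) end.

(** The special entries are exactly 1 because a small neighbourhood of [std_zero] stays within one
    face of each cube. *)
Definition near_std (p : configuration) := forall b i,
  if special b i then p b i = 1 else `|p b i| <= 1 / 4.

Lemma std_map_near p : near_std p -> forall j, std_map p j = std_linear p j.
Proof.
move=> pn.
have x4 : p (inord 0) (inord 4) = 1 by have := pn (inord 0) (inord 4); rewrite /special inordK ?eqxx.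
have y5 : p (inord 1) (inord 5) = 1.
  by have := pn (inord 1) (inord 5); rewrite /special inordK // -(inj_eq val_inj) /= !inordK.
have z5 : p (inord 2) (inord 5) = 1.
  by have := pn (inord 2) (inord 5); rewrite /special inordK // -(inj_eq val_inj) /= !inordK.
have sm b i : (b < 3)%N -> (i < 6)%N -> i != (if b == 0 then 4 else 5)%N -> `|p (inord b) (inord i)| <= 1 / 4.
  move=> b3 i6 h; have := pn (inord b) (inord i).
  by rewrite /special -(inj_eq val_inj) /= !inordK // (negbTE h).
have tsm b i : (b < 3)%N -> (i < 6)%N -> i != (if b == 0 then 4 else 5)%N -> trim (p (inord b) (inord i)) = 0.
  by move=> b3 i6 h; apply: trim_small; have := sm b i b3 i6 h; lra.
have exc : excess (p (inord 0)) (p (inord 1)) = 0.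
  rewrite /excess max_l //.
  have ext b : (b < 2)%N -> extent (p (inord b)) <= 1 / 4.
    by move=> b2; rewrite /extent ge_max !sm //; first [lia | case: (b == 0)%N].
  by have := ext 0 isT; have := ext 1 isT; lra.
(* Here [im_part] is 1 + x5 y4, at least 3/4, where [saturate] is constant. *)
have sat : saturate (im_part (p (inord 0)) (p (inord 1))) = 1.
  apply: saturate_big; rewrite /im_part exc x4 y5 mul0r subr0 mul1r.
  have h1 : `|p (inord 0) (inord 5) * p (inord 1) (inord 4)| <= 1 / 4 * 1.
    rewrite normrM; apply: ler_pM => //; first exact: sm.
    by apply: le_trans (sm 1 4 isT isT isT) _; lra.
  by move: h1; rewrite ler_norml => /andP[h1 h2]; lra.
move=> j; rewrite /std_map /z_test /=.
case: j => //=; rewrite ?exc ?sat ?x4 ?y5 ?z5 ?(tsm 2 3) ?(tsm 2 4) ?(tsm 0 0) ?(tsm 0 1) ?(tsm 0 2) ?(tsm 0 3) //; ring.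
Qed.

(* An equivariant map that is constant near [std_zero]; subtracting a small
   multiple moves the zero of [std_map] into the interior of a simplex. *)
Definition sat2 (s : R) := 2 * trim s.

Definition shift_fun (e : configuration) (x y z : 'I_6 -> R) (j : component) : R :=
  let pick i v := e (inord 0) (inord i) * sat2 (v (inord 4)) + e (inord 1) (inord i) * sat2 (v (inord 5)) in
  let xy := sat2 (x (inord 4)) * sat2 (y (inord 5)) + sat2 (x (inord 5)) * sat2 (y (inord 4)) in
  let z5 := sat2 (z (inord 5)) in
  match j with
  | X0 => pick 0%N x | Y0 => pick 0%N y | X1 => pick 1%N x | Y1 => pick 1%N y
  | Z0 => e (inord 2) (inord 0) * z5 | Z1 => e (inord 2) (inord 1) * z5
  | Z2 => e (inord 2) (inord 2) * z5
  | XZ0 => pick 2%N x * z5 | YZ0 => pick 2%N y * z5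
  | XZ1 => pick 3%N x * z5 | YZ1 => pick 3%N y * z5
  | XY0 => (e (inord 1) (inord 4) + e (inord 0) (inord 5)) * xy
  | XY1 => (e (inord 1) (inord 4) - e (inord 0) (inord 5)) * xy
  | XYZ0 => e (inord 2) (inord 3) * (xy * z5) | XYZ1 => e (inord 2) (inord 4) * (xy * z5)
  end.

Definition shift_map e p := shift_fun e (p (inord 0)) (p (inord 1)) (p (inord 2)).

Lemma sat2N s : sat2 (- s) = - sat2 s.
Proof. by rewrite /sat2 trimN mulrN. Qed.

Lemma shift_map_equivariant e : equivariant_map (shift_map e).
Proof.
apply: (@equivariant_intro (shift_fun e)) => x y z j; rewrite /shift_fun;
  by case: j => /=; rewrite /negv ?sat2N ?expr0 ?expr1; ring.
Qed.

Lemma shift_map_near e p : near_std p -> forall j, shift_map e p j = std_linear e j.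
Proof.
move=> pn.
have x4 : p (inord 0) (inord 4) = 1 by have := pn (inord 0) (inord 4); rewrite /special inordK ?eqxx.
have y5 : p (inord 1) (inord 5) = 1.
  by have := pn (inord 1) (inord 5); rewrite /special inordK // -(inj_eq val_inj) /= !inordK.
have z5 : p (inord 2) (inord 5) = 1.
  by have := pn (inord 2) (inord 5); rewrite /special inordK // -(inj_eq val_inj) /= !inordK.
have sm b i : (b < 3)%N -> (i < 6)%N -> i != (if b == 0 then 4 else 5)%N -> sat2 (p (inord b) (inord i)) = 0.
  move=> b3 i6 h; have := pn (inord b) (inord i).
  rewrite /special -(inj_eq val_inj) /= !inordK // (negbTE h) => h'.
  by rewrite /sat2 trim_small ?mulr0 //; lra.
have s1 : sat2 1 = 1 by rewrite /sat2 trim1; lra.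
by move=> j; rewrite /shift_map /shift_fun /= x4 y5 z5 s1 (sm 0 5) // (sm 1 4) //; case: j => /=; ring.
Qed.

Lemma shift_map_bound e p j : (forall b i, `|e b i| <= 1) -> spherical p -> `|shift_map e p j| <= 4.
Proof.
move=> e1 pS.
have g1 b i : `|sat2 (p b i)| <= 1.
  have [/(_ i) + _] := pS b; rewrite !ler_norml /sat2 /trim /clip => /andP[h1 h2].
  case: (lerP (1 / 2) (p b i)) => h; first by rewrite max_r; [apply/andP; split; lra|lra].
  by case: (lerP (- (1 / 2)) (p b i)) => h'; apply/andP; split; lra.
have nA (a b A B : R) : `|a| <= A -> `|b| <= B -> `|a + b| <= A + B.
  by move=> h1 h2; apply: le_trans (ler_normD _ _) (lerD h1 h2).
have nM (a b A B : R) : `|a| <= A -> `|b| <= B -> `|a * b| <= A * B.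
  by move=> h1 h2; rewrite normrM; apply: ler_pM.
have nN (a A : R) : `|a| <= A -> `|- a| <= A by rewrite normrN.
rewrite /shift_map /shift_fun /=.
have xy : `|sat2 (p (inord 0) (inord 4)) * sat2 (p (inord 1) (inord 5)) +
   sat2 (p (inord 0) (inord 5)) * sat2 (p (inord 1) (inord 4))| <= 1 * 1 + 1 * 1.
  by apply: nA; apply: nM.
have pk i b : `|e (inord 0) i * sat2 (p b (inord 4)) + e (inord 1) i * sat2 (p b (inord 5))| <= 1 * 1 + 1 * 1.
  by apply: nA; apply: nM.
case: j;
  try by [apply: le_trans (pk _ _) _; lra
        | apply: le_trans (nM _ _ _ _ (e1 _ _) (g1 _ _)) _; lra
        | apply: le_trans (nM _ _ _ _ (pk _ _) (g1 _ _)) _; lra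
        | apply: le_trans (nM _ _ _ _ (nA _ _ _ _ (e1 _ _) (e1 _ _)) xy) _; lra
        | apply: le_trans (nM _ _ _ _ (nA _ _ _ _ (e1 _ _) (nN _ _ (e1 _ _))) xy) _; lra
        | apply: le_trans (nM _ _ _ _ (e1 _ _) (nM _ _ _ _ xy (g1 _ _))) _; lra].
Qed.

End Configurations.

Require Import Defs.
From mathcomp Require Import all_classical all_reals all_analysis.
From mathcomp Require Import measurable_realfun ring lra zify.
Import Order.TTheory GRing.Theory Num.Theory.
Import numFieldNormedType.Exports.
Local Open Scope ring_scope.

(** * Zeros of equivariant maps *)

Section Limits.
Variable R : realType.
Local Notation configuration := (configuration R).

Lemma bounded_cluster (I : finType) (u : nat -> I -> R) :
  (forall n i, `|u n i| <= 1) ->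
  exists p : I -> R, forall d, 0 < d -> forall n0, exists2 n, (n0 <= n)%N &
    forall i, `|u n i - p i| < d.
Proof.
move=> u1; pose v n : 'rV[R]_#|I| := \row_k u n (enum_val k).
have cpt := @rV_compact R #|I| (fun=> `[-1, 1]%classic) (fun=> @segment_compact R (-1) 1).
have PF : ProperFilter (v @ \oo)%classic by exact: fmap_proper_filter.
have [|p [_ clp]] := cpt (v @ \oo)%classic PF.
  by exists 0%N => //= n _ k; rewrite /v mxE in_itv /= -ler_norml; exact: u1.
exists (fun i => p ord0 (enum_rank i)) => d d0 n0.
have [|_ [[n n0n <-] /= [_ pn]]] := clp (v @` [set n | (n0 <= n)%N])%classic (ball p d) _ (nbhsx_ballx _ _ d0).
  by exists n0 => //= n n0n; exists n.
exists n => // i; have := pn ord0 (enum_rank i).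
by rewrite /v mxE enum_rankK /ball /= distrC.
Qed.

Lemma spherical_limit (p : configuration) :
  (forall d, 0 < d -> exists2 q : configuration, spherical q & forall b i, `|q b i - p b i| < d) ->
  spherical p.
Proof.
move=> lim b; split.
  move=> i; apply/ler_addgt0Pl => e e0; have [q qS qp] := lim e e0.
  have [/(_ i) q1 _] := qS b; have := qp b i.
  by rewrite distrC => /ltW h; rewrite -(subrK (q b i) (p b i)); apply: le_trans (ler_normD _ _) (lerD _ _).
apply: contrapT => none.
have p1 i : `|p b i| < 1 - 0 -> True by [].
have [d d0 dp] : exists2 d, 0 < d & forall q : configuration, spherical q -> exists i, d <= `|q b i - p b i|.
  pose d := \big[Num.min/1]_(i < 6) `|1 - `|p b i| |.
  have d0 : 0 < d.
    apply: lt_bigmin => // i _; rewrite normr_gt0 subr_eq0 eq_sym.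
    by apply/eqP => e; apply: none; exists i.
  exists d => // q qS; have [_ [i qi]] := qS b; exists i.
  apply: le_trans (_ : `|1 - `|p b i| | <= _); first exact: bigmin_le_cond.
  by rewrite -qi; exact: ler_dist_dist.
have [q qS qp] := lim d d0; have [i] := dp q qS.
by rewrite leNgt qp.
Qed.

Lemma spherical_cluster (u : nat -> configuration) : (forall n, spherical (u n)) ->
  exists2 p, spherical p & forall d, 0 < d -> forall n0, exists2 n, (n0 <= n)%N &
    forall b i, `|u n b i - p b i| < d.
Proof.
move=> uS.
have [|p lim] := @bounded_cluster ('I_3 * 'I_6)%type (fun n x => u n x.1 x.2).
  by move=> n [b i] /=; have [/(_ i)] := uS n b.
exists (fun b i => p (b, i)); last first.
  by move=> d d0 n0; have [n n0n h] := lim d d0 n0; exists n => // b i; exact: (h (b, i)).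
apply: spherical_limit => d d0; have [n _ h] := lim d d0 0%N.
by exists (u n) => // b i; exact: (h (b, i)).
Qed.

Definition mesh (N : nat) : R := (2 * N)%:R^-1.

Lemma small_mesh (d : R) : 0 < d -> exists n0, forall N, (n0 <= N)%N ->
  N.+1%:R^-1 < d /\ ((0 < N)%N -> mesh N < d).
Proof.
move=> d0; exists (Num.bound d^-1) => N n0N.
have h : d^-1 < N%:R.
  apply: lt_le_trans (archi_boundP _) _; last by rewrite ler_nat.
  by rewrite invr_ge0 ltW.
have N0 : 0 < N%:R :> R by apply: lt_trans h; rewrite invr_gt0.
split.
  rewrite -[ltRHS]invrK ltf_pV2 ?posrE ?invr_gt0 ?ltr0n //.
  by apply: lt_trans h _; rewrite ltr_nat.
move=> NN; rewrite /mesh -[ltRHS]invrK ltf_pV2 ?posrE ?invr_gt0 ?ltr0n ?muln_gt0 //.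
by apply: lt_le_trans h _; rewrite ler_nat; lia.
Qed.

(** The centre of the cell, after scaling [0, 4N] to [-1, 1]. *)
Definition cell_point N (c : cell N) : configuration :=
  fun b i => ((c (b, i))%:R - (2 * N)%:R) * mesh N.

Section CellPoints.
Variable N : nat.
Hypothesis N_gt0 : (0 < N)%N.

Let mesh_gt0 : 0 < mesh N.
Proof. by rewrite /mesh invr_gt0 ltr0n muln_gt0. Qed.

Let meshK : (2 * N)%:R * mesh N = 1.
Proof. by rewrite /mesh divff // pnatr_eq0 -lt0n muln_gt0. Qed.

Lemma cell_point_spherical (c : cell N) : on_spheres c -> spherical (cell_point c).
Proof.
move=> /forallP cS b; split.
  move=> i; rewrite /cell_point normrM (gtr0_norm mesh_gt0) -[leRHS]meshK.
  apply: ler_wpM2r; first exact: ltW.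
  have := ltn_ord (c (b, i)); rewrite ltnS -(ler_nat R) => h.
  have := ler0n R (c (b, i)) => h0.
  have e : (4 * N)%:R = (2 * N)%:R + (2 * N)%:R :> R by rewrite -natrD; congr _%:R; lia.
  by rewrite ler_norml; apply/andP; split; lra.
have /existsP[i ci] := cS b; exists i; rewrite /cell_point normrM (gtr0_norm mesh_gt0).
rewrite -[RHS]meshK; congr (_ * _); move: ci; rewrite /extreme => /orP[]/eqP->.
  by rewrite sub0r normrN normr_nat.
have -> : (4 * N)%:R = (2 * N)%:R + (2 * N)%:R :> R by rewrite -natrD; congr _%:R; lia.
by rewrite addrK normr_nat.
Qed.

Lemma cell_point_act k (c : cell N) : cell_point (cell_act k c) = conf_act k (cell_point c).
Proof.
apply/funext => b; apply/funext => i; rewrite /cell_point /conf_act ffunE /=.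
case: (flips k b); rewrite ?mul1r //= mulN1r -mulNr; congr (_ * _).
have h := ltn_ord (c (swaps k b, i)); rewrite subSS natrB //.
have -> : (4 * N)%:R = (2 * N)%:R + (2 * N)%:R :> R by rewrite -natrD; congr _%:R; lia.
by rewrite opprB; lra.
Qed.

Lemma cell_point_near (c d : cell N) : near_cells c d -> forall b i,
  `|cell_point c b i - cell_point d b i| <= mesh N.
Proof.
move=> cd b i; have [h1 h2] := cd (b, i).
rewrite /cell_point -mulrBl normrM (gtr0_norm mesh_gt0) -[leRHS]mul1r.
apply: ler_wpM2r; first exact: ltW.
move: h1 h2; rewrite -!(ler_nat R) -!natr1 => h1 h2.
by rewrite ler_norml; apply/andP; split; lra.
Qed.

Lemma core_diagonal (c : cell N) : on_spheres c -> c \in cell_core N -> exists e : bool,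
  forall i, `|cell_point c (inord 0) i - (-1) ^+ e * cell_point c (inord 1) i| <= mesh N.
Proof.
move=> cS cc; have [e h] := core_near N_gt0 cS cc; exists e => i.
rewrite /cell_point mulrA -mulrBl normrM (gtr0_norm mesh_gt0) -[leRHS]mul1r.
apply: ler_wpM2r; first exact: ltW.
have := h i; case: e {h} => /= -[]; rewrite -!(ler_nat R) -!natr1 ?natrD ?natrM => h1 h2.
  by rewrite mulN1r ler_norml; apply/andP; split; lra.
by rewrite mul1r ler_norml; apply/andP; split; lra.
Qed.

End CellPoints.

Lemma simplex_close N (s : {set cell N}) c d p (r : R) : (0 < N)%N -> s \in simplices N ->
  c \in s -> d \in s -> (forall b i, `|cell_point c b i - p b i| < r) -> mesh N < r ->
  forall b i, `|cell_point d b i - p b i| < r + r.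
Proof.
move=> N0 /simplicesP[_ _ inc] cs ds cp mr b i.
have := cell_point_near N0 (incident_near N0 (inc d c ds cs)) b i => dc.
have -> : cell_point d b i - p b i =
    (cell_point d b i - cell_point c b i) + (cell_point c b i - p b i) by ring.
by apply: le_lt_trans (ler_normD _ _) (ltrD _ (cp b i)); exact: le_lt_trans mr.
Qed.

(** Otherwise there are counterexamples at every fineness, clustering at some [p]. If F p j were
    nonzero, coordinate [j] would have constant sign on a small simplex near [p], against [hull0].
    So [p] is a zero, and the simplices do approach one. The same [n0] bounds both the mesh and the
    error of [G]. *)
Lemma hull0_near_zero (F : configuration -> component -> R) (r : R) :
  continuous_map F -> 0 < r ->
  exists n0, forall N, (n0 <= N)%N -> (0 < N)%N -> forall s, s \in simplices N ->
  forall G : cell N -> component -> R,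
  (forall t, t \in s -> forall j, `|G t j - F (cell_point t) j| < n0.+1%:R^-1) ->
  hull0 s G -> exists p, [/\ spherical p, forall j, F p j = 0 &
     forall t, t \in s -> forall b i, `|cell_point t b i - p b i| < r].
Proof.
move=> Fc r0; apply: contrapT => no.
pose P n (x : configuration) := exists N (s : {set cell N}) t G,
  [/\ [/\ (n <= N)%N, (0 < N)%N, s \in simplices N & t \in s], x = cell_point t,
      (forall t, t \in s -> forall j, `|G t j - F (cell_point t) j| < n.+1%:R^-1), hull0 s G
    & ~ exists p, [/\ spherical p, forall j, F p j = 0 &
        forall t, t \in s -> forall b i, `|cell_point t b i - p b i| < r]].
have /choice[u uP] : forall n, exists x, P n x.
  move=> n; apply: contrapT => nP; apply: no; exists n => N nN N0 s sS G GF h.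
  apply: contrapT => np; apply: nP.
  have [t ts] : exists t, t \in s.
    by apply/set0Pn; rewrite -card_gt0; have [->] := simplicesP _ sS.
  by exists (cell_point t), N, s, t, G.
have uS n : spherical (u n).
  have [N [s [t [G [[nN N0 sS ts] -> _ _ _]]]]] := uP n.
  by apply: cell_point_spherical => //; have [_ sph _] := simplicesP _ sS; exact: sph.
have [p pS lim] := spherical_cluster uS.
have F0 j : F p j = 0.
  apply: contrapT => /eqP Fp.
  have e0 : 0 < `|F p j| / 2 by rewrite divr_gt0 // normr_gt0.
  have [d d0 dF] := Fc p pS j _ e0.
  have d2 : 0 < d / 2 by rewrite divr_gt0.
  have [n1 n1P] := small_mesh d2; have [n2 n2P] := small_mesh e0.
  have [n nn near] := lim _ d2 (maxn n1 n2).
  have [N [s [t [G [[nN N0 sS ts] ut GF h _]]]]] := uP n.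
  apply: (@hull0_sep _ _ _ s G (F p j) j _ h) => t' t's.
  have close b i : `|cell_point t' b i - p b i| < d.
    rewrite (splitr d); apply: (simplex_close N0 sS ts t's); first by rewrite -ut.
    have [|_ h2] := n1P N; last exact: h2.
    by move: nn; rewrite geq_max => /andP[h1 _]; exact: leq_trans nN.
  have [_ sph _] := simplicesP _ sS.
  have h1 := dF _ (cell_point_spherical N0 (sph _ t's)) close.
  have [|h2 _] := n2P n; first by move: nn; rewrite geq_max => /andP[].
  have h3 := lt_trans (GF t' t's j) h2.
  have h4 : `|G t' j - F p j| < `|F p j|.
    rewrite (splitr `|F p j|); have -> : G t' j - F p j = (G t' j - F (cell_point t') j) + (F (cell_point t') j - F p j) by ring.
    by apply: le_lt_trans (ler_normD _ _) _; exact: ltrD.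
  move: h4; case: (ltrgtP (F p j) 0) Fp => // Fp _.
    by rewrite (ltr0_norm Fp) ltr_norml => /andP[_ h4]; rewrite nmulr_rgt0 //; lra.
  by rewrite (gtr0_norm Fp) ltr_norml => /andP[h4 _]; rewrite pmulr_rgt0 //; lra.
have r2 : 0 < r / 2 by rewrite divr_gt0.
have [n1 n1P] := small_mesh r2; have [n nn near] := lim _ r2 n1.
have [N [s [t [G [[nN N0 sS ts] ut GF h]]]]] := uP n; apply.
exists p; split=> // t' t's b i.
rewrite (splitr r); apply: (simplex_close N0 sS ts t's); first by rewrite -ut.
by have [|_ h2] := n1P N; [exact: leq_trans nN|exact: h2].
Qed.

(** Simplices violating the sign would cluster at a point with x = y or x = -y; there [XY0] has the
    sign [(-1) ^+ e], by hypothesis in the first case and by equivariance in the second. *)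
Lemma core_sign (F : configuration -> component -> R) :
  continuous_map F -> equivariant_map F ->
  (forall p, spherical p -> p (inord 0) = p (inord 1) -> 0 < F p XY0) ->
  exists n0, forall N, (n0 <= N)%N -> (0 < N)%N -> forall s, s \in simplices N ->
  forall c e, c \in s ->
  (forall i, `|cell_point c (inord 0) i - (-1) ^+ nat_of_bool e * cell_point c (inord 1) i| <= mesh N) ->
  forall t v, t \in s -> `|v - F (cell_point t) XY0| < n0.+1%:R^-1 -> 0 < (-1) ^+ e * v.
Proof.
move=> Fc Fe Fd.
suff sign e : exists n0, forall N, (n0 <= N)%N -> (0 < N)%N -> forall s, s \in simplices N ->
    forall c, c \in s ->
    (forall i, `|cell_point c (inord 0) i - (-1) ^+ nat_of_bool e * cell_point c (inord 1) i| <= mesh N) ->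
    forall t v, t \in s -> `|v - F (cell_point t) XY0| < n0.+1%:R^-1 -> 0 < (-1) ^+ e * v.
  have [n0 h0] := sign false; have [n1 h1] := sign true.
  have mon m : (m <= maxn n0 n1)%N -> (maxn n0 n1).+1%:R^-1 <= m.+1%:R^-1 :> R.
    by move=> h; rewrite lef_pV2 ?posrE ?ltr0n // ler_nat ltnS.
  exists (maxn n0 n1) => N nN N0 s sS c e cs ce t v ts vF.
  have [le0 le1] : (n0 <= N)%N /\ (n1 <= N)%N by move: nN; rewrite geq_max => /andP.
  case: e ce => ce; [apply: (h1 N _ _ s sS c _ _ t)|apply: (h0 N _ _ s sS c _ _ t)] => //.
    by apply: lt_le_trans vF _; apply: mon; rewrite leq_maxr.
  by apply: lt_le_trans vF _; apply: mon; rewrite leq_maxl.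
apply: contrapT => no.
pose P n (x : configuration) := exists N (s : {set cell N}) c t v,
  [/\ [/\ (n <= N)%N, (0 < N)%N, s \in simplices N, c \in s & t \in s], x = cell_point c,
      (forall i, `|cell_point c (inord 0) i - (-1) ^+ nat_of_bool e * cell_point c (inord 1) i| <= mesh N),
      `|v - F (cell_point t) XY0| < n.+1%:R^-1 & ~ 0 < (-1) ^+ e * v].
have /choice[u uP] : forall n, exists x, P n x.
  move=> n; apply: contrapT => nP; apply: no; exists n => N nN N0 s sS c cs ce t v ts vF.
  apply: contrapT => nv; apply: nP.
  by exists (cell_point c), N, s, c, t, v.
have uS n : spherical (u n).
  have [N [s [c [t [v [[nN N0 sS cs ts] -> _ _ _]]]]]] := uP n.
  by apply: cell_point_spherical => //; have [_ sph _] := simplicesP _ sS; exact: sph.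
have [p pS lim] := spherical_cluster uS.
have pE i : p (inord 0) i = (-1) ^+ e * p (inord 1) i.
  apply/eqP; rewrite -subr_eq0 -normr_le0; apply/ler_addgt0Pl => d d0.
  have d3 : 0 < d / 3 by rewrite divr_gt0.
  have [n1 n1P] := small_mesh d3; have [n nn near] := lim _ d3 n1.
  have [N [s [c [t [v [[nN N0 _ _ _] uc ce _ _]]]]]] := uP n.
  have [|_ h2] := n1P N; [exact: leq_trans nN|].
  have {}h2 := h2 N0; have h0 := near (inord 0) i; have h1 := near (inord 1) i.
  have := ce i; rewrite -uc => h3.
  have sg1 : `|(-1) ^+ e : R| = 1 by rewrite normrX normrN1 expr1n.
  have -> : p (inord 0) i - (-1) ^+ e * p (inord 1) i =
    - (u n (inord 0) i - p (inord 0) i) + (u n (inord 0) i - (-1) ^+ e * u n (inord 1) i)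
    + (-1) ^+ e * (u n (inord 1) i - p (inord 1) i) by ring.
  apply: le_trans (ler_normD _ _) _; rewrite normrM sg1 mul1r.
  have := ler_normD (- (u n (inord 0) i - p (inord 0) i)) (u n (inord 0) i - (-1) ^+ e * u n (inord 1) i).
  by rewrite normrN; lra.
have sg2 : (-1) ^+ e * (-1) ^+ e = 1 :> R by rewrite -expr2 sqrr_sign.
have Fp : 0 < (-1) ^+ e * F p XY0.
  have := Fe (e, false, false, false) p XY0; rewrite /flips_component /= andbT !addbF => <-.
  apply: Fd.
    move=> b; have [pb1 [i pb2]] := pS b; split.
      by move=> i'; rewrite /conf_act /= normrM normrX normrN1 expr1n mul1r.
    by exists i; rewrite /conf_act /= normrM normrX normrN1 expr1n mul1r.
  apply/funext => i; rewrite /conf_act /flips /swaps /= !inordK //= pE mulrA sg2.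
  by rewrite mul1r.
pose eps := (-1) ^+ e * F p XY0 / 2.
have e0 : 0 < eps by rewrite divr_gt0.
have [d d0 dF] := Fc p pS XY0 _ e0.
have d2 : 0 < d / 2 by rewrite divr_gt0.
have [n1 n1P] := small_mesh d2; have [n2 n2P] := small_mesh e0.
have [n nn near] := lim _ d2 (maxn n1 n2).
have [N [s [c [t [v [[nN N0 sS cs ts] uc ce vF]]]]]] := uP n; apply.
have close b i : `|cell_point t b i - p b i| < d.
  rewrite (splitr d); apply: (simplex_close N0 sS cs ts); first by rewrite -uc.
  have [|_ h2] := n1P N; last exact: h2.
  by move: nn; rewrite geq_max => /andP[h1 _]; exact: leq_trans nN.
have [_ sph _] := simplicesP _ sS.
have h1 := dF _ (cell_point_spherical N0 (sph _ ts)) close.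
have [|h2 _] := n2P n; first by move: nn; rewrite geq_max => /andP[].
have h3 : `|(-1) ^+ e * (v - F p XY0)| < eps + eps.
  rewrite normrM normrX normrN1 expr1n mul1r.
  have -> : v - F p XY0 = (v - F (cell_point t) XY0) + (F (cell_point t) XY0 - F p XY0) by ring.
  by apply: le_lt_trans (ler_normD _ _) _; apply: ltrD => //; exact: lt_trans h2.
move: h3; rewrite mulrBr ltr_norml => /andP[h3 _].
by move: h3; rewrite /eps -splitr; lra.
Qed.

End Limits.

Lemma conf_act_mul (R : realFieldType) k m (p : configuration R) :
  conf_act k (conf_act m p) = conf_act (symmetry_mul k m) p.
Proof.
apply/funext => b; apply/funext => i.
by rewrite /conf_act flips_mul swaps_mul signr_addb mulrA.
Qed.

Lemma conf_act1 (R : realFieldType) (p : configuration R) : conf_act symmetry1 p = p.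
Proof.
apply/funext => b; apply/funext => i; rewrite /conf_act /swaps /=.
by elim/ord3_ind: b; rewrite /flips /= inordK //= mul1r.
Qed.

(** Enumerates the 15 entries that are not special, five per sphere. On the first sphere entry 5
    takes the place of the special entry 4; special entries get the out-of-range value 15. *)
Definition free_rank (x : 'I_3 * 'I_6) : nat :=
  if special x.1 x.2 then 15 else
  (5 * x.1 + (if (x.1 == 0 :> nat) && (x.2 == 5 :> nat) then 4 else x.2))%N.

Lemma free_rank_lt x : ~~ special x.1 x.2 -> (free_rank x < 15)%N.
Proof.
case: x => b i; rewrite /free_rank /special -(inj_eq val_inj) /= inordK //.
by elim/ord3_ind: b; elim/ord6_ind: i; rewrite !inordK.
Qed.

Definition free_rank_inv (k : nat) : 'I_3 * 'I_6 :=
  (inord (k %/ 5)%N, inord (if k == 4%N then 5 else k %% 5)%N).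

Lemma free_rankK x : ~~ special x.1 x.2 -> free_rank_inv (free_rank x) = x.
Proof.
case: x => b i; rewrite /free_rank /special -(inj_eq val_inj) /= inordK //.
by elim/ord3_ind: b; elim/ord6_ind: i; rewrite /free_rank_inv !inordK.
Qed.

Lemma free_rank_surj k : (k < 15)%N -> exists2 x, ~~ special x.1 x.2 & free_rank x = k.
Proof.
move=> k15; have sp : special (free_rank_inv k).1 (free_rank_inv k).2 = false.
  rewrite /special /free_rank_inv -(inj_eq val_inj) /=.
  by do 15 (case: k k15 => [|k] k15; first by rewrite /= !inordK).
exists (free_rank_inv k); first exact: negbT.
rewrite /free_rank sp /free_rank_inv /=; clear sp.
by do 15 (case: k k15 => [|k] k15; first by rewrite /= !inordK).
Qed.

Lemma kle_two M a a1 a2 : (a1 <= 2 * M)%N -> (2 * M < a2)%N ->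
  kle a1 a2 || kle a2 a1 -> kle a a1 || kle a1 a -> kle a a2 || kle a2 a ->
  (a == 2 * M)%N || (a == (2 * M).+1).
Proof. by rewrite /kle /consecutive; lia. Qed.

Lemma kle_step M a a' : (a == 2 * M)%N || (a == (2 * M).+1) ->
  (a' == 2 * M)%N || (a' == (2 * M).+1) ->
  (kle (2 * M).+1 a /\ kle (2 * M) a') \/ (kle a (2 * M).+1 /\ kle a' (2 * M)) -> (a' <= a)%N.
Proof. by rewrite /kle /consecutive; lia. Qed.

Lemma subn15_lt a b : (b < a)%N -> (a < 15)%N -> ((15 - a).+1 <= 15 - b)%N.
Proof. by lia. Qed.

(** * The simplex around the shifted zero of the standard map *)

Section StandardSimplex.
Variable N : nat.
Hypothesis N_gt1 : (1 < N)%N.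
Let N_gt0 : (0 < N)%N.
Proof. exact: ltnW. Qed.

(** The flag starts at the vertex [std_zero] and opens the free entries one at a time, in the order
    of [free_rank]. *)
Definition std_cell (m : 'I_16) : cell N :=
  [ffun x => if special x.1 x.2 then inord (4 * N) else inord (2 * N + (free_rank x < m))].

Lemma std_cellE m x :
  std_cell m x = (if special x.1 x.2 then 4 * N else 2 * N + (free_rank x < m))%N :> nat.
Proof. by rewrite ffunE; case: ifP => _; rewrite inordK //; case: (free_rank x < m)%N => /=; lia. Qed.

Lemma std_cell_inj : injective std_cell.
Proof.
move=> m m' e; apply: val_inj => /=; apply/eqP; apply: contraTT isT => mm'.
have [k k15 h] : exists2 k, (k < 15)%N & (k < m)%N != (k < m')%N.
  have m16 := ltn_ord m; have m'16 := ltn_ord m'.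
  exists (minn m m'); first by lia.
  by case: (ltngtP m m') mm' => // h _; lia.
have [x sx xo] := free_rank_surj k15.
have := congr1 (fun c : cell N => val (c x)) e; rewrite /= !std_cellE (negbTE sx) xo.
by move: h; case: (k < m)%N; case: (k < m')%N => //=; lia.
Qed.

Definition std_simplex : {set cell N} := [set std_cell m | m : 'I_16].

Lemma std_simplex_in : std_simplex \in simplices N.
Proof.
have le (m m' : 'I_16) : (m <= m')%N -> gle (std_cell m) (std_cell m').
  move=> mm'; apply/forallP => x; rewrite !std_cellE /kle /consecutive.
  case: ifP => _; first by rewrite eqxx.
  by move: mm'; case: (ltnP (free_rank x) m); case: (ltnP (free_rank x) m'); lia.
apply/simplicesP; split.
- by rewrite card_imset ?card_ord //; exact: std_cell_inj.
- move=> _ /imsetP[m _ ->]; apply/forallP => b; apply/existsP.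
  exists (if b == inord 0 then inord 4 else inord 5).
  have sp : special b (if b == inord 0 then inord 4 else inord 5).
    by rewrite /special; case: ifP => _; rewrite inordK.
  by rewrite /extreme std_cellE /= sp eqxx orbT.
- move=> _ _ /imsetP[m _ ->] /imsetP[m' _ ->]; rewrite /incident.
  by case/orP: (leq_total m m') => /le->; rewrite ?orbT.
Qed.

(** Any other symmetry replaces a special entry 4N by 0 or by an entry at most 2N + 1, which is too
    far away since N > 1. *)
Lemma std_simplex_unique k c c0 : c \in std_simplex -> c0 \in std_simplex ->
  incident (cell_act k c) c0 -> k = symmetry1.
Proof.
move=> /imsetP[m _ ->] /imsetP[m0 _ ->] /(incident_near N_gt0) near.
case: k near => [[[e0 e1] e2] s] near.
have E b i : (b < 3)%N -> (i < 6)%N -> forall m, std_cell m (inord b, inord i) =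
    (if i == (if b == 0 then 4 else 5) then 4 * N else 2 * N + (free_rank (inord b, inord i) < m))%N :> nat.
  by move=> b3 i6 m'; rewrite std_cellE /special /= -(inj_eq val_inj) /= !inordK.
have h0 := near (inord 0, inord 4); have h1 := near (inord 1, inord 5).
have h2 := near (inord 2, inord 5).
have actE k0 (c1 : cell N) b i : cell_act k0 c1 (b, i) =
    if flips k0 b then rev_ord (c1 (swaps k0 b, i)) else c1 (swaps k0 b, i) by rewrite ffunE.
case: s near h0 h1 h2 => near.
  rewrite actE /flips /swaps /= !inordK //= E //= => -[_ h0 _ _].
  case: e0 h0 {near} => /=; rewrite (E 1 4) //=; case: (free_rank _ < _)%N => /=; lia.
rewrite !actE /flips /swaps /= !inordK //= !E //= => -[_ h0] [_ h1] [_ h2].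
by case: e0 h0 {near}; case: e1 h1; case: e2 h2 => //=; rewrite ?E //=; lia.
Qed.

Lemma std_simplex_isolated (s : {set cell N}) : s \in simplices N -> exists k,
  forall t l, cell_act l t \in s -> t \in std_simplex -> cell_act l t \in cell_act k @: std_simplex.
Proof.
move=> /simplicesP[_ _ inc].
have [[t0 [l0 [t0s t0std]]]|none] := pselect (exists t l, cell_act l t \in s /\ t \in std_simplex).
  exists l0 => t l ts tstd; suff -> : l = l0 by apply: imset_f.
  have := incident_act N_gt0 (symmetry_inv l0) (inc _ _ ts t0s).
  rewrite cell_actK cell_act_mul => /(std_simplex_unique tstd t0std) e.
  have invK : involutive symmetry_inv by move=> [[[e0 e1] e2] []].
  apply/esym/(inv_inj invK)/(@symmetry_mulI l).
  by rewrite /= e symmetry_mulVl.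
by exists symmetry1 => t l ts tstd; case: none; exists t, l.
Qed.

Variable R : realType.

Let mesh_gt0 : 0 < mesh R N.
Proof. by rewrite /mesh invr_gt0 ltr0n muln_gt0. Qed.

Let meshK : (2 * N)%:R * mesh R N = 1.
Proof. by rewrite /mesh divff // pnatr_eq0 -lt0n muln_gt0. Qed.

(** The centroid of [std_simplex] in units of the mesh, measured from [std_zero]: the free entry of
    rank k is open in 15 - k of the 16 vertices. *)
Definition eps : configuration R := fun b i => (15 - free_rank (b, i))%:R / 16.

Definition start_map (c : cell N) (j : component) : R :=
  std_map (cell_point R c) j - mesh R N * shift_map eps (cell_point R c) j.

Lemma eps_le1 b i : `|eps b i| <= 1.
Proof.
rewrite /eps normrM normr_nat gtr0_norm ?invr_gt0 ?ltr0n // ler_pdivrMr ?ltr0n // mul1r.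
by rewrite ler_nat; lia.
Qed.

Lemma start_map_equivariant k c j : start_map (cell_act k c) j =
  (-1) ^+ flips_component k j * start_map c (moves_component k j).
Proof.
by rewrite /start_map cell_point_act // std_map_equivariant shift_map_equivariant; ring.
Qed.

Lemma start_map_close c j : on_spheres c ->
  `|start_map c j - std_map (cell_point R c) j| <= 4 * mesh R N.
Proof.
move=> cS; rewrite /start_map addrAC subrr add0r normrN normrM (gtr0_norm mesh_gt0) mulrC.
apply: ler_wpM2r; first exact: ltW.
by apply: shift_map_bound; [exact: eps_le1|exact: cell_point_spherical].
Qed.

Definition offset_of (c : cell N) : configuration R := fun b i => (c (b, i))%:R - (2 * N)%:R.

Lemma start_map_near (c : cell N) : near_std (cell_point R c) -> forall j,
  start_map c j = mesh R N * (std_linear (offset_of c) j - std_linear eps j).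
Proof.
move=> cn j; rewrite /start_map std_map_near // shift_map_near //.
by case: j => /=; rewrite /cell_point /offset_of; ring.
Qed.

(** Each sphere has an extreme entry, of absolute value 1; close to [std_zero] it can only be the
    special one, with value 1. *)
Lemma near_std_cell (c : cell N) : on_spheres c ->
  (forall b i, `|cell_point R c b i - std_zero R b i| < 1 / 4) -> near_std (cell_point R c).
Proof.
move=> cS near b i; have := near b i; rewrite /std_zero.
case sp: (special b i); last by rewrite subr0 => /ltW.
have /existsP[i' ci'] := forallP cS b => _.
have [sp'|sp'] := boolP (special b i'); last first.
  have := near b i'; rewrite /std_zero (negbTE sp') subr0 => h.
  suff : `|cell_point R c b i'| = 1 by move=> e; move: h; rewrite e; lra.
  rewrite /cell_point normrM (gtr0_norm mesh_gt0) -[RHS]meshK; congr (_ * _).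
  move: ci'; rewrite /extreme => /orP[]/eqP->; first by rewrite sub0r normrN normr_nat.
  have -> : (4 * N)%:R = (2 * N)%:R + (2 * N)%:R :> R by rewrite -natrD; congr _%:R; lia.
  by rewrite addrK normr_nat.
have -> : i = i' by apply: val_inj => /=; move: sp sp'; rewrite /special => /eqP-> /eqP->.
have := near b i'; rewrite /std_zero sp' /cell_point.
move: ci'; rewrite /extreme => /orP[]/eqP->.
  rewrite sub0r mulNr meshK /= => h; exfalso; have := ler_norm (- (- 1 - 1) : R).
  by rewrite normrN; move: h; rewrite mulr1n; lra.
have -> : (4 * N)%:R = (2 * N)%:R + (2 * N)%:R :> R by rewrite -natrD; congr _%:R; lia.
by rewrite addrK meshK.
Qed.

(* The weights express a point near the offset [eps], whose entries are
   distinct and lie in ]0, 1[: this forces the steps of the chain [s]. *)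
Lemma start_map_unique (s : {set cell N}) G : s \in simplices N ->
  (forall c, c \in s -> near_std (cell_point R c)) ->
  (forall c j, c \in s -> `|G c j - start_map c j| < mesh R N / 100) ->
  hull0 s G -> s = std_simplex.
Proof.
move=> sS near Gc [l [l0 l1 lG]]; have [cs sph inc] := simplicesP _ sS.
pose D b i := \sum_(c in s) l c * offset_of c b i.
have lin j : `|std_linear D j - std_linear eps j| <= 1 / 100.
  rewrite -(ler_pM2l mesh_gt0) -{1}(gtr0_norm mesh_gt0) -normrM.
  have -> : mesh R N * (std_linear D j - std_linear eps j) =
      \sum_(c in s) l c * (start_map c j - G c j).
    transitivity (\sum_(c in s) l c * start_map c j); last first.
      by under [RHS]eq_bigr do rewrite mulrBr; rewrite sumrB lG subr0.
    have e : \sum_(c in s) l c * (mesh R N * std_linear eps j) = mesh R N * std_linear eps j.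
      by rewrite -big_distrl /= l1 mul1r.
    rewrite mulrBr -e; transitivity (\sum_(c in s) l c * (mesh R N * std_linear (offset_of c) j) -
        \sum_(c in s) l c * (mesh R N * std_linear eps j)); last first.
      by rewrite -sumrB; apply: eq_bigr => c cin; rewrite (start_map_near (near c cin)); ring.
    congr (_ - _); rewrite {e}; case: j => /=; rewrite /D; try by
      rewrite big_distrr; apply: eq_bigr => c _ /=; ring.
      by rewrite -big_split big_distrr; apply: eq_bigr => c _ /=; ring.
    by rewrite -sumrB big_distrr; apply: eq_bigr => c _ /=; ring.
  apply: le_trans (ler_norm_sum _ _ _) _.
  apply: le_trans (_ : \sum_(c in s) l c * (mesh R N / 100) <= _).
    apply: ler_sum => c cin; rewrite normrM (ger0_norm (l0 c cin)).
    by apply: ler_wpM2l; [exact: l0|rewrite distrC; apply: ltW; exact: Gc].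
  by rewrite -big_distrl /= l1; lra.
(* An error of 1/50 keeps the averages [D] strictly between 0 and 1, and two such errors stay below
   1/16, the gap between consecutive entries of [eps]. *)
have De b i : ~~ special b i -> `|D b i - eps b i| <= 1 / 50.
  rewrite /special -(inj_eq val_inj) /=.
  have h0 := lin XY0; have h1 := lin XY1; move: h0 h1 => /=.
  rewrite !ler_norml => /andP[a1 a2] /andP[a3 a4].
  have L (x : R) : `|x| <= 1 / 100 -> - (1 / 50) <= x <= 1 / 50.
    by rewrite ler_norml => /andP[h1 h2]; apply/andP; split; lra.
  elim/ord3_ind: b; elim/ord6_ind: i; rewrite !inordK //= => _;
  by [exact: (L _ (lin X0)) | exact: (L _ (lin X1)) | exact: (L _ (lin XZ0)) | exact: (L _ (lin XZ1))
     | exact: (L _ (lin Y0)) | exact: (L _ (lin Y1)) | exact: (L _ (lin YZ0)) | exact: (L _ (lin YZ1))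
     | exact: (L _ (lin Z0)) | exact: (L _ (lin Z1)) | exact: (L _ (lin Z2))
     | exact: (L _ (lin XYZ0)) | exact: (L _ (lin XYZ1)) | apply/andP; split; lra].
have Dmono (f g : cell N -> R) : (forall c, c \in s -> f c <= g c) ->
    \sum_(c in s) l c * f c <= \sum_(c in s) l c * g c.
  by move=> fg; apply: ler_sum => c cin; apply: ler_wpM2l; [exact: l0|exact: fg].
have eps_gt x : ~~ special x.1 x.2 -> 1 / 16 <= eps x.1 x.2 <= 15 / 16.
  move=> /free_rank_lt h; rewrite /eps -surjective_pairing.
  have h1 : 1 <= (15 - free_rank x)%:R :> R by rewrite ler1n; lia.
  have h2 : (15 - free_rank x)%:R <= 15 :> R by rewrite ler_nat; lia.
  by apply/andP; split; lra.
have kinc c d x : c \in s -> d \in s -> kle (c x) (d x) || kle (d x) (c x).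
  by move=> cin din; have /orP[/forallP/(_ x)->|/forallP/(_ x)->] := inc c d cin din; rewrite ?orbT.
(* As the average lies strictly between 0 and 1, some cell has entry at most 2N and another has a
   larger one; incidence then confines all cells to 2N and 2N + 1. *)
have two c x : c \in s -> ~~ special x.1 x.2 -> (c x == (2 * N)%N :> nat) || (c x == (2 * N).+1 :> nat).
  move=> cin sx; have := De x.1 x.2 sx; have := eps_gt x sx.
  rewrite ler_norml /D /offset_of -surjective_pairing => /andP[e1 e2] /andP[h1 h2].
  have [c1 c1s lo] : exists2 c1, c1 \in s & (c1 x <= 2 * N)%N.
    apply: contrapT => no; have : 1 <= \sum_(c in s) l c * ((c x)%:R - (2 * N)%:R).
      rewrite -[leLHS](_ : \sum_(c in s) l c * 1 = 1); last by rewrite -big_distrl /= l1 mul1r.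
      apply: Dmono => d din; rewrite lerBrDl natr1 ler_nat ltnNge; apply/negP => h.
      by apply: no; exists d.
    by lra.
  have [c2 c2s hi] : exists2 c2, c2 \in s & (2 * N < c2 x)%N.
    apply: contrapT => no; have : \sum_(c in s) l c * ((c x)%:R - (2 * N)%:R) <= 0.
      rewrite -[leRHS](_ : \sum_(c in s) l c * 0 = 0); last by rewrite big1 // => ? _; rewrite mulr0.
      apply: Dmono => d din; rewrite subr_le0 ler_nat leqNgt; apply/negP => h.
      by apply: no; exists d.
    by lra.
  have := kinc c1 c2 x c1s c2s; have := kinc c c1 x cin c1s; have := kinc c c2 x cin c2s.
  by move=> k1 k2 k3; exact: kle_two lo hi k3 k2 k1.
(* Along a flag the entry [x] cannot open before [x']: if it did, the average at [x] would be at
   least that at [x'], contrary to the strict decrease of [eps] in the rank. *)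
have mono c x x' : c \in s -> ~~ special x.1 x.2 -> ~~ special x'.1 x'.2 ->
    (free_rank x' < free_rank x)%N -> c x = (2 * N).+1 :> nat -> c x' = (2 * N).+1 :> nat.
  move=> cin sx sx' lt cx; case/orP: (two c x' cin sx') => /eqP // cx'.
  have : D x'.1 x'.2 <= D x.1 x.2.
    apply: Dmono => d din; rewrite /offset_of -!surjective_pairing lerD2r ler_nat.
    apply: kle_step (two d x din sx) (two d x' din sx') _; rewrite -cx -cx'.
    by have /orP[/forallP h|/forallP h] := inc c d cin din; [left|right]; split; exact: h.
  have := De _ _ sx; have := De _ _ sx'; rewrite !ler_norml /eps -!surjective_pairing.
  move=> /andP[h1 h2] /andP[h3 h4] h5.
  have h6 : (15 - free_rank x)%:R + 1 <= (15 - free_rank x')%:R :> R.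
    by rewrite natr1 ler_nat; exact: subn15_lt lt (free_rank_lt sx).
  by exfalso; lra.
have sub : s \subset std_simplex.
  apply/fintype.subsetP => c cin.
  pose m := (\max_(x : 'I_3 * 'I_6 | ~~ special x.1 x.2 && odd (c x)) (free_rank x).+1)%N.
  have m16 : (m < 16)%N.
    rewrite ltnS; apply/bigmax_leqP => x /andP[sx _]; exact: free_rank_lt.
  apply/imsetP; exists (Ordinal m16) => //; apply/ffunP => x; apply: val_inj.
  rewrite /= std_cellE /=; case: ifP => sx.
    have := near c cin x.1 x.2; rewrite sx /cell_point -surjective_pairing => h.
    have e : (c x)%:R - (2 * N)%:R = (2 * N)%:R :> R.
      by apply: (mulIf (lt0r_neq0 mesh_gt0)); rewrite h meshK.
    have : (c x)%:R = (4 * N)%:R :> R.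
      have -> : (4 * N)%:R = (2 * N)%:R + (2 * N)%:R :> R by rewrite -natrD; congr _%:R; lia.
      by rewrite -{1}e subrK.
    by move/eqP; rewrite eqr_nat => /eqP.
  have nsx := negbT sx; have h2 := two c x cin nsx.
  suff -> : (free_rank x < m)%N = (c x == (2 * N).+1 :> nat).
    by case/orP: h2 => /eqP->; rewrite ?eqxx; lia.
  apply/idP/eqP => [lt|cx]; last first.
    by apply: (@leq_bigmax_cond _ _ (fun x => (free_rank x).+1)); rewrite nsx cx /=; lia.
  have [x1 /andP[sx1 ox1] le] : exists2 x1, ~~ special x1.1 x1.2 && odd (c x1) &
      (free_rank x <= free_rank x1)%N.
    apply: contrapT => no; move: lt; rewrite ltnNge => /negP; apply.
    apply/bigmax_leqP => x1 h; rewrite ltnNge; apply/negP => le; apply: no; by exists x1.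
  have cx1 : c x1 = (2 * N).+1 :> nat by case/orP: (two c x1 cin sx1) => /eqP // e; move: ox1; rewrite e; lia.
  move: le; rewrite leq_eqVlt => /orP[/eqP e|lt']; last exact: (mono c x1 x).
  by rewrite -(free_rankK nsx) e free_rankK.
by apply/eqP; rewrite eqEcard sub cs card_imset ?card_ord //; exact: std_cell_inj.
Qed.

End StandardSimplex.

Section StandardWeights.
Variable R : realType.
Variable N : nat.
Hypothesis N_gt1 : (1 < N)%N.

Let N_gt0 : (0 < N)%N.
Proof. exact: ltnW. Qed.

Let mesh_gt0 : 0 < mesh R N.
Proof. by rewrite /mesh invr_gt0 ltr0n muln_gt0. Qed.

Let meshK : (2 * N)%:R * mesh R N = 1.
Proof. by rewrite /mesh divff // pnatr_eq0 -lt0n muln_gt0. Qed.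

Lemma offset_std_cell m x : ~~ special x.1 x.2 ->
  offset_of R (std_cell N m) x.1 x.2 = (free_rank x < m)%:R.
Proof.
move=> sx; rewrite /offset_of -surjective_pairing std_cellE // (negbTE sx) natrD.
by rewrite addrAC subrr add0r.
Qed.

Lemma std_cell_near m : near_std (cell_point R (std_cell N m)).
Proof.
move=> b i; case: ifP => [sp|/negbT sp].
  rewrite /cell_point std_cellE //= sp.
  have -> : (4 * N)%:R = (2 * N)%:R + (2 * N)%:R :> R by rewrite -natrD; congr _%:R; lia.
  by rewrite addrK.
rewrite -[cell_point _ _ _ _]/(offset_of R (std_cell N m) (b, i).1 (b, i).2 * mesh R N).
rewrite offset_std_cell // normrM normr_nat (gtr0_norm mesh_gt0).
have h : mesh R N <= 1 / 4.
  rewrite /mesh mul1r lef_pV2 ?posrE ?ltr0n ?muln_gt0 //.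
  by rewrite (ler_nat R 4); lia.
apply: le_trans h; rewrite -[leRHS]mul1r; apply: ler_wpM2r; first exact: ltW.
by rewrite (ler_nat R _ 1); case: (_ < _)%N.
Qed.

Let gap (l : 'I_16 -> R) : configuration R :=
  fun b i => \sum_m l m * (offset_of R (std_cell N m) b i - eps R b i).

Let gap_start l j :
  \sum_m l m * start_map R (std_cell N m) j = mesh R N * std_linear (gap l) j.
Proof.
transitivity (\sum_m l m * (mesh R N * (std_linear (offset_of R (std_cell N m)) j - std_linear (eps R) j))).
  by apply: eq_bigr => m _; rewrite (start_map_near (std_cell_near m)).
rewrite /gap; case: j => /=; rewrite -?sumrB -?big_split big_distrr;
  by apply: eq_bigr => m _ /=; ring.
Qed.

Let std_linear_eq0 (w : configuration R) :
  (forall j, std_linear w j = 0) <-> (forall b i, ~~ special b i -> w b i = 0).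
Proof.
split=> [w0 b i|w0 j].
  rewrite /special -(inj_eq val_inj) /=.
  have := w0 XY0; have := w0 XY1 => /= h1 h2.
  elim/ord3_ind: b; elim/ord6_ind: i; rewrite !inordK //= => _;
  by [exact: (w0 X0) | exact: (w0 X1) | exact: (w0 XZ0) | exact: (w0 XZ1)
     | exact: (w0 Y0) | exact: (w0 Y1) | exact: (w0 YZ0) | exact: (w0 YZ1)
     | exact: (w0 Z0) | exact: (w0 Z1) | exact: (w0 Z2)
     | exact: (w0 XYZ0) | exact: (w0 XYZ1) | lra].
have z b i : (b < 3)%N -> (i < 6)%N -> i != (if b == 0 then 4 else 5)%N -> w (inord b) (inord i) = 0.
  by move=> b3 i6 ne; apply: w0; rewrite /special -(inj_eq val_inj) /= !inordK.
by case: j => /=; rewrite !z // ?addr0 ?subr0.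
Qed.

Let gapE l x : ~~ special x.1 x.2 -> gap l x.1 x.2 =
  \sum_m l m * (free_rank x < m)%:R - (15 - free_rank x)%:R / 16 * \sum_m l m.
Proof.
move=> sx; rewrite big_distrr /= -sumrB; apply: eq_bigr => m _.
by rewrite offset_std_cell // /eps -surjective_pairing; ring.
Qed.

Lemma hull0_std_simplex : hull0 (std_simplex N) (@start_map N R).
Proof.
have -> : std_simplex N = std_cell N @: [set: 'I_16].
  by apply/setP => c; apply/imsetP/imsetP => -[m _ ->]; exists m.
apply/hull0_imset; first by move=> m m' _ _; exact: (std_cell_inj N_gt1).
exists (fun=> 16%:R^-1); split.
- by move=> m _; rewrite invr_ge0.
- by rewrite sumr_const cardsT card_ord -[LHS]mulr_natr mulVf // pnatr_eq0.
move=> j; rewrite (eq_bigl xpredT) => [|m]; last by rewrite inE.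
rewrite /= gap_start.
suff -> : std_linear (gap (fun=> 16%:R^-1)) j = 0 by rewrite mulr0.
apply: (proj2 (std_linear_eq0 _)) => b i sp; rewrite -[LHS]/(gap _ (b, i).1 (b, i).2) gapE //.
have := free_rank_lt (x := (b, i)) sp; move: (free_rank _) => k k15.
rewrite -big_distrr /= big_const card_ord iter_addr addr0.
have -> : \sum_(m < 16) (k < m)%:R = (15 - k)%:R :> R.
  rewrite -natr_sum; congr _%:R; do 15 (case: k k15 => [|k] k15; first by rewrite !big_ord_recr big_ord0).
  by [].
have -> : 16%:R^-1 *+ 16 = 1 :> R by rewrite -[LHS]mulr_natr mulVf // pnatr_eq0.
by rewrite mulr1 mulrC subrr.
Qed.

(** The relations among all 16 values are the multiples of the constant one, so a relation missing
    one vertex is trivial. *)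
Lemma li_std_simplex (B : {set cell N}) : B \subset std_simplex N -> (#|B| <= 15)%N ->
  li B (@start_map N R).
Proof.
move=> /fintype.subsetP Bs cB.
pose B' := [set m | std_cell N m \in B].
have BE : B = std_cell N @: B'.
  apply/setP => c; apply/idP/imsetP => [cB'|[m]]; last by rewrite inE => ? ->.
  by have /imsetP[m _ cm] := Bs c cB'; exists m => //; rewrite inE -cm.
have inj : {in B' &, injective (std_cell N)} by move=> m m' _ _; exact: (std_cell_inj N_gt1).
rewrite BE; apply/li_imset => // l lB.
have [m0 m0B] : exists m0, m0 \notin B'.
  apply/existsP; apply: contraLR cB => /existsPn h; rewrite -ltnNge BE card_in_imset //.
  by rewrite (eq_card (B := xpredT)) ?card_ord // => m; have := h m; rewrite negbK.
pose l' m := if m \in B' then l m else 0.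
have g0 : forall b i, ~~ special b i -> gap l' b i = 0.
  apply/std_linear_eq0 => j; apply: (mulfI (lt0r_neq0 mesh_gt0)).
  rewrite mulr0 -gap_start -[RHS](lB j) [RHS]big_mkcond; apply: eq_bigr => m _.
  by rewrite /l'; case: ifP => _ //; rewrite mul0r.
pose S := \sum_m l' m.
(* These tail sums are the averages of the free entries, up to normalization; consecutive ones
   differ by a single weight. *)
pose A k := \sum_(m < 16) l' m * (k < m)%:R.
have AE k : (k <= 15)%N -> A k = (15 - k)%:R / 16 * S.
  rewrite leq_eqVlt => /orP[/eqP->|k15].
    rewrite subnn mul0r mul0r; apply: big1 => m _.
    by rewrite ltnNge -ltnS ltn_ord mulr0.
  have [x sx xk] := free_rank_surj k15.
  by have := gapE l' sx; rewrite xk g0 // => /esym/eqP; rewrite subr_eq0 => /eqP.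
have lE m : l' m = S / 16.
  have [m1|m1] := posnP m.
    have : S - A 0%N = l' m.
      rewrite /S /A -sumrB (bigD1 m) //= m1 mulr0 subr0 big1 ?addr0 // => i im.
      suff -> : (0 < i)%N by rewrite mulr1 subrr.
      by rewrite lt0n; apply: contra im => /eqP e; apply/eqP/val_inj; rewrite /= e m1.
    by rewrite AE // subn0 => <-; lra.
  have : A m.-1 - A m = l' m.
    rewrite /A -sumrB (bigD1 m) //= prednK // leqnn ltnn mulr1 mulr0 subr0 big1 ?addr0 // => i im.
    have -> : (m <= i)%N = (m < i)%N by rewrite ltn_neqAle eq_sym im.
    by rewrite subrr.
  have m16 := ltn_ord m; rewrite !AE; try lia.
  have -> : (15 - m.-1 = (15 - m).+1)%N by lia.
  by rewrite -natr1 => <-; lra.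
have S0 : S = 0.
  by have := lE m0; rewrite /l' (negbTE m0B) => /esym/eqP; rewrite mulf_eq0 invr_eq0 pnatr_eq0 orbF => /eqP.
by move=> m mB; have := lE m; rewrite /l' mB S0 mul0r.
Qed.

End StandardWeights.

(** * The Borsuk-Ulam type theorem *)

Section EquivariantZero.
Variable R : realType.

Lemma mesh_slack (a b : R) : 0 < a -> a < b / 8 -> a / 100 + 4 * a < b.
Proof. by lra. Qed.

Theorem equivariant_zero (F : configuration R -> component -> R) :
  continuous_map F -> equivariant_map F ->
  (forall p, spherical p -> p (inord 0) = p (inord 1) -> 0 < F p XY0) ->
  exists2 p, spherical p & forall j, F p j = 0.
Proof.
move=> Fc Fe Fd; apply: contrapT => noF.
have stdd : forall p : configuration R, spherical p -> p (inord 0) = p (inord 1) -> 0 < std_map p XY0.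
  by move=> p pS e; exact: z_test_diagonal.
have [n0 h0] := hull0_near_zero Fc ltr01.
have q4 : 0 < 1 / 4 :> R by rewrite divr_gt0.
have [n1 h1] := hull0_near_zero (@std_map_continuous R) q4.
have [n2 h2] := core_sign Fc Fe Fd.
have [n3 h3] := core_sign (@std_map_continuous R) (@std_map_equivariant R) stdd.
pose n := (maxn (maxn n0 n1) (maxn n2 n3)).
have nn m : (m <= n)%N -> n.+1%:R^-1 <= m.+1%:R^-1 :> R.
  by move=> h; rewrite lef_pV2 ?posrE ?ltr0n // ler_nat ltnS.
(* The start map is within four meshes of [std_map] and its perturbation within a hundredth of a
   mesh; the factor 8 covers both. *)
have d0 : 0 < n.+1%:R^-1 / 8 :> R by rewrite divr_gt0 // invr_gt0 ltr0n.
have [n4 h4] := small_mesh d0.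
pose N := maxn 2 (maxn n n4).
have N1 : (1 < N)%N by rewrite leq_max.
have N0 : (0 < N)%N by exact: ltnW.
have nN : (n <= N)%N by exact: leq_trans (leq_maxl n n4) (leq_maxr 2 _).
have le0 : (n0 <= n)%N by rewrite /n !leq_max leqnn.
have le1 : (n1 <= n)%N by rewrite /n !leq_max leqnn ?orbT.
have le2 : (n2 <= n)%N by rewrite /n !leq_max leqnn ?orbT.
have le3 : (n3 <= n)%N by rewrite /n !leq_max leqnn ?orbT.
have [|_ /(_ N0) mN] := h4 N; first exact: leq_trans (leq_maxr n n4) (leq_maxr 2 _).
have mesh0 : 0 < mesh R N by rewrite /mesh invr_gt0 ltr0n muln_gt0.
pose P b : cell N -> component -> R :=
  if b then fun c => F (cell_point R c) else @start_map N R.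
pose sg (k : symmetry) j : R := (-1) ^+ flips_component k j.
have Pe b : equivariant (@cell_act N) sg moves_component (P b).
  move=> k c j; rewrite /P; case: b; last exact: (start_map_equivariant N1).
  by rewrite cell_point_act // Fe.
have card_s (s : {set cell N}) : s \in simplices N -> #|s| = #|{: component}|.+1.
  by move=> /simplicesP[-> _ _]; rewrite card_component.
have compo (k m : symmetry) : exists l, (forall t : cell N, cell_act k (cell_act m t) = cell_act l t) /\
    (forall j, sg k j * sg m (moves_component k j) = sg l j /\
       moves_component m (moves_component k j) = moves_component l j).
  exists (symmetry_mul k m); split=> [t|j]; first exact: cell_act_mul.
  by rewrite /sg flips_component_mul signr_addb moves_component_mul.
have invo (k : symmetry) : exists m, forall t : cell N, cell_act m (cell_act k t) = t.
  by exists (symmetry_inv k) => t; exact: cell_actK.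
have ident : exists e : symmetry, (forall t : cell N, cell_act e t = t) /\
    (forall j, sg e j = 1 /\ moves_component e j = j).
  exists symmetry1; split=> [t|j]; first exact: cell_act1.
  by rewrite /sg; case: j.
have sg1 k j : `|sg k j| = 1 by rewrite /sg normrX normrN1 expr1n.
have e0 : 0 < mesh R N / 100 by rewrite divr_gt0.
have [G [Ge GP _ Gstd Ggen]] := @generic_perturbation R (cell N) component symmetry
  (simplices N) (@cell_act N) sg moves_component (cell_core N) XY0
  compo invo ident sg1 moves_component_inj (@cell_core_act N)
  (@cell_act_free N) (@simplex_act_free N N0) P (std_simplex N) _ e0 Pe
  (fun B Bs cB => @li_std_simplex R N N1 B Bs (eq_ind _ (fun k => (_ <= k)%N) cB _ card_component))
  (@std_simplex_isolated N N1).
have mn : mesh R N / 100 + 4 * mesh R N < n.+1%:R^-1 by exact: mesh_slack mesh0 mN.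
have closeF c j : `|G true c j - F (cell_point R c) j| < n.+1%:R^-1.
  by apply: lt_trans (GP true c j) (le_lt_trans _ mn); rewrite lerDl mulr_ge0 // ltW.
have closeS c j : on_spheres c -> `|G false c j - std_map (cell_point R c) j| < n.+1%:R^-1.
  move=> cS; apply: le_lt_trans mn.
  have -> : G false c j - std_map (cell_point R c) j =
      (G false c j - P false c j) + (P false c j - std_map (cell_point R c) j) by ring.
  apply: le_trans (ler_normD _ _) _; apply: lerD; first exact: ltW (GP _ _ _).
  exact: start_map_close.
have sph (s : {set cell N}) c : s \in simplices N -> c \in s -> on_spheres c.
  by move=> /simplicesP[_ sph _]; exact: sph.
have sgn : core_signed (simplices N) (cell_core N) XY0 (G false) (G true).
  move=> s c sS cs cc; have [e ce] := core_diagonal R N0 (sph s c sS cs) cc.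
  exists ((-1) ^+ e) => u us; split.
    apply: (h3 N (leq_trans le3 nN) N0 s sS c e cs ce u _ us).
    by apply: lt_le_trans (closeS u XY0 (sph s u sS us)) _; exact: nn.
  apply: (h2 N (leq_trans le2 nN) N0 s sS c e cs ce u _ us).
  by apply: lt_le_trans (closeF u XY0) _; exact: nn.
have := @hull0_count_invariant R (cell N) component symmetry
  (simplices N) (@cell_act N) sg moves_component (cell_core N) XY0 card_s (@simplices_thin N N0)
  compo invo ident (@simplices_act N N0) (@cell_core_act N)
  (@cell_act_free N) (@simplex_act_free N N0) G Ge Ggen sgn.
have -> : hull0_count (simplices N) (G true) = 0%N.
  apply/eqP; rewrite cards_eq0; apply/eqP/setP => s; rewrite finset.in_set finset.in_set0.
  apply/negbTE/negP => /andP[sS /asboolP h].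
  have [|p [pS pF _]] := h0 N (leq_trans le0 nN) N0 s sS (G true) _ h.
    by move=> t _ j; apply: lt_le_trans (closeF t j) _; exact: nn.
  by apply: noF; exists p.
have hull_act := @hull0_act R (cell N) component symmetry (@cell_act N) sg moves_component invo.
(* A counted simplex lies near some [conf_act k std_zero]; moved back by [k] it must be
   [std_simplex]. So the counted simplices are its translates, one for each symmetry. *)
have -> : hull0_count (simplices N) (G false) = #|{: symmetry}|.
  rewrite -(card_imset (f := fun k : symmetry => cell_act k @: std_simplex N)) => [|k l e].
    apply: eq_card => s; rewrite inE; apply/andP/imsetP => [[sS /asboolP h]|[k _ ->]].
      have [|p [pS p0 near]] := h1 N (leq_trans le1 nN) N0 s sS (G false) _ h.
        by move=> t ts j; apply: lt_le_trans (closeS t j (sph s t sS ts)) _; exact: nn.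
      have [k pk] := std_map_zero pS p0.
      have s'S := simplices_act N0 (symmetry_inv k) sS.
      exists k => //; suff <- : cell_act (symmetry_inv k) @: s = std_simplex N.
        rewrite -imset_comp (eq_imset (g := id)) ?imset_id // => t /=.
        have kk : symmetry_mul k (symmetry_inv k) = symmetry1.
          by have := symmetry_mulK k symmetry1; case: (k) => [[[[] []] []] []].
        by rewrite cell_act_mul kk cell_act1.
      apply: (start_map_unique N1 s'S (G := G false)).
      - move=> _ /imsetP[t ts ->]; apply: near_std_cell => //.
          exact: on_spheres_act (sph s t sS ts).
        move=> b i; have -> : std_zero R = conf_act (symmetry_inv k) p.
          by rewrite pk conf_act_mul symmetry_mulVl conf_act1.
        by rewrite cell_point_act // /conf_act -mulrBr normrM normrX normrN1 expr1n [ltLHS]mul1r near.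
      - by move=> c j _; exact: (GP false c j).
      - by apply/hull_act.
    split; first by apply: simplices_act => //; exact: std_simplex_in.
    apply/asboolP/hull_act => //.
    by apply: (eq_hull0 _ (hull0_std_simplex R N1)) => t ts; rewrite Gstd.
  have t0 : std_cell N ord0 \in std_simplex N by apply: imset_f.
  have : cell_act k (std_cell N ord0) \in cell_act l @: std_simplex N by rewrite -e; exact: imset_f.
  move=> /imsetP[t ts et].
  have : cell_act (symmetry_mul (symmetry_inv l) k) (std_cell N ord0) = t.
    by rewrite -cell_act_mul et cell_actK.
  move=> et'; have : incident (cell_act (symmetry_mul (symmetry_inv l) k) (std_cell N ord0)) t.
    by rewrite et' /incident gle_refl.
  move=> /(std_simplex_unique N1 t0 ts) lk.
  have invK : involutive symmetry_inv by move=> [[[e1 e2] e3] []].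
  apply/esym/(inv_inj invK)/(@symmetry_mulI k).
  by rewrite /= lk symmetry_mulVl.
rewrite mod0n modn_small; last by rewrite mul2n -addnn -[ltnLHS]addn0 ltn_add2l; apply/card_gt0P; exists symmetry1.
by move/eqP; rewrite -leqn0 leqNgt; case/negP; apply/card_gt0P; exists symmetry1.
Qed.

End EquivariantZero.

Local Open Scope classical_set_scope.
Local Open Scope ring_scope.

(** * Masses of orthants *)

Section BorelSets.
Variables (R : realType) (d : nat).

Lemma borel_open (A : set 'rV[R]_d) : open A -> measurable (A : set (borel R d)).
Proof. by move=> oA; apply: sub_sigma_algebra. Qed.

Lemma borel_closed (A : set 'rV[R]_d) : closed A -> measurable (A : set (borel R d)).
Proof.
by move=> cA; rewrite -(setCK A); apply: measurableC; apply: borel_open; exact: closed_openC.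
Qed.

Lemma borel_gt0 (f : 'rV[R]_d -> R) : continuous f -> measurable ([set q | 0 < f q] : set (borel R d)).
Proof.
move=> cf; apply: borel_open.
have -> : [set q | 0 < f q] = f @^-1` [set r | 0 < r] by [].
by apply: open_comp => [x _|]; [exact: cf|exact: open_gt].
Qed.

Lemma borel_ge0 (f : 'rV[R]_d -> R) : continuous f -> measurable ([set q | 0 <= f q] : set (borel R d)).
Proof.
move=> cf; apply: borel_closed.
have -> : [set q | 0 <= f q] = f @^-1` [set r | 0 <= r] by [].
by apply: closed_comp => [x _|]; [exact: cf|exact: closed_ge].
Qed.

Lemma borel_eq0 (f : 'rV[R]_d -> R) : continuous f -> measurable ([set q | f q = 0] : set (borel R d)).
Proof.
move=> cf; apply: borel_closed.
have -> : [set q | f q = 0] = f @^-1` [set 0] by [].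
by apply: closed_comp => [x _|]; [exact: cf|exact: closed_eq].
Qed.

End BorelSets.

Lemma continuous_sum (R : realType) (T : topologicalType) n (f : 'I_n -> T -> R) :
  (forall i, continuous (f i)) -> continuous (fun x => \sum_i f i x).
Proof.
move=> fc x; elim: n f fc => [|n IH] f fc.
  have -> : (fun y => \sum_(i < 0) f i y) = (fun=> 0) by apply/funext => y; rewrite big_ord0.
  exact: cvg_cst.
have -> : (fun y => \sum_(i < n.+1) f i y) =
    (fun y => \sum_(i < n) f (widen_ord (leqnSn n) i) y + f ord_max y).
  by apply/funext => y; rewrite big_ord_recr.
by apply: cvgD; [apply: IH => i|]; exact: fc.
Qed.

Section AffineForms.
Variable R : realType.
Implicit Types (v x y z : 'I_6 -> R) (q : 'rV[R]_5).

(* The last entry of [v] is the constant term. *)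
Definition aff v q : R := \sum_(i < 5) v (widen_ord (leqnSn 5) i) * q ord0 i + v ord_max.

Definition saff (e : bool) v q : R := if e then aff v q else - aff v q.

Definition side (e : bool) v : set 'rV[R]_5 := [set q | 0 < saff e v q].

Definition weight q : R := \sum_(i < 5) `|q ord0 i| + 1.

Lemma aff_continuous v : continuous (aff v).
Proof.
move=> q; apply: continuousD; last exact: cst_continuous.
apply: continuous_sum => i x; apply: continuousM; [exact: cst_continuous|exact: coord_continuous].
Qed.

Lemma saff_continuous e v : continuous (saff e v).
Proof.
case: e => q; first exact: aff_continuous.
by apply: continuousN; exact: aff_continuous.
Qed.

Lemma weight_continuous : continuous weight.
Proof.
move=> q; apply: continuousD; last exact: cst_continuous.
apply: continuous_sum => i x; apply: continuous_comp; [exact: coord_continuous|exact: norm_continuous].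
Qed.

Lemma weight_gt0 q : 0 < weight q.
Proof. by apply: ltr_wpDl => //; apply: sumr_ge0 => i _. Qed.

Lemma saff_dist e v w q r : (forall i, `|v i - w i| < r) ->
  `|saff e v q - saff e w q| <= r * weight q.
Proof.
move=> vw; have h : `|aff v q - aff w q| <= r * weight q.
  have -> : aff v q - aff w q = \sum_(i < 5) (v (widen_ord (leqnSn 5) i) - w (widen_ord (leqnSn 5) i)) * q ord0 i
      + (v ord_max - w ord_max).
    rewrite /aff opprD addrACA -sumrB; congr (_ + _).
    by apply: eq_bigr => i _; rewrite mulrBl.
  rewrite /weight mulrDr mulr1; apply: le_trans (ler_normD _ _) _; apply: lerD; last exact: ltW.
  rewrite big_distrr /=; apply: le_trans (ler_norm_sum _ _ _) _; apply: ler_sum => i _.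
  by rewrite normrM; apply: ler_wpM2r => //; exact: ltW.
by case: e => //=; rewrite -opprD normrN.
Qed.

Lemma side_measurable e v : measurable (side e v : set (borel R 5)).
Proof. by apply: borel_gt0; exact: saff_continuous. Qed.

Lemma side_negv e v : side e (negv v) = side (~~ e) v.
Proof.
have a q : aff (negv v) q = - aff v q.
  by rewrite /aff /negv opprD -sumrN; congr (_ + _); apply: eq_bigr => i _; rewrite mulNr.
by rewrite /side /saff; apply/seteqP; split=> q /=; case: e; rewrite /= a ?opprK.
Qed.

Section Masses.
Variable m : borel_measure R 5.
Hypothesis m_cont : continuous_measure m.

Definition vol (A : set 'rV[R]_5) : R := fine (m (A : set (borel R 5))).

Lemma volK (A : set 'rV[R]_5) : measurable (A : set (borel R 5)) -> (vol A)%:E = m A.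
Proof. by move=> mA; rewrite /vol fineK // fin_num_measure. Qed.

Lemma vol_ge0 A : 0 <= vol A.
Proof. by rewrite /vol fine_ge0. Qed.

Lemma vol_le (A B : set 'rV[R]_5) : measurable (A : set (borel R 5)) ->
  measurable (B : set (borel R 5)) -> A `<=` B -> vol A <= vol B.
Proof. by move=> mA mB AB; rewrite -lee_fin !volK //; apply: le_measure; rewrite ?inE. Qed.

(** A form without linear part has constant term of absolute value 1 and never vanishes: this is the
    hyperplane at infinity. *)
Lemma aff_null v : in_cube_boundary v -> m [set q | aff v q = 0] = 0%E.
Proof.
move=> [v1 [i0 vi0]].
have [nz|nz] := eqVneq (\row_i v (widen_ord (leqnSn 5) i)) (0 : 'rV_5).
  have v0 i : v (widen_ord (leqnSn 5) i) = 0 by have /rowP/(_ i) := nz; rewrite !mxE.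
  have -> : [set q | aff v q = 0] = set0; last exact: measure0.
  apply/seteqP; split=> // q /=; rewrite /aff big1 ?add0r => [vm|i _]; last by rewrite v0 mul0r.
  have : v i0 = 0.
    have [i0m|i0m] := ltnP i0 5; last by rewrite (_ : i0 = ord_max) //; apply: val_inj => /=; have := ltn_ord i0; lia.
    by rewrite -[RHS](v0 (Ordinal i0m)); congr v; exact: val_inj.
  by move=> e; move: vi0; rewrite e normr0 => /esym/eqP; rewrite oner_eq0.
rewrite -[RHS](m_cont (Hyperplane (- v ord_max) nz)); congr (m _).
have hE q : height (Hyperplane (- v ord_max) nz) q = aff v q.
  by rewrite /height /= opprK; congr (_ + _); apply: eq_bigr => i _; rewrite mxE.
by apply/seteqP; split=> q; rewrite /hyperplane_set /= hE.
Qed.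

Lemma vol_split v (A : set 'rV[R]_5) : in_cube_boundary v -> measurable (A : set (borel R 5)) ->
  vol A = vol (A `&` side true v) + vol (A `&` side false v).
Proof.
move=> vS mA; have mt := side_measurable true v; have mf := side_measurable false v.
have m0 : measurable ([set q | aff v q = 0] : set (borel R 5)).
  by apply: borel_eq0; exact: aff_continuous.
apply: EFin_inj; rewrite EFinD !volK //; try exact: measurableI.
have mAt : measurable ((A `&` side true v) : set (borel R 5)) by exact: measurableI.
have mAf : measurable ((A `&` side false v) : set (borel R 5)) by exact: measurableI.
have dis : (A `&` side true v) `&` (A `&` side false v) = set0.
  by apply/seteqP; split=> // q [[_ h1] [_ h2]]; move: h1 h2; rewrite /side /saff /=; lra.
apply: etrans _ (measureU m mAt mAf dis).
have mA0 : measurable ((A `&` [set q | aff v q = 0]) : set (borel R 5)) by exact: measurableI.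
have A00 : m (A `&` [set q | aff v q = 0]) = 0%E.
  apply: (@subset_measure0 _ _ _ m _ [set q | aff v q = 0]) => //; exact: aff_null.
apply: etrans _ (measureU0 (measurableU _ _ mAt mAf) mA0 A00).
congr (m _); apply/seteqP; split=> q /=; last by move=> [[[]|[]]|[]].
rewrite /side /saff /= => Aq; case: (ltrgtP (aff v q) 0) => h.
- by left; right; split=> //; rewrite oppr_gt0.
- by left; left.
- by right.
Qed.

Definition orthant_vol x y z (e0 e1 e2 : bool) : R :=
  vol (side e0 x `&` side e1 y `&` side e2 z).

Lemma orthant_measurable x y z e0 e1 e2 :
  measurable ((side e0 x `&` side e1 y `&` side e2 z) : set (borel R 5)).
Proof. by apply: measurableI; [apply: measurableI|]; exact: side_measurable. Qed.

Lemma orthant_vol_sum x y z : in_cube_boundary x -> in_cube_boundary y -> in_cube_boundary z ->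
  \sum_(e0 : bool) \sum_(e1 : bool) \sum_(e2 : bool) orthant_vol x y z e0 e1 e2 = vol setT.
Proof.
move=> xS yS zS; rewrite (vol_split xS measurableT) !big_bool !setTI /orthant_vol.
rewrite !(vol_split yS (side_measurable _ _)).
have mm e e' : measurable ((side e x `&` side e' y) : set (borel R 5)).
  by apply: measurableI; exact: side_measurable.
by rewrite !(vol_split zS (mm _ _)).
Qed.

(* [side e v] is the union of the sets [inner n e v], and each of these stays
   inside [side e w] for [w] close to [v]. *)
Let inner n e v : set 'rV[R]_5 := [set q | 0 <= saff e v q - n.+1%:R^-1 * weight q].

Let inner_measurable n e v : measurable (inner n e v : set (borel R 5)).
Proof.
apply: borel_ge0 => q; apply: continuousB; first exact: saff_continuous.
by apply: continuousM; [exact: cst_continuous|exact: weight_continuous].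
Qed.

Let inner_mono e v : {homo (fun n => inner n e v) : n k / (n <= k)%N >-> n `<=` k}.
Proof.
move=> n k nk q; rewrite /inner /= => h; apply: le_trans h _; rewrite lerD2l lerN2.
apply: ler_wpM2r; first exact: ltW (weight_gt0 q).
by rewrite lef_pV2 ?posrE ?ltr0n // ler_nat ltnS.
Qed.

Let inner_cover e v : \bigcup_n inner n e v = side e v.
Proof.
apply/seteqP; split=> q.
  move=> [n _]; rewrite /inner /side /= subr_ge0 => h; apply: lt_le_trans h.
  by rewrite mulr_gt0 ?weight_gt0 // invr_gt0 ltr0n.
rewrite /side /= => h; have w0 := weight_gt0 q.
have [n0 n0P] := small_mesh (divr_gt0 h w0).
exists n0 => //; rewrite /inner /= subr_ge0 -ler_pdivlMr //.
by have [|+ _] := n0P n0; [exact: leqnn|exact: ltW].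
Qed.

Let inner_side n e v w : (forall i, `|w i - v i| < n.+1%:R^-1) -> inner n e v `<=` side e w.
Proof.
move=> near q; rewrite /inner /side /= subr_ge0; move: near.
have : 0 < n.+1%:R^-1 :> R by rewrite invr_gt0 ltr0n.
move: (n.+1%:R^-1) => k k0 near h.
pose r := \big[Num.max/0]_i `|v i - w i|.
have rk : r < k by apply: bigmax_lt => // i _; rewrite distrC.
(* [saff_dist] takes strict bounds and returns a weak one, so a value strictly between the actual
   distance and [k] is inserted. *)
pose r' := (r + k) / 2.
have vr i : `|v i - w i| < r'.
  by apply: le_lt_trans (_ : r < r'); [exact: le_bigmax_cond|rewrite /r'; lra].
have := saff_dist e q vr; rewrite ler_norml => /andP[_ h2].
have : r' * weight q < k * weight q by rewrite ltr_pM2r ?weight_gt0 // /r'; lra.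
lra.
Qed.

(** By continuity from below some inner set has almost the full volume, and it stays inside all
    orthants close enough to the given one. *)
Lemma orthant_vol_lsc x y z e0 e1 e2 (eps : R) : 0 < eps -> exists2 r : R, 0 < r & forall x' y' z',
  (forall i, `|x' i - x i| < r) -> (forall i, `|y' i - y i| < r) -> (forall i, `|z' i - z i| < r) ->
  orthant_vol x y z e0 e1 e2 - eps < orthant_vol x' y' z' e0 e1 e2.
Proof.
move=> eps0; pose C n := inner n e0 x `&` inner n e1 y `&` inner n e2 z.
have mC n : measurable (C n : set (borel R 5)).
  by apply: measurableI; [apply: measurableI|]; exact: inner_measurable.
have CU : \bigcup_n C n = side e0 x `&` side e1 y `&` side e2 z.
  rewrite -!inner_cover; apply/seteqP; split=> q.
    by move=> [n _ [[h0 h1] h2]]; split; [split|]; exists n.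
  move=> [[[n0 _ h0] [n1 _ h1]] [n2 _ h2]].
  exists (maxn n0 (maxn n1 n2)) => //; split; [split|].
  - by apply: inner_mono h0; rewrite leq_max leqnn.
  - by apply: inner_mono h1; rewrite !leq_max leqnn !orbT.
  - by apply: inner_mono h2; rewrite !leq_max leqnn !orbT.
have mono : {homo C : n k / (n <= k)%N >-> (n <= k)%O}.
  move=> n k nk; rewrite subsetEset => q [[h0 h1] h2].
  by split; [split|]; apply: inner_mono; eassumption.
have mU : measurable ((\bigcup_n C n) : set (borel R 5)) by rewrite CU; exact: orthant_measurable.
have /fine_cvg cv : m (C n) @[n --> \oo] --> (vol (\bigcup_n C n))%:E.
  by rewrite volK //; exact: (nondecreasing_cvg_mu (mu := m) mC mU mono).
have /cvgrPdist_lt/(_ _ eps0)[n _ /(_ n (leqnn n))] := cv.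
rewrite CU => hn; exists n.+1%:R^-1; first by rewrite invr_gt0 ltr0n.
move=> x' y' z' xx yy zz.
have h : vol (C n) <= orthant_vol x' y' z' e0 e1 e2.
  apply: vol_le => //; first exact: orthant_measurable.
  by move=> q [[h0 h1] h2]; split; [split|]; [exact: (inner_side xx)|exact: (inner_side yy)|exact: (inner_side zz)].
apply: lt_le_trans h; rewrite ltrBlDr -ltrBlDl; apply: le_lt_trans hn; exact: ler_norm.
Qed.

(* The volume of every orthant is lower semicontinuous and their sum is constant. *)
Lemma orthant_vol_cont (p : configuration R) e0 e1 e2 : spherical p ->
  cont_at p (fun q : configuration R => orthant_vol (q (inord 0)) (q (inord 1)) (q (inord 2)) e0 e1 e2).
Proof.
pose O (q : configuration R) e := orthant_vol (q (inord 0)) (q (inord 1)) (q (inord 2)) e.1.1 e.1.2 e.2.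
move=> pS.
have tot (q : configuration R) : spherical q -> \sum_e O q e = vol setT.
  move=> qS; rewrite -(orthant_vol_sum (qS (inord 0)) (qS (inord 1)) (qS (inord 2))).
  by rewrite pair_big pair_big; apply: eq_big => [[[]]|[[]]].
suff contO e : cont_at p (O ^~ e) by exact: (contO (e0, e1, e2)).
suff main (eps : R) : 0 < eps -> exists2 r : R, 0 < r & forall q : configuration R, spherical q ->
    (forall b i, `|q b i - p b i| < r) -> `|O q e - O p e| < eps by exact main.
move=> eps0.
have [r r0 rP] : exists2 r : R, 0 < r & forall q : configuration R, (forall b i, `|q b i - p b i| < r) ->
    forall e', O p e' - eps / 8 < O q e'.
  (* If each of the other seven orthants loses at most eps/8, the remaining one gains less than
     eps. *)
  have eps8 : 0 < eps / 8 by lra.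
  have /choice[r /all_and2[r0 rP]] : forall e', exists r : R, 0 < r /\ forall x' y' z',
      (forall i, `|x' i - p (inord 0) i| < r) -> (forall i, `|y' i - p (inord 1) i| < r) ->
      (forall i, `|z' i - p (inord 2) i| < r) ->
      O p e' - eps / 8 < orthant_vol x' y' z' e'.1.1 e'.1.2 e'.2.
    move=> e'; have [r r0 rP] := orthant_vol_lsc (p (inord 0)) (p (inord 1)) (p (inord 2))
       e'.1.1 e'.1.2 e'.2 eps8.
    by exists r.
  exists (\big[Num.min/1]_e' r e').
    by apply: lt_bigmin => //.
  move=> q near e'; have near' b i : `|q b i - p b i| < r e'.
    by apply: lt_le_trans (near b i) _; exact: bigmin_le_cond.
  by apply: rP => i; exact: near'.
exists r => // q qS near; have h := rP q near.
have := tot q qS; rewrite -(tot p pS) (bigD1 e) //= [in RHS](bigD1 e) //= => sumE.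
have : \sum_(i | i != e) (O p i - eps / 8) <= \sum_(i | i != e) O q i.
  by apply: ler_sum => i _; exact: ltW.
rewrite sumrB sumr_const.
have -> : #|(fun i => i != e)| = 7.
  by rewrite (eq_card (B := predC1 e)) // cardC1 !card_prod !card_bool.
have := h e; rewrite -[eps / 8 *+ 7]mulr_natr => h1 h2.
by rewrite ltr_norml; apply/andP; split; lra.
Qed.

End Masses.
End AffineForms.

(** * Signed sums of octant masses *)

Section Transform.
Variable R : realType.

Definition alternate (c : bool) (g : bool -> R) : R := g true + (if c then - g false else g false).

(** The Walsh coefficient of [M] at the character [c] of (Z/2)^3. *)
Definition transform (c : bool * bool * bool) (M : bool -> bool -> bool -> R) : R :=
  alternate c.1.1 (fun e0 => alternate c.1.2 (fun e1 => alternate c.2 (M e0 e1))).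

Lemma transform_neg0 c M : transform c (fun e0 => M (~~ e0)) = (-1) ^+ c.1.1 * transform c M.
Proof. by case: c => [[[] []] []]; rewrite /transform /alternate /= ?expr1 ?expr0; ring. Qed.

Lemma transform_neg1 c M : transform c (fun e0 e1 => M e0 (~~ e1)) = (-1) ^+ c.1.2 * transform c M.
Proof. by case: c => [[[] []] []]; rewrite /transform /alternate /= ?expr1 ?expr0; ring. Qed.

Lemma transform_neg2 c M : transform c (fun e0 e1 e2 => M e0 e1 (~~ e2)) = (-1) ^+ c.2 * transform c M.
Proof. by case: c => [[[] []] []]; rewrite /transform /alternate /= ?expr1 ?expr0; ring. Qed.

Lemma transform_swap c M : transform c (fun e0 e1 => M e1 e0) = transform (c.1.2, c.1.1, c.2) M.
Proof. by case: c => [[[] []] []]; rewrite /transform /alternate /=; ring. Qed.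

Lemma transform_cont p c (M : configuration R -> bool -> bool -> bool -> R) :
  (forall e0 e1 e2, cont_at p (fun q => M q e0 e1 e2)) -> cont_at p (fun q => transform c (M q)).
Proof.
have alt c' (g : configuration R -> bool -> R) : (forall e, cont_at p (g ^~ e)) ->
    cont_at p (fun q => alternate c' (g q)).
  move=> gc; apply: cont_add; first exact: gc.
  by case: c'; [apply: cont_opp|]; exact: gc.
move=> Mc; apply: (alt _ (fun q e0 => alternate _ (fun e1 => alternate _ (M q e0 e1)))) => e0.
apply: (alt _ (fun q e1 => alternate _ (M q e0 e1))) => e1.
by apply: (alt _ (fun q e2 => M q e0 e1 e2)) => e2; exact: Mc.
Qed.

End Transform.

Section Octants.
Variable R : realType.
Implicit Types x y z : 'I_6 -> R.

Lemma orthant_vol_swap (m : borel_measure R 5) x y z e0 e1 e2 :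
  orthant_vol m y x z e0 e1 e2 = orthant_vol m x y z e1 e0 e2.
Proof. by rewrite /orthant_vol (setIC (side e0 y)). Qed.

Lemma orthant_vol_diagonal (m : borel_measure R 5) x z e0 e1 e2 : e0 != e1 ->
  orthant_vol m x x z e0 e1 e2 = 0.
Proof.
move=> ne; rewrite /orthant_vol.
have -> : side e0 x `&` side e1 x = set0; last by rewrite set0I /vol measure0.
apply/seteqP; split=> // q []; rewrite /side /saff /=.
by case: e0 e1 ne => [] [] //= _; lra.
Qed.

Variables m1 m2 m3 : borel_measure R 5.
Hypotheses (m1_cont : continuous_measure m1) (m2_cont : continuous_measure m2)
  (m3_cont : continuous_measure m3).

(** Both [m1] and [m2] meet all seven nontrivial characters; [m3] takes the third copy of the
    character of z. As [XY0] goes to [m1], the diagonal condition requires the mass of [m1] to be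
    positive. *)
Definition tested (j : component) : borel_measure R 5 :=
  match j with
  | X0 | Y0 | Z0 | XZ0 | YZ0 | XY0 | XYZ0 => m1
  | Z2 => m3
  | _ => m2
  end.

Definition octant_test x y z (j : component) : R :=
  transform (character j) (orthant_vol (tested j) x y z).

Lemma octant_test_equivariant :
  equivariant_map (fun p => octant_test (p (inord 0)) (p (inord 1)) (p (inord 2))).
Proof.
apply: equivariant_intro => x y z j; rewrite /octant_test.
- rewrite -transform_neg0; congr transform; do 3! apply/funext => ?; by rewrite /orthant_vol side_negv.
- rewrite -transform_neg1; congr transform; do 3! apply/funext => ?; by rewrite /orthant_vol side_negv.
- rewrite -transform_neg2; congr transform; do 3! apply/funext => ?; by rewrite /orthant_vol side_negv.
- have -> : orthant_vol (tested j) y x z =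
      fun e0 e1 e2 => orthant_vol (tested (swap_component j)) x y z e1 e0 e2.
    by do 3! apply/funext => ?; rewrite orthant_vol_swap; case: j.
  by rewrite transform_swap; case: j.
Qed.

Lemma octant_test_continuous :
  continuous_map (fun p => octant_test (p (inord 0)) (p (inord 1)) (p (inord 2))).
Proof.
move=> p pS j; apply: transform_cont => e0 e1 e2; apply: orthant_vol_cont => //.
by case: j.
Qed.

(** For x = y the octants counted negatively are empty, so the signed sum is the total mass. *)
Lemma octant_test_diagonal x z : 0 < vol m1 setT -> in_cube_boundary x -> in_cube_boundary z ->
  0 < octant_test x x z XY0.
Proof.
move=> m1T xS zS; rewrite (_ : octant_test _ _ _ _ = vol m1 setT) //.
rewrite -(orthant_vol_sum m1_cont xS xS zS) !big_bool /octant_test /transform /alternate /=.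
have d e0 e1 e2 (ne : e0 != e1) := orthant_vol_diagonal m1 x z e2 ne.
by rewrite !(d true false) // !(d false true) //; ring.
Qed.

Theorem octants : 0 < vol m1 setT -> exists x y z,
  [/\ in_cube_boundary x, in_cube_boundary y & in_cube_boundary z] /\
  [/\ forall e0 e1 e2, orthant_vol m1 x y z e0 e1 e2 = vol m1 setT / 8,
      forall e0 e1 e2, orthant_vol m2 x y z e0 e1 e2 = vol m2 setT / 8 &
      vol m3 (side true z) = vol m3 (side false z)].
Proof.
move=> m1T; have [|p pS p0] := equivariant_zero octant_test_continuous octant_test_equivariant.
  move=> p pS /= e; rewrite -e; apply: octant_test_diagonal => //; exact: pS.
exists (p (inord 0)), (p (inord 1)), (p (inord 2)).
move: (pS (inord 0)) (pS (inord 1)) (pS (inord 2)) p0 => /=.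
move: (p (inord 0)) (p (inord 1)) (p (inord 2)) => x y z {pS p} xS yS zS F0.
split=> //.
(* A function on (Z/2)^3 whose nontrivial Walsh coefficients vanish is constant. *)
have solve (m : borel_measure R 5) : continuous_measure m ->
    (forall c, c != (false, false, false) -> c != (false, false, true) ->
       transform c (orthant_vol m x y z) = 0) ->
    transform (false, false, true) (orthant_vol m x y z) = 0 ->
    forall e0 e1 e2, orthant_vol m x y z e0 e1 e2 = vol m setT / 8.
  move=> mc hc h7.
  have := hc (true, false, false) isT isT; have := hc (false, true, false) isT isT.
  have := hc (true, true, false) isT isT; have := hc (true, false, true) isT isT.
  have := hc (false, true, true) isT isT; have := hc (true, true, true) isT isT.
  have := h7; have := orthant_vol_sum mc xS yS zS; rewrite !big_bool /transform /alternate /=.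
  move: (orthant_vol m x y z) => O h0 h1 h2 h3 h4 h5 h6 {}h7 [] [] []; lra.
split.
- apply: solve => //; last exact: (F0 Z0).
  by move=> [[[] []] []] // _ _; [exact: (F0 XYZ0)|exact: (F0 XY0)|exact: (F0 XZ0)|exact: (F0 X0)|exact: (F0 YZ0)|exact: (F0 Y0)].
- apply: solve => //; last exact: (F0 Z1).
  by move=> [[[] []] []] // _ _; [exact: (F0 XYZ1)|exact: (F0 XY1)|exact: (F0 XZ1)|exact: (F0 X1)|exact: (F0 YZ1)|exact: (F0 Y1)].
have mz e := side_measurable e z.
have sum e : vol m3 (side e z) = \sum_(e0 : bool) \sum_(e1 : bool) orthant_vol m3 x y z e0 e1 e.
  have I A B C : (A `&` B) `&` C = (B `&` C) `&` A :> set 'rV[R]_5.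
    by rewrite -setIA setIC.
  rewrite (vol_split m3_cont xS (mz e)) !big_bool /orthant_vol.
  rewrite !(vol_split m3_cont yS (measurableI _ _ (mz e) (side_measurable _ x))).
  by rewrite !(I (side e z)) /= !addrA.
have := F0 Z2; rewrite /octant_test /transform /alternate /= !sum !big_bool /=; lra.
Qed.

End Octants.

Section HamSandwich.
Variable R : realType.

Definition imbalance (m : borel_measure R 5) (z : 'I_6 -> R) : R :=
  vol m (side true z) - vol m (side false z).

Lemma imbalance_odd m : odd_fun (imbalance m).
Proof. by move=> z; rewrite /imbalance !side_negv opprB. Qed.

(** A side of z is an orthant of the configuration (z, z, z), whose volume is known to be
    continuous. *)
Lemma imbalance_cont m : continuous_measure m -> cont_z (imbalance m).
Proof.
move=> mc p pS; have pS' : spherical (fun=> p (inord 2)) by move=> b; exact: pS.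
have sideE e z : vol m (side e z) = orthant_vol m z z z e e e.
  by rewrite /orthant_vol !setIid.
have contS e : cont_at p (fun q => vol m (side e (q (inord 2)))).
  move=> eps eps0; have [d d0 dP] := orthant_vol_cont mc e e e pS' eps0.
  exists d => // q qS near; rewrite !sideE.
  by apply: (dP (fun=> q (inord 2))) => [b|b i]; [exact: qS|exact: near].
by apply: cont_add => //; exact: cont_opp.
Qed.

(* In the test map below, [zt1 = b2] and [om = b1], so that [test_map_zero]
   makes the last two imbalances vanish whether or not [(zt1, zt2, om)] is 0. *)
Theorem ham_sandwich (m0 m1 m2 m3 m4 : borel_measure R 5) :
  continuous_measure m0 -> continuous_measure m1 -> continuous_measure m2 ->
  continuous_measure m3 -> continuous_measure m4 ->
  exists2 z, in_cube_boundary z &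
    [/\ imbalance m0 z = 0, imbalance m1 z = 0, imbalance m2 z = 0, imbalance m3 z = 0 &
        imbalance m4 z = 0].
Proof.
move=> c0 c1 c2 c3 c4.
pose D := ZData (imbalance m0) (imbalance m1) (imbalance m2) (imbalance m3) (imbalance m4)
  (imbalance m4) (fun=> 0) (imbalance m3).
have Deq : equivariant_map (z_test D).
  apply: z_test_equivariant; try exact: imbalance_odd.
  by move=> z /=; rewrite oppr0.
have Dco : continuous_map (z_test D).
  apply: z_test_continuous; try exact: imbalance_cont.
  by move=> p _; exact: cont_cst.
have [|p pS F0] := equivariant_zero Dco Deq; first exact: z_test_diagonal.
exists (p (inord 2)); first exact: pS.
have [e3 e4] : imbalance m3 (p (inord 2)) = 0 /\ imbalance m4 (p (inord 2)) = 0.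
  apply: contrapT => ne; apply: (ne); apply: (test_map_zero _ _ _ F0); [exact: pS|exact: pS|].
  by move=> [t1 _ om]; exact: ne.
by split; [exact: (F0 Z0)|exact: (F0 Z1)|exact: (F0 Z2)| |].
Qed.

End HamSandwich.

(** * Lebesgue measure of sets *)

Section OuterMeasure.
Variables (R : realType) (d : nat).
Notation E := 'rV[R]_d.+1.
Implicit Types (X : set E) (c : nat -> E * E).

Definition box_volume (ab : E * E) : R := \prod_(i < d.+1) (ab.2 ord0 i - ab.1 ord0 i).

Definition proper_box (ab : E * E) : Prop := forall i, ab.1 ord0 i <= ab.2 ord0 i.

Definition box_cover X c : Prop :=
  (forall k, proper_box (c k)) /\ X `<=` \bigcup_k box (c k).1 (c k).2.

Definition cover_volume c : \bar R := (\sum_(0 <= k <oo) (box_volume (c k))%:E)%E.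

Lemma box_volume_ge0 ab : proper_box ab -> 0 <= box_volume ab.
Proof. by move=> p; apply: prodr_ge0 => i _; rewrite subr_ge0. Qed.

Lemma lebesgue_outerE X :
  lebesgue_outer X = ereal_inf [set cover_volume c | c in box_cover X].
Proof.
congr ereal_inf; apply/seteqP; split=> v.
  by move=> [a [b [ab Xab ->]]]; exists (fun k => (a k, b k)).
by move=> [c [pc Xc] <-]; exists (fst \o c), (snd \o c).
Qed.

Lemma cover_volume_ge0 X c : box_cover X c -> (0 <= cover_volume c)%E.
Proof. by move=> [pc _]; apply: nneseries_ge0 => k _ _; rewrite lee_fin box_volume_ge0. Qed.

Lemma lebesgue_outer_le X c : box_cover X c -> (lebesgue_outer X <= cover_volume c)%E.
Proof. by move=> Xc; rewrite lebesgue_outerE; apply: ereal_inf_lbound; exists c. Qed.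

Lemma le_lebesgue_outer X (y : \bar R) :
  (forall c, box_cover X c -> (y <= cover_volume c)%E) -> (y <= lebesgue_outer X)%E.
Proof. by move=> h; rewrite lebesgue_outerE; apply: le_ereal_inf_tmp => _ [c Xc <-]; exact: h. Qed.

Lemma lebesgue_outer_mono X Y : X `<=` Y -> (lebesgue_outer X <= lebesgue_outer Y)%E.
Proof.
move=> XY; apply: le_lebesgue_outer => c [pc Yc]; apply: lebesgue_outer_le; split=> //.
exact: subset_trans XY Yc.
Qed.

Lemma lebesgue_outer_ge0 X : (0 <= lebesgue_outer X)%E.
Proof. by apply: le_lebesgue_outer => c; exact: cover_volume_ge0. Qed.

(** The padding boxes are degenerate and have volume 0, the dimension being positive. *)
Definition single_box (ab : E * E) : nat -> E * E := fun k => if k is 0 then ab else (0, 0).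

Lemma single_box_cover ab : proper_box ab -> box_cover (box ab.1 ab.2) (single_box ab).
Proof. by move=> p; split=> [[|k] //=|q bq]; exists 0. Qed.

Lemma single_box_volume ab : cover_volume (single_box ab) = (box_volume ab)%:E.
Proof.
apply: lim_near_cst => //; near=> n; have n0 : (0 < n)%N by near: n; exists 1.
rewrite -(prednK n0) big_nat_recl //= big1 ?adde0 // => i _.
by rewrite /box_volume big_ord_recl /= subrr mul0r.
Unshelve. all: by end_near. Qed.

Lemma lebesgue_outer_box ab : proper_box ab ->
  (lebesgue_outer (box ab.1 ab.2) <= (box_volume ab)%:E)%E.
Proof. by move=> p; rewrite -single_box_volume; apply: lebesgue_outer_le; exact: single_box_cover. Qed.

Lemma lebesgue_outer0 : lebesgue_outer (set0 : set E) = 0%E.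
Proof.
apply/eqP; rewrite eq_le lebesgue_outer_ge0 andbT.
have p0 : proper_box ((0, 0) : E * E) by move=> i.
apply: le_trans (lebesgue_outer_mono (sub0set (box (0, 0 : E).1 (0, 0 : E).2))) _.
apply: le_trans (lebesgue_outer_box p0) _.
by rewrite /box_volume big_ord_recl /= subrr mul0r.
Qed.

Lemma lebesgue_outer_subadditive : sigma_subadditive (@lebesgue_outer R d.+1).
Proof.
move=> A; have [[i ioo]|noo] := pselect (exists i, lebesgue_outer (A i) = +oo%E).
  rewrite (eseries_pinfty _ _ ioo) ?leey// => n _.
  by rewrite -ltNye (lt_le_trans _ (lebesgue_outer_ge0 _)).
have fin i : lebesgue_outer (A i) \is a fin_num.
  rewrite ge0_fin_numE ?lebesgue_outer_ge0 // ltey; apply/eqP => ioo; apply: noo; by exists i.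
apply/lee_addgt0Pr => e e0.
apply: le_trans (epsilon_trick xpredT (fun n => lebesgue_outer_ge0 (A n)) (ltW e0)).
have /choice[G] : forall n, exists c, box_cover (A n) c /\
    (cover_volume c <= lebesgue_outer (A n) + (e / (2 ^ n.+1)%:R)%:E)%E.
  move=> n; have en : 0 < e / (2 ^ n.+1)%:R by rewrite divr_gt0 // ltr0n expn_gt0.
  have := fin n; rewrite lebesgue_outerE => /(lb_ereal_inf_adherent en) [_ [c Ac <-] /ltW h].
  by exists c.
move=> /all_and2[Gc Gv].
have /card_esym/ppcard_eqP[f] := card_nat2.
pose c k := G (f k).1 (f k).2.
have v0 i j : (0 <= (box_volume (G i j))%:E)%E.
  by rewrite lee_fin box_volume_ge0 //; have [] := Gc i.
have cc : box_cover (\bigcup_n A n) c.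
  split=> [k|q [n _ Aq]]; first by have [h _] := Gc (f k).1; exact: h.
  have [_ /(_ q Aq)[j _ qj]] := Gc n.
  by exists (f^-1%FUN (n, j)) => //; rewrite /c invK ?inE.
apply: le_trans (lebesgue_outer_le cc) _.
apply: (@le_trans _ _ (\sum_(0 <= i <oo) cover_volume (G i))%E); last first.
  apply: lee_nneseries => // i _ _; exact: (cover_volume_ge0 (Gc i)).
rewrite /cover_volume nneseries_esumT => [|k]; last exact: v0.
rewrite -(@reindex_esum _ _ _ setT setT f (fun x => (box_volume (G x.1 x.2))%:E)); last first.
  exact: bij.
under eq_eseriesr do rewrite nneseries_esumT //.
rewrite nneseries_esumT => [|i]; last exact: esum_ge0.
rewrite esum_esum //.
by rewrite (_ : [set: nat] `*`` _ = setT) //; apply/seteqP; split.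
Qed.

HB.instance Definition _ := isOuterMeasure.Build R E (@lebesgue_outer R d.+1)
  lebesgue_outer0 lebesgue_outer_ge0 lebesgue_outer_mono lebesgue_outer_subadditive.


(** The hyperplane cuts every box of a cover into two boxes whose volumes add up. *)
Lemma lebesgue_half_caratheodory (i : 'I_d.+1) (t : R) :
  (@lebesgue_outer R d.+1).-caratheodory [set q : E | t < q ord0 i].
Proof.
apply: le_caratheodory_measurable => X; apply: le_lebesgue_outer => c [pc Xc].
(* The cut [t], clamped to the box, so that a box missed by the hyperplane leaves a degenerate
   part. *)
pose m (ab : E * E) := Num.max (ab.1 ord0 i) (Num.min (ab.2 ord0 i) t).
pose up (ab : E * E) : E * E := (\row_j (if j == i then m ab else ab.1 ord0 j), ab.2).
pose lo (ab : E * E) : E * E := (ab.1, \row_j (if j == i then m ab else ab.2 ord0 j)).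
have am (ab : E * E) : ab.1 ord0 i <= m ab by rewrite /m le_max lexx.
have mb (ab : E * E) : proper_box ab -> m ab <= ab.2 ord0 i by move=> p; rewrite /m ge_max p ge_min lexx.
have pu (ab : E * E) : proper_box ab -> proper_box (up ab).
  by move=> p j; rewrite /up mxE /=; case: eqP => [->|_]; [exact: mb|exact: p].
have pl (ab : E * E) : proper_box ab -> proper_box (lo ab).
  by move=> p j; rewrite /lo mxE /=; case: eqP => [->|_]; [exact: am|exact: p].
have volE (ab : E * E) : box_volume ab = box_volume (up ab) + box_volume (lo ab).
  have vD (cd : E * E) : box_volume cd =
      (cd.2 ord0 i - cd.1 ord0 i) * \prod_(j | j != i) (cd.2 ord0 j - cd.1 ord0 j).
    by rewrite /box_volume (bigD1 i).
  rewrite !vD /up /lo /= !(mxE _ _ _ i) eqxx.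
  have -> : \prod_(j | j != i) (ab.2 ord0 j - (\row_j (if j == i then m ab else ab.1 ord0 j)) ord0 j) =
      \prod_(j | j != i) (ab.2 ord0 j - ab.1 ord0 j).
    by apply: eq_bigr => j ji; rewrite mxE (negbTE ji).
  have -> : \prod_(j | j != i) ((\row_j (if j == i then m ab else ab.2 ord0 j)) ord0 j - ab.1 ord0 j) =
      \prod_(j | j != i) (ab.2 ord0 j - ab.1 ord0 j).
    by apply: eq_bigr => j ji; rewrite mxE (negbTE ji).
  by ring.
have cu : box_cover (X `&` [set q | t < q ord0 i]) (up \o c).
  split=> [k|q [/Xc[k _ qk] tq]]; first exact: pu.
  exists k => // j; have := qk j; rewrite /up /= mxE !in_itv /=; case: eqP => // -> /andP[h1 h2].
  by rewrite h2 andbT /m gt_max h1 gt_min tq orbT.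
have cl : box_cover (X `&` ~` [set q | t < q ord0 i]) (lo \o c).
  split=> [k|q [/Xc[k _ qk] /negP]]; first exact: pl.
  rewrite -leNgt => tq.
  exists k => // j; have := qk j; rewrite /lo /= mxE !in_itv /=; case: eqP => // -> /andP[h1 h2].
  by rewrite h1 /= /m le_max le_min h2 tq orbT.
apply: le_trans (leeD (lebesgue_outer_le cu) (lebesgue_outer_le cl)) _.
rewrite /cover_volume -nneseriesD; last 2 first.
- by move=> k _ _; rewrite lee_fin box_volume_ge0 //; exact: pu.
- by move=> k _ _; rewrite lee_fin box_volume_ge0 //; exact: pl.
apply: lee_nneseries => [k _ _|k _]; last by rewrite -EFinD lee_fin [leRHS]volE.
by rewrite -EFinD lee_fin addr_ge0 ?box_volume_ge0 //; [exact: pu|exact: pl].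
Qed.

Lemma box_caratheodory (a b : E) : (@lebesgue_outer R d.+1).-caratheodory (box a b).
Proof.
have -> : box a b = \bigcap_(i in [set: 'I_d.+1])
    ([set q : E | a ord0 i < q ord0 i] `&` ~` [set q : E | b ord0 i < q ord0 i]).
  apply/seteqP; split=> q h i; first by have := h i; rewrite in_itv /= => /andP[h1 h2]; split=> //=; rewrite ltNge h2.
  by have [//|h1 h2] := h i; rewrite in_itv /= h1 /= leNgt; apply/negP.
apply: (@fin_bigcap_measurable _ (caratheodory_type (@lebesgue_outer R d.+1))) => //.
move=> i _; apply: (@measurableI _ (caratheodory_type (@lebesgue_outer R d.+1))).
  exact: lebesgue_half_caratheodory.
apply: (@measurableC _ (caratheodory_type (@lebesgue_outer R d.+1))).
exact: lebesgue_half_caratheodory.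
Qed.

(** An open set is the union of the boxes with rational corners that it contains, and there are
    countably many. *)
Lemma open_caratheodory (U : set E) : open U -> (@lebesgue_outer R d.+1).-caratheodory U.
Proof.
move=> oU; pose B (f : {ffun 'I_d.+1 -> rat * rat}) : set E :=
  box (\row_i ratr (f i).1) (\row_i ratr (f i).2).
have -> : U = \bigcup_f (if `[< B f `<=` U >] then B f else set0).
  apply/seteqP; split=> [q Uq|q [f _]]; last by case: asboolP => // BU; exact: BU.
  have /nbhs_ballP[e /= e0 qe] := open_nbhs_nbhs (conj oU Uq).
  have /fin_all_exists[f fP] : forall i : 'I_d.+1, exists ab : rat * rat,
      [/\ q ord0 i - e < ratr ab.1, ratr ab.1 < q ord0 i, q ord0 i < ratr ab.2 & ratr ab.2 < q ord0 i + e].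
    move=> i; have [|a] := @rat_in_itvoo R (q ord0 i - e) (q ord0 i); first by rewrite ltrBlDr ltrDl.
    have [|b] := @rat_in_itvoo R (q ord0 i) (q ord0 i + e); first by rewrite ltrDl.
    by rewrite !in_itv /= => /andP[h1 h2] /andP[h3 h4]; exists (a, b).
  exists (finfun f) => //; rewrite ifT.
    by move=> i; rewrite !mxE ffunE in_itv /=; have [_ -> /ltW-> _] := fP i.
  apply/asboolP => r rB; apply: qe; split=> // i j; rewrite ord1.
  have := rB j; rewrite !mxE ffunE in_itv /= => /andP[h1 h2].
  have [h3 h4 h5 h6] := fP j.
  rewrite /ball /= ltr_norml; apply/andP; split; lra.
apply: (@countable_bigcupT_measurable _ (caratheodory_type (@lebesgue_outer R d.+1))) => // f.
case: asboolP => _; last exact: (@measurable0 _ (caratheodory_type (@lebesgue_outer R d.+1))).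
exact: box_caratheodory.
Qed.

Lemma borel_caratheodory (A : set (borel R d.+1)) : measurable A ->
  (@lebesgue_outer R d.+1).-caratheodory A.
Proof.
apply: smallest_sub; last by move=> U; exact: open_caratheodory.
exact: (@sigma_algebra_measurable _ (caratheodory_type (@lebesgue_outer R d.+1))).
Qed.

End OuterMeasure.

(** * Sets as continuous Borel measures *)

Section SetMass.
Variables (R : realType) (d : nat).
Notation E := 'rV[R]_d.+1.
Notation cara := (caratheodory_type (@lebesgue_outer R d.+1)).

(** Lebesgue measure restricted to [B]; bisecting this measure is bisecting [B]. The proof [hB] is
    an argument so that the measure structure can be attached to the term. *)
Definition set_mass (B : set E) (hB : finite_lebesgue_measurable B) (A : set (borel R d.+1)) : \bar R :=
  lebesgue_outer (A `&` B).

Section Instance.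
Variables (B : set E) (hB : finite_lebesgue_measurable B).

Let set_mass0 : set_mass hB set0 = 0%E.
Proof. by rewrite /set_mass set0I lebesgue_outer0. Qed.

Let set_mass_ge0 A : (0 <= set_mass hB A)%E.
Proof. exact: lebesgue_outer_ge0. Qed.

Let set_mass_additive : semi_sigma_additive (set_mass hB).
Proof.
move=> F mF tF mU.
pose lam : {outer_measure set E -> \bar R} := @lebesgue_outer R d.+1.
have mB : measurable (B : set (caratheodory_type lam)) := hB.1.
pose m : {measure set (caratheodory_type lam) -> \bar R} := mrestr (lam : set (caratheodory_type lam) -> \bar R) mB.
apply: (@measure_semi_sigma_additive _ _ _ m F) => //.
- by move=> i; exact: borel_caratheodory.
- exact: borel_caratheodory.
Qed.

HB.instance Definition _ := isMeasure.Build _ (borel R d.+1) R (set_mass hB)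
  set_mass0 set_mass_ge0 set_mass_additive.

Let set_mass_fin : fin_num_fun (set_mass hB).
Proof.
move=> A mA; rewrite ge0_fin_numE ?set_mass_ge0 //; apply: le_lt_trans hB.2.
by apply: lebesgue_outer_mono => q [].
Qed.

HB.instance Definition _ := Measure_isFinite.Build _ (borel R d.+1) R (set_mass hB) set_mass_fin.

End Instance.

Lemma lebesgue_outer_translate (X : set E) v :
  (lebesgue_outer [set q | X (q + v)%R] <= lebesgue_outer X)%E.
Proof.
apply: le_lebesgue_outer => c [pc Xc].
pose c' k : E * E := ((c k).1 - v, (c k).2 - v).
have -> : cover_volume c = cover_volume c'.
  apply: eq_eseriesr => k _; congr EFin; apply: eq_bigr => i _.
  by rewrite /c' !mxE; ring.
apply: lebesgue_outer_le; split=> [k i|q /Xc[k _ qk]]; first by rewrite /c' !mxE lerD2r; exact: pc.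
exists k => // i; have := qk i; rewrite /c' !mxE !in_itv /=; lra.
Qed.

Variable h : hyperplane R d.+1.

Lemma height_continuous : continuous (height h).
Proof.
move=> q; apply: continuousB; last exact: cst_continuous.
apply: continuous_sum => i x; apply: continuousM; [exact: cst_continuous|exact: coord_continuous].
Qed.

Lemma heightD q t : height h (q + t *: normal h) =
  height h q + t * \sum_(i < d.+1) normal h ord0 i ^+ 2.
Proof.
rewrite /height addrAC mulr_sumr -big_split; congr (_ - _).
by apply: eq_bigr => i _; rewrite !mxE /=; ring.
Qed.

Lemma normal_sqr_gt0 : 0 < \sum_(i < d.+1) normal h ord0 i ^+ 2.
Proof.
rewrite lt_def sumr_ge0 ?andbT => [|i _]; last exact: sqr_ge0.
apply/eqP => /eqP; rewrite psumr_eq0 => [/allP n0|i _]; last exact: sqr_ge0.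
have /eqP := normal_neq0 h; apply; apply/rowP => i; rewrite mxE; apply/eqP.
by have := n0 i (mem_index_enum _); rewrite /= sqrf_eq0.
Qed.

(* Translates of a bounded piece of a hyperplane along the normal are disjoint
   and stay in a bounded box, so the piece is null. *)
Let piece (r t : R) : set E :=
  [set q | height h (q - t *: normal h) = 0 /\ forall i, - r < (q - t *: normal h) ord0 i <= r].

Let piece_measurable r t : measurable (piece r t : set cara).
Proof.
have -> : piece r t = [set q | height h (q - t *: normal h) = 0] `&`
    box (const_mx (- r) + t *: normal h) (const_mx r + t *: normal h).
  apply/seteqP; split=> q [h0 qb]; split=> // i; have := qb i; rewrite !mxE ?in_itv /=; lra.
apply: (@measurableI _ cara); last exact: box_caratheodory.
apply: borel_caratheodory; apply: borel_eq0.
have -> : (fun q => height h (q - t *: normal h)) =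
    (fun q => height h q + - t * \sum_(i < d.+1) normal h ord0 i ^+ 2).
  by apply/funext => q; rewrite -scaleNr heightD.
by move=> q; apply: continuousD; [exact: height_continuous|exact: cst_continuous].
Qed.

Let piece_disjoint r s t : s != t -> piece r s `&` piece r t = set0.
Proof.
move=> st; apply/seteqP; split=> // q [[h1 _] [h2 _]]; move: h1 h2.
rewrite -!scaleNr !heightD => h1 h2; have n0 := normal_sqr_gt0.
have : (s - t) * (\sum_(i < d.+1) normal h ord0 i ^+ 2) = 0 by lra.
by move/eqP; rewrite mulf_eq0 (gt_eqF n0) orbF subr_eq0 (negbTE st).
Qed.

Let piece_null r : lebesgue_outer (piece r 0) = 0%E.
Proof.
(* Infinitely many distinct shifts, all at most 1, so that one box [Q] contains every translate. *)
pose v k := k.+1%:R^-1 : R.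
have v_inj i j : i <> j -> v i != v j.
  by move=> ij; apply/eqP => /invr_inj/eqP; rewrite eqr_nat eqSS => /eqP.
pose M : R := `|r| + \sum_i `|normal h ord0 i|.
pose Q : E * E := (const_mx (- M), const_mx M).
have sub k : piece r (v k) `<=` box Q.1 Q.2.
  move=> q [_ qb] i; have := qb i; rewrite !mxE in_itv /=.
  have : `|v k * normal h ord0 i| <= \sum_i `|normal h ord0 i|.
    rewrite (bigD1 i) //=; apply: ler_wpDr; first exact: sumr_ge0.
    rewrite normrM -[leRHS]mul1r ler_wpM2r // ger0_norm ?invr_ge0 //.
    by rewrite invf_le1 ?ltr0n // ler1n.
  by rewrite ler_norml /M; have := ler_norm r; lra.
have trans k : (lebesgue_outer (piece r 0%R) <= lebesgue_outer (piece r (v k)))%E.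
  apply: le_trans (lebesgue_outer_translate _ (v k *: normal h)).
  by apply: lebesgue_outer_mono => q; rewrite /piece /= addrK scale0r subr0.
(* n disjoint translates, each at least as large as the piece, fit into [Q]. *)
have bound n : (n%:R%:E * lebesgue_outer (piece r 0%R) <= (box_volume Q)%:E)%E.
  pose lam : {outer_measure set E -> \bar R} := @lebesgue_outer R d.+1.
  have dis : trivIset setT (fun k => piece r (v k)).
    by apply/trivIsetP => i j _ _ ij; apply: piece_disjoint; apply: v_inj; apply/eqP.
  have := @caratheodory_additive R E lam _ (fun k => piece_measurable r (v k)) dis n (box Q.1 Q.2).
  under [in RHS]eq_bigr do rewrite ((setIidPr _ _).2 (sub _)).
  move=> sumE; apply: le_trans (_ : lam (box Q.1 Q.2) <= _)%E; last first.
    apply: (@lebesgue_outer_box _ _ Q) => i; rewrite !mxE.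
    have M0 : 0 <= M by rewrite addr_ge0 // sumr_ge0.
    by move: M M0 {Q sub sumE} => M M0; lra.
  apply: le_trans (_ : lam (box Q.1 Q.2 `&` \big[setU/set0]_(i < n) piece r (v i)) <= _)%E; last first.
    by apply: lebesgue_outer_mono => q [].
  rewrite sumE; elim: n {sumE} => [|n IH]; first by rewrite mul0e big_ord0.
  rewrite big_ord_recr /= -natr1 EFinD ge0_muleDl ?lee_fin // mul1e.
  by apply: leeD => //; exact: trans.
move: bound (lebesgue_outer_ge0 (piece r 0)); move: (lebesgue_outer _) (box_volume Q) => c V bound.
case: c bound => [c|/(_ 1)|//]; last by rewrite mul1e.
move=> bound; rewrite lee_fin le_eqVlt => /predU1P[<-//|c0]; exfalso.
have := bound (Num.truncn (V / c)).+1; rewrite -EFinM lee_fin leNgt => /negP; apply.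
by rewrite -ltr_pdivrMr // truncnS_gt.
Qed.

Lemma hyperplane_null : lebesgue_outer (hyperplane_set h) = 0%E.
Proof.
have cov : hyperplane_set h `<=` \bigcup_n piece n%:R 0.
  move=> q hq.
  have [n nP] : exists n, forall i, `|q ord0 i| < n%:R.
    exists (Num.truncn (\sum_i `|q ord0 i|)).+1 => i.
    apply: le_lt_trans (truncnS_gt _); rewrite (bigD1 i) //= lerDl.
    by apply: sumr_ge0.
  exists n => //; split; first by rewrite scale0r subr0.
  move=> i; have := nP i; rewrite scale0r subr0 ltr_norml; lra.
apply/eqP; rewrite eq_le lebesgue_outer_ge0 andbT.
apply: le_trans (lebesgue_outer_mono cov) _.
apply: le_trans (@lebesgue_outer_subadditive R d _) _.
by rewrite eseries0 // => k _ _; exact: piece_null.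
Qed.

Lemma set_mass_continuous (B : set E) (hB : finite_lebesgue_measurable B) :
  set_mass hB (hyperplane_set h) = 0%E.
Proof.
apply/eqP; rewrite eq_le lebesgue_outer_ge0 andbT -hyperplane_null.
by apply: lebesgue_outer_mono => q [].
Qed.

End SetMass.

(** * The moment curve *)

Lemma finite_poly_roots (R : idomainType) (p : {poly R}) : p != 0 -> finite_set [set t | root p t].
Proof.
have [n] := ubnP (size p); elim: n p => // n IH p pn p0.
have [[a /factor_theorem[q pE]]|no] := pselect (exists a, root p a); last first.
  rewrite (_ : [set t | root p t] = set0) //; apply/seteqP; split=> // t pt.
  by case: no; exists t.
have q0 : q != 0 by apply: contraNneq p0 => q0; rewrite pE q0 mul0r.
apply: (@sub_finite_set _ _ ([set t | root q t] `|` [set a])).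
  by move=> t /=; rewrite pE rootM root_XsubC => /orP[]; [left|right; apply/eqP].
rewrite finite_setU; split; last exact: finite_set1.
apply: IH => //; move: pn; rewrite pE size_Mmonic ?monicXsubC // size_XsubC addn2 /=.
by rewrite ltnS.
Qed.

Section MomentCurve.
Variables (R : realType) (d : nat).

Definition moment_curve (t : R) : 'rV[R]_d.+1 := \row_i t ^+ i.+1.

Lemma moment_curve_measurable (A : set (borel R d.+1)) : measurable A ->
  measurable (moment_curve @^-1` A : set (measurableTypeR R)).
Proof.
apply: (smallest_sub (C := sigma_algebra setT)
  (X := [set B | measurable (moment_curve @^-1` B : set (measurableTypeR R))])).
  split=> [|B mB|F mF] /=; first by rewrite preimage_set0.
    by rewrite setTD preimage_setC; exact: measurableC.
  by rewrite preimage_bigcup; apply: bigcup_measurable => n _; exact: mF.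
move=> U oU; apply: open_measurable; rewrite openE => t Ut.
have /nbhs_ballP[e /= e0 te] := open_nbhs_nbhs (conj oU Ut).
have near_pow : \forall s \near t, forall i : 'I_d.+1, `|t ^+ i.+1 - s ^+ i.+1| < e.
  apply: (@filter_forall R 'I_d.+1 (fun i s => `|t ^+ i.+1 - s ^+ i.+1| < e) (nbhs t) _) => i.
  by have /cvgrPdist_lt/(_ e e0) := @exprn_continuous R i.+1 t.
apply: filterS near_pow => s ts; apply: te; split=> // i j; rewrite !mxE; exact: ts.
Qed.

(** The parameters are roots of a polynomial whose coefficients are the normal vector and the
    offset, hence nonzero. *)
Lemma moment_curve_hyperplane (h : hyperplane R d.+1) :
  finite_set (moment_curve @^-1` hyperplane_set h).
Proof.
pose p : {poly R} := \poly_(i < d.+2) (if i is j.+1 then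
  (if insub j is Some k then normal h ord0 k else 0) else - offset h).
have p0 : p != 0.
  apply: contraNneq (normal_neq0 h) => p0; apply/eqP/rowP => i; rewrite mxE.
  have := congr1 (fun q : {poly R} => q`_i.+1) p0.
  by rewrite coef_poly coef0 ltnS ltn_ord valK.
apply: sub_finite_set (finite_poly_roots p0) => t /=; rewrite /hyperplane_set /= /height => ht.
rewrite /root horner_poly big_ord_recl /= expr0 mulr1 addrC; apply/eqP; rewrite -[RHS]ht.
by congr (_ + _); apply: eq_bigr => i _; rewrite valK mxE.
Qed.

(** The image of Lebesgue measure on [0, 1]: of total mass 1, and continuous because hyperplanes
    meet the curve in finitely many points. *)
Definition moment_mass (A : set (borel R d.+1)) : \bar R :=
  lebesgue_measure (`[0, 1] `&` moment_curve @^-1` A).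

Let moment_mass0 : moment_mass set0 = 0%E.
Proof. by rewrite /moment_mass preimage_set0 setI0 measure0. Qed.

Let moment_mass_ge0 A : (0 <= moment_mass A)%E.
Proof. exact: measure_ge0. Qed.

Let moment_mass_additive : semi_sigma_additive moment_mass.
Proof.
move=> F mF tF mU; rewrite /moment_mass preimage_bigcup setI_bigcupr.
have mI (A : set (borel R d.+1)) : measurable A -> measurable (`[0, 1] `&` moment_curve @^-1` A : set (measurableTypeR R)).
  by move=> mA; apply: measurableI => //; exact: moment_curve_measurable.
apply: (@measure_semi_sigma_additive _ _ _ (@lebesgue_measure R)) => [i|i j _ _|].
- exact: mI.
- move=> [t [[_ h1] [_ h2]]]; apply: (tF i j) => //; by exists (moment_curve t).
- by apply: bigcup_measurable => i _; exact: mI.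
Qed.

HB.instance Definition _ := isMeasure.Build _ (borel R d.+1) R moment_mass
  moment_mass0 moment_mass_ge0 moment_mass_additive.

Lemma moment_mass_setT : moment_mass setT = 1%E.
Proof. by rewrite /moment_mass preimage_setT setIT lebesgue_measure_itv /= lte01 oppr0 adde0. Qed.

Let moment_mass_fin : fin_num_fun moment_mass.
Proof.
move=> A mA; rewrite ge0_fin_numE ?moment_mass_ge0 //.
apply: le_lt_trans (_ : (moment_mass setT < +oo)%E); last by rewrite moment_mass_setT ltry.
by apply: le_measure; rewrite ?inE.
Qed.

HB.instance Definition _ := Measure_isFinite.Build _ (borel R d.+1) R moment_mass moment_mass_fin.

Lemma moment_mass_continuous : continuous_measure moment_mass.
Proof.
move=> h; have mh : measurable (moment_curve @^-1` hyperplane_set h : set (measurableTypeR R)).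
  by apply: moment_curve_measurable; apply: borel_eq0; exact: height_continuous.
apply: (@subset_measure0 _ _ _ (@lebesgue_measure R) _ (moment_curve @^-1` hyperplane_set h)).
- apply: measurableI => //; exact: mh.
- exact: mh.
- by move=> t [].
- by apply: countable_lebesgue_measure0; apply: finite_set_countable; exact: moment_curve_hyperplane.
Qed.

End MomentCurve.

(** * Equipartitions *)

Section Hyperplanes.
Variable R : realType.
Implicit Types (m mu : borel_measure R 5) (v x y z : 'I_6 -> R).

Definition linear_part v : 'rV[R]_5 := \row_i v (widen_ord (leqnSn 5) i).

Definition plane v (nz : linear_part v != 0) : hyperplane R 5 := Hyperplane (- v ord_max) nz.

Lemma height_plane v (nz : linear_part v != 0) : height (plane nz) = aff v.
Proof.
apply/funext => q; rewrite /height /= opprK; congr (_ + _).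
by apply: eq_bigr => i _; rewrite mxE.
Qed.

Lemma halfspace_plane v (nz : linear_part v != 0) e :
  halfspace (plane nz) e = [set q | 0 <= saff e v q].
Proof. by case: e; rewrite /halfspace height_plane //; apply/seteqP; split=> q; rewrite /= oppr_ge0. Qed.

(** A form at infinity has constant sign, so two nonempty sides certify a genuine hyperplane. *)
Lemma linear_part_neq0 v q q' : side true v q -> side false v q' -> linear_part v != 0.
Proof.
rewrite /side /saff /= => h h'; apply/eqP => nz.
have c r : aff v r = v ord_max.
  rewrite /aff big1 ?add0r // => i _; have /rowP/(_ i) := nz.
  by rewrite !mxE => ->; rewrite mul0r.
by move: h h'; rewrite !c; lra.
Qed.

Lemma halfspace_measurable (h : hyperplane R 5) e : measurable (halfspace h e : set (borel R 5)).
Proof.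
case: e; rewrite /halfspace; first by apply: borel_ge0; exact: height_continuous.
have -> : [set q | height h q <= 0] = [set q | 0 <= - height h q].
  by apply/seteqP; split=> q; rewrite /= oppr_ge0.
by apply: borel_ge0 => q; apply: continuousN; exact: height_continuous.
Qed.

Lemma hyperplane_measurable (h : hyperplane R 5) : measurable (hyperplane_set h : set (borel R 5)).
Proof. by apply: borel_eq0; exact: height_continuous. Qed.

Lemma measure_eq_null m (A C N : set (borel R 5)) : measurable A -> measurable C -> measurable N ->
  A `<=` C -> C `<=` A `|` N -> m N = 0%E -> m C = m A.
Proof.
move=> mA mC mN AC CAN N0; apply/eqP; rewrite eq_le; apply/andP; split.
  by rewrite -(measureU0 mA mN N0); apply: le_measure; rewrite ?inE //; exact: measurableU.
by apply: le_measure; rewrite ?inE.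
Qed.

Lemma halfspace_split v (nz : linear_part v != 0) e q : halfspace (plane nz) e q ->
  side e v q \/ hyperplane_set (plane nz) q.
Proof.
rewrite halfspace_plane /hyperplane_set /= height_plane le_eqVlt => /predU1P[|]; last by left.
by case: e => /=; rewrite /saff /= => h; right; lra.
Qed.

Lemma measure_halfspace m v (nz : linear_part v != 0) e : continuous_measure m ->
  m (halfspace (plane nz) e) = m (side e v).
Proof.
move=> mc; apply: (@measure_eq_null _ _ _ (hyperplane_set (plane nz))) => //.
- exact: side_measurable.
- exact: halfspace_measurable.
- exact: hyperplane_measurable.
- by move=> q; rewrite halfspace_plane /side /=; exact: ltW.
- by move=> q; exact: halfspace_split.
Qed.

(** The closed and the open orthant differ only inside the union of the hyperplanes, which is
    null. *)
Lemma measure_hyperorthant m k (v : 'I_k -> 'I_6 -> R) (nz : forall i, linear_part (v i) != 0)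
    (e : 'I_k -> bool) : continuous_measure m ->
  m (hyperorthant (fun i => plane (nz i)) e) = m (\bigcap_(i in setT) side (e i) (v i)).
Proof.
move=> mc.
pose N := \big[setU/set0]_(i < k) (hyperplane_set (plane (nz i)) : set (borel R 5)).
have [mN N0] : measurable N /\ m N = 0%E.
  rewrite /N; elim/big_rec: _ => [|i X _ [mX X0]]; first by rewrite measure0.
  have mh := @hyperplane_measurable (plane (nz i)).
  by split; [exact: measurableU|rewrite measureU0 //; exact: mc].
apply: (@measure_eq_null _ _ _ N) => //.
- by apply: fin_bigcap_measurable => // i _; exact: side_measurable.
- by apply: fin_bigcap_measurable => // i _; exact: halfspace_measurable.
- by move=> q sq i _; have := sq i I; rewrite halfspace_plane /side /=; exact: ltW.
- move=> q hq; have [sq|nsq] := pselect (forall i, side (e i) (v i) q).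
    by left=> i _; exact: sq.
  right; have /existsNP[i nsi] := nsq.
  have [//|hi] := halfspace_split (hq i I).
  by rewrite /N (bigD1 i) //; left.
Qed.

Lemma mass_measure (nu : mass R 5) : admissible nu -> exists2 m : borel_measure R 5,
  continuous_measure m & forall h, m (halfspace h true) = m (halfspace h false) -> bisects h nu.
Proof.
case: nu => [B hB|m mc]; last by exists m.
exists (set_mass hB : borel_measure R 5); first by move=> h; exact: set_mass_continuous.
by move=> h; rewrite /= /bisects_set ![B `&` _]setIC.
Qed.

Lemma mrestr_continuous m (D : set 'rV[R]_5) (mD : measurable (D : set (borel R 5))) :
  continuous_measure m -> continuous_measure (mrestr m mD : borel_measure R 5).
Proof.
move=> mc h; apply: (@subset_measure0 _ _ _ m _ (hyperplane_set h)) => //; last exact: mc.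
- by apply: measurableI => //; exact: hyperplane_measurable.
- exact: hyperplane_measurable.
Qed.

Lemma vol_nonempty m (A : set 'rV[R]_5) : vol m A != 0 -> exists q, A q.
Proof.
move=> nz; apply/set0P; apply: contra_neq nz => ->; by rewrite /vol measure0.
Qed.

Lemma imbalance_neq0 m z : continuous_measure m -> 0 < vol m setT -> in_cube_boundary z ->
  imbalance m z = 0 -> forall e, vol m (side e z) = vol m setT / 2.
Proof.
move=> mc m0 zS; rewrite /imbalance (vol_split mc zS measurableT) !setTI => h.
by case; lra.
Qed.

Theorem equipartition_bisectors mu (nu : 'I_4 -> mass R 5) (B : set 'rV[R]_5) :
  continuous_measure mu -> 0 < vol mu setT -> (forall i, admissible (nu i)) ->
  finite_lebesgue_measurable B ->
  exists h : 'I_4 -> hyperplane R 5, equipartition mu h /\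
    exists i j : 'I_4, [/\ i != j, forall k, bisects (h i) (nu k) & bisects_set (h j) B].
Proof.
move=> muc mu0 nuA hB.
have /fin_all_exists[nm nmP] : forall i : 'I_4, exists m : borel_measure R 5,
    continuous_measure m /\ forall h, m (halfspace h true) = m (halfspace h false) -> bisects h (nu i).
  by move=> i; have [m mc mP] := mass_measure (nuA i); exists m.
have [mB mBc mBP] := @mass_measure (MassSet B) hB.
have nmc i : continuous_measure (nm i) by have [] := nmP i.
have [w wS [wmu w0 w1 w2 w3]] := ham_sandwich muc (nmc (inord 0)) (nmc (inord 1)) (nmc (inord 2)) (nmc (inord 3)).
have wnu i : imbalance (nm i) w = 0.
  have -> : i = inord i by apply: val_inj; rewrite /= inordK.
  by case: i => [[|[|[|[|]]]]].
have whalf := imbalance_neq0 muc mu0 wS wmu.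
(* The halves of [mu] on the two sides of [w]; eighths of them are the sixteenths of [mu]. *)
pose m e : borel_measure R 5 := mrestr mu (side_measurable e w).
have mc e : continuous_measure (m e) by exact: mrestr_continuous.
have mE e A : vol (m e) A = vol mu (A `&` side e w) by [].
have mT e : vol (m e) setT = vol mu setT / 2 by rewrite mE setTI.
have [|x [y [z [[xS yS zS] [h1 h2 h3]]]]] := octants (mc true) (mc false) mBc.
  by rewrite mT divr_gt0.
have oct e e0 e1 e2 : orthant_vol (m e) x y z e0 e1 e2 = vol mu setT / 16.
  by case: e; rewrite ?h1 ?h2 mT; field.
pose v : 'I_4 -> 'I_6 -> R := fun i => nth w [:: w; x; y; z] i.
have full (e : 'I_4 -> bool) : vol mu (\bigcap_(i in setT) side (e i) (v i)) = vol mu setT / 16.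
  rewrite -(oct (e (inord 0)) (e (inord 1)) (e (inord 2)) (e (inord 3))) /orthant_vol mE.
  congr vol; apply/seteqP; split=> [q sq|q [[[sx sy] sz] sw] i _].
    have s (i : nat) (i4 : (i < 4)%N) : side (e (inord i)) (nth w [:: w; x; y; z] i) q.
      by have := sq (inord i) I; rewrite /v inordK.
    by split; [split; [split|]|]; [exact: (s 1)|exact: (s 2)|exact: (s 3)|exact: (s 0)].
  have -> : i = inord i by apply: val_inj; rewrite /= inordK.
  by case: i => [[|[|[|[|]]]]] //= _; rewrite /v inordK.
(* All 16 orthants have positive mass, so both sides of each form are nonempty; this excludes the
   hyperplane at infinity. *)
have nz i : linear_part (v i) != 0.
  have ne e : exists q, side e (v i) q.
    have /vol_nonempty[q sq] : vol mu (\bigcap_(i in setT) side ((fun=> e) i) (v i)) != 0.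
      by rewrite (full (fun=> e)) gt_eqF // divr_gt0.
    by exists q; exact: sq.
  by have [q qP] := ne true; have [q' q'P] := ne false; exact: linear_part_neq0 qP q'P.
have bis (n : borel_measure R 5) i : continuous_measure n -> imbalance n (v i) = 0 ->
    n (halfspace (plane (nz i)) true) = n (halfspace (plane (nz i)) false).
  move=> nc /subr0_eq; rewrite !measure_halfspace // -!volK; try exact: side_measurable.
  by move=> ->.
exists (fun i => plane (nz i)); split.
  move=> e; rewrite measure_hyperorthant // -volK; last first.
    by apply: fin_bigcap_measurable => // i _; exact: side_measurable.
  rewrite full -volK // -EFinM; congr EFin; rewrite mulrC.
  by rewrite -natrX.
(* Index 0 is [w], the common bisector of the [nu k]; the last index is [z], which halves [B]. *)
exists ord0, ord_max; split=> // [k|].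
  by have [_] := nmP k; apply; apply: bis.
by apply: mBP; apply: bis => //; rewrite /imbalance /v /= h3 subrr.
Qed.

End Hyperplanes.

Theorem corollary6 (R : realType) (mu : borel_measure R 5)
    (mu_continuous : continuous_measure mu) :
  (exists h : 'I_4 -> hyperplane R 5, equipartition mu h) /\
  (forall (nu : 'I_4 -> mass R 5) (B : set 'rV[R]_5),
    (forall i, admissible (nu i)) -> finite_lebesgue_measurable B ->
    exists h : 'I_4 -> hyperplane R 5,
      equipartition mu h /\
      exists i j : 'I_4,
        [/\ i != j, forall k, bisects (h i) (nu k) & bisects_set (h j) B]).
Proof.
suff main (nu : 'I_4 -> mass R 5) (B : set 'rV[R]_5) : (forall i, admissible (nu i)) ->
    finite_lebesgue_measurable B -> exists h : 'I_4 -> hyperplane R 5, equipartition mu h /\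
      exists i j : 'I_4, [/\ i != j, forall k, bisects (h i) (nu k) & bisects_set (h j) B].
  split=> //; have f0 : finite_lebesgue_measurable (set0 : set 'rV[R]_5).
    by split; [exact: caratheodory_measurable_set0|rewrite lebesgue_outer0 ltry].
  (* The first claim is the second one with empty sets. *)
  have [h [hmu _]] := main (fun=> MassSet set0) set0 (fun=> f0) f0.
  by exists h.
move=> nuA hB; have [T0|T0] := eqVneq (mu setT) 0%E; last first.
  apply: equipartition_bisectors => //.
  rewrite lt_def vol_ge0 andbT; apply: contra_neq T0 => T0.
  by rewrite -(volK mu measurableT) T0.
(* Any hyperplanes equipartition the zero measure, but they must still be finite and bisect the
   [nu i] and [B]; the moment curve supplies the positive mass that the argument needs. *)
have [||h [_ hb]] := @equipartition_bisectors R (@moment_mass R 4) nu B _ _ nuA hB.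
- exact: moment_mass_continuous.
- by rewrite /vol [X in fine X](moment_mass_setT R 4) ltr01.
exists h; split=> // e; rewrite T0 mule0; apply/eqP; rewrite eq_le measure_ge0 andbT -T0.
apply: le_measure; rewrite ?inE //.
by apply: fin_bigcap_measurable => // i _; exact: halfspace_measurable.
Qed.
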